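(* Let $(\mathscr A,\boldsymbol\varphi)$ be a surfaced probability space, $(\mathscr X_i)_{i\in I}$ a family of subsets of $\mathscr A$, and $\mathscr A_i$ the subalgebra of $\mathscr A$ generated by $\mathscr X_i$. Let $(g_0,n_0)\in\overline{\mathsf{Typ}}$. Then $(\mathscr X_i)_{i\in I}$ is $(g_0,n_0)$-free if and only if $(\mathscr A_i)_{i\in I}$ is $(g_0,n_0)$-free.
   Context: **Surfaced permutations.** $P(d)$ is the lattice of set partitions of $[d]$ ($\vee$ = join, $\mathbf 1_d=\{[d]\}$); $\mathbf 0_\alpha$ is the partition into supports of cycles of $\alpha\in S(d)$. $\mathbb{PS}(d)$ is the set of triples $(\mathcal A,\alpha,g)$ with $\mathcal A\in P(d)$, $\alpha\in S(d)$, $\mathbf 0_\alpha\le\mathcal A$ and $g:\mathcal A\to\frac12\mathbb Z_{\ge0}$. For $(\mathcal A,\alpha)$ on a set of size $d$: $|(\mathcal A,\alpha)|=2(d-\#\mathcal A)-(d-\#\mathbf 0_\alpha)$ and $|(\mathcal A,\alpha,g)|=|(\mathcal A,\alpha)|+\sum_{A\in\mathcal A}2g(A)$. Product: $(\mathcal A,\alpha,g)\odot(\mathcal B,\beta,h)=(\mathcal A\vee\mathcal B,\alpha\circ\beta,k)$ with, for each block $C\in\mathcal A\vee\mathcal B$, $$k(C)=\tfrac12\big(|(\mathcal A_{|C},\alpha_{|C},g_{|C})|+|(\mathcal B_{|C},\beta_{|C},h_{|C})|-|(\{C\},(\alpha\circ\beta)_{|C})|\big).$$ Convolution of $f_1:\mathbb{PS}(d)\to\mathbb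 C$ with $f_2:\mathbb{PS}(d)\times\mathscr A^d\to\mathbb C$: $(f_1\circledast f_2)(\mathcal C,\gamma,k)[a_1,\ldots,a_d]=\sum_{(\mathcal A,\alpha,g)\odot(\mathcal B,\beta,h)=(\mathcal C,\gamma,k)}f_1(\mathcal A,\alpha,g)f_2(\mathcal B,\beta,h)[a_1,\ldots,a_d]$ (similarly for two scalar functions). The zeta function is $\boldsymbol\zeta(\mathcal A,\alpha,g)=1$ if $\mathcal A=\mathbf 0_\alpha$ and $g=0$, else $0$; $\boldsymbol\mu$ is its two-sided $\circledast$-inverse (it exists), the unit being the indicator of $(\mathbf 0_{\mathrm{id}},\mathrm{id},0)$. **Surfaced probability space (SPS).** A unital associative $\mathbb C$-algebra $\mathscr A$ with symmetric $n$-linear forms $\varphi_{g,n}:\mathscr A^n\to\mathbb C$ ($g\in\frac12\mathbb Z_{\ge0}$, $n\ge1$), tracial in each argument, with $\varphi_{0,1}(1)=1$ and $\varphi_{g,n}(1,a_2,\ldots,a_n)=0$ for $(g,n)\ne(0,1)$. **Moments and free cumulants.** For $\sigma\in S(d)$ with cycles $(i_{1,1}\,i_{1,2}\cdots),\ldots,(i_{n,1}\,i_{n,2}\cdots)$ (so $\sigma(i_{j,l})=i_{j,l+1}$), put $\phi(\mathbf 1_d,\sigma,g)[a_1,\ldots,a_d]=\varphi_{g,n}(a_{i_{1,1}}a_{i_{1,2}}\cdots,\ldots,a_{i_{n,1}}a_{i_{n,2}}\cdots)$ and extend multiplicatively: $\phi(\mathcal A,\alpha,g)[a_1,\ldots,a_d]=\prod_{A\in\mathcal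 A}\phi(\mathbf 1_{\#A},\alpha_{|A},g(A))[(a_i)_{i\in A}]$. Put $\phi^\vee=\boldsymbol\mu\circledast\phi$. For $k_1,\ldots,k_n\ge1$, $d=\sum k_i$, let $\lambda=\lambda(\mathbf k)$ be the decreasing rearrangement of $\mathbf{k}$ and $\pi_\lambda=(1\cdots\lambda_1)(\lambda_1+1\cdots\lambda_1+\lambda_2)\cdots$; the free cumulants are $\kappa_{g;k_1,\ldots,k_n}(a_1,\ldots,a_d)=\phi^\vee(\mathbf 1_d,\pi_{\lambda},g)[a_1,\ldots,a_d]$. **Types.** $\mathsf{Typ}=\frac12\mathbb Z_{\ge0}\times\mathbb Z_{>0}$, ordered by $(g,n)\preceq(g',n')$ iff $g\le g'$ and $g+n\le g'+n'$. $\overline{\mathsf{Typ}}$ is $\mathsf{Typ}$ together with elements $(g,\infty)$, $g\in\frac12\mathbb Z_{\ge0}$, and $(\infty,\infty)$; $(g,n)\preceq(g',\infty)$ iff $g\le g'$, and every element is $\preceq(\infty,\infty)$. **Freeness.** A family $(\mathscr X_i)_{i\in I}$ of subsets of $\mathscr A$ is $(g_0,n_0)$-free if for all $(g,n)\in\mathsf{Typ}$ with $(g,n)\preceq(g_0,n_0)$, all $d$, all $a_p\in\mathscr X_{i(p)}$ ($p\in[d]$) and all $k_1,\ldots,k_n>0$ with $\sum k_i=d$, one has $\kappa_{g;k_1,\ldots,k_n}(a_1,\ldots,a_d)=0$ whenever $i(p)\ne i(q)$ for some $p,q\in[d]$. *)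

(* Defs.v *)
From HB Require Import structures.
(* The classical sets come first: cover, partition, pblock, ... are then those
   of finset. *)
From mathcomp Require Import boolp classical_sets functions cardinality fsbigop.
From mathcomp Require Import all_boot all_order all_algebra all_fingroup.
From mathcomp Require Import zify.

Set Implicit Arguments.
Unset Strict Implicit.
Unset Printing Implicit Defensive.
Import Order.TTheory GRing.Theory Num.Theory.
Local Open Scope ring_scope.

(* Half-integers g >= 0 are encoded by the natural number 2g. *)
Notation halfnat := nat (only parsing).

Definition refines d (P Q : {set {set 'I_d}}) : bool :=
  [forall B in P, exists C in Q, B \subset C].

Definition part_join d (P Q : {set {set 'I_d}}) : {set {set 'I_d}} :=
  equivalence_partition
    (connect [rel x y : 'I_d | (y \in pblock P x) || (y \in pblock Q x)]) [set: 'I_d].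

Section PartJoin.
Variables (d : nat) (P Q : {set {set 'I_d}}).
Hypotheses (partP : partition P [set: 'I_d]) (partQ : partition Q [set: 'I_d]).

Let e := [rel x y : 'I_d | (y \in pblock P x) || (y \in pblock Q x)].

Let mem_cover R (x : 'I_d) : partition R [set: 'I_d] -> x \in cover R.
Proof. by move=> partR; rewrite (cover_partition partR) finset.inE. Qed.

Let esym : connect_sym e.
Proof.
apply: sym_connect_sym => x y /=.
have sym R : partition R [set: 'I_d] -> (y \in pblock R x) = (x \in pblock R y).
  move=> partR; have /and3P[_ triv _] := partR.
  by rewrite -!eq_pblock ?mem_cover // eq_sym.
by rewrite !sym.
Qed.

Let equiv_e : {in [set: 'I_d] & &, equivalence_rel (connect e)}.
Proof.
apply: in3W; apply/equivalence_relP.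
by split=> [|x y]; [exact: connect0 | exact: same_connect].
Qed.

Lemma part_joinP : partition (part_join P Q) [set: 'I_d].
Proof. exact: equivalence_partitionP. Qed.

Let join_ub R : partition R [set: 'I_d] ->
  (forall x, pblock R x \subset [set y | e x y]) -> refines R (part_join P Q).
Proof.
move=> partR Re; apply/forall_inP => B RB; have [/eqP covR triv n0] := and3P partR.
have [x Bx] : exists x, x \in B by apply/set0Pn; apply: contraNneq n0 => <-.
apply/exists_inP; exists [set y in [set: 'I_d] | connect e x y].
  by apply: imset_f; rewrite finset.inE.
apply/subsetP => y By; rewrite !finset.inE /=; apply: connect1.
by have /subsetP/(_ y) := Re x; rewrite (def_pblock triv RB Bx) finset.inE; apply.
Qed.

Lemma part_join_ubl : refines P (part_join P Q).
Proof. by apply: join_ub => // x; apply/subsetP => y; rewrite finset.inE /= => ->. Qed.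

Lemma part_join_ubr : refines Q (part_join P Q).
Proof.
by apply: join_ub => // x; apply/subsetP => y; rewrite finset.inE /= orbC => ->.
Qed.

Lemma part_join_least R : partition R [set: 'I_d] ->
  refines P R -> refines Q R -> refines (part_join P Q) R.
Proof.
move=> partR /forall_inP PR /forall_inP QR.
have /and3P[/eqP covR trivR _] := partR.
have sub S x y : partition S [set: 'I_d] ->
    (forall B, B \in S -> [exists C in R, B \subset C]) ->
    y \in pblock S x -> pblock R x = pblock R y.
  move=> partS SR Sxy.
  have Sx : x \in pblock S x by rewrite mem_pblock mem_cover.
  have /exists_inP[C RC /subsetP BC] := SR _ (pblock_mem (mem_cover x partS)).
  by rewrite (def_pblock trivR RC (BC x Sx)) (def_pblock trivR RC (BC y Sxy)).
have eR x y : e x y -> pblock R x = pblock R y.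
  by case/orP; apply: sub.
apply/forall_inP => _ /imsetP[x _ ->]; apply/exists_inP.
exists (pblock R x); first by rewrite pblock_mem ?mem_cover.
apply/subsetP => y; rewrite !finset.inE /= => /connectP[p ep ->] {y}.
suff -> : pblock R x = pblock R (last x p) by rewrite mem_pblock mem_cover.
by elim: p x ep => //= z p IHp x /andP[/eR -> /IHp].
Qed.

End PartJoin.

(* The genus function of (P, s, G) is defined on the blocks of P; outside of P
   it is required to be 0, so that each triple has a unique representative. *)
Definition is_surfperm d
    (x : {set {set 'I_d}} * {perm 'I_d} * {ffun {set 'I_d} -> halfnat}) : bool :=
  [&& partition x.1.1 [set: 'I_d], refines (porbits x.1.2) x.1.1 &
      [forall B, (B \notin x.1.1) ==> (x.2 B == 0%N)]].

Record surfperm d := SurfPerm {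
  surfperm_val :> {set {set 'I_d}} * {perm 'I_d} * {ffun {set 'I_d} -> halfnat};
  surfpermP : is_surfperm surfperm_val }.

HB.instance Definition _ d := [isSub for @surfperm_val d].
HB.instance Definition _ d := [Choice of surfperm d by <:].

Definition sp_part d (x : surfperm d) : {set {set 'I_d}} := (val x).1.1.
Definition sp_perm d (x : surfperm d) : {perm 'I_d} := (val x).1.2.
Definition sp_genus d (x : surfperm d) : {ffun {set 'I_d} -> halfnat} :=
  (val x).2.

(* |(P_{|C}, s_{|C})| for a union C of blocks of P: the blocks of P_{|C} are
   the blocks of P included in C, and likewise for the cycles of s_{|C}. *)
Definition pp_size d (P : {set {set 'I_d}}) (s : {perm 'I_d}) (C : {set 'I_d})
    : int :=
  2 * (#|C|%:Z - #|P ::&: C|%:Z) - (#|C|%:Z - #|porbits s ::&: C|%:Z).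

(* |(P_{|C}, s_{|C}, g_{|C})| *)
Definition sp_size d (x : surfperm d) (C : {set 'I_d}) : int :=
  pp_size (sp_part x) (sp_perm x) C
  + \sum_(B in sp_part x ::&: C) (sp_genus x B)%:Z.

(* x (.) y = z. The equality of genera is multiplied by 2 and stated in int, so
   that no subtraction is truncated. Products of permutations are composed from
   left to right in the library: (s * t) i = t (s i). *)
Definition sp_prod d (x y z : surfperm d) : bool :=
  [&& sp_part z == part_join (sp_part x) (sp_part y),
      sp_perm z == (sp_perm y * sp_perm x)%g &
      [forall C in sp_part z,
         (sp_genus z C)%:Z
         == sp_size x C + sp_size y C - pp_size [set C] (sp_perm z) C]].

Section Finiteness.
Variable d : nat.

Let card_blocks (P : {set {set 'I_d}}) (s : {perm 'I_d}) (C : {set 'I_d}) :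
  partition P [set: 'I_d] -> refines (porbits s) P ->
  (#|P ::&: C| <= #|porbits s ::&: C| <= #|C|)%N.
Proof.
move=> partP /forall_inP ref; have /and3P[/eqP covP triv P0] := partP.
pose r (B : {set 'I_d}) : option 'I_d := [pick x in B].
have rP (S : {set {set 'I_d}}) B : finset.set0 \notin S -> B \in S ->
    exists2 x, r B = Some x & x \in B.
  move=> S0 SB; rewrite /r; case: (pickP (mem B)) => [x Bx|B0]; first by exists x.
  have e : B = finset.set0 by apply/setP => x; rewrite finset.inE; apply: B0.
  by move: S0; rewrite -e SB.
have orb0 : finset.set0 \notin porbits s.
  by apply/imsetP => -[x _ /setP/(_ x)]; rewrite porbit_id finset.inE.
have sub_orb B x : B \in P -> x \in B -> porbit s x \subset B.
  move=> PB Bx; have /exists_inP[C' PC' sub] := ref _ (imset_f _ (isT : x \in 'I_d)).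
  have C'x : x \in C' by apply: (subsetP sub); apply: porbit_id.
  by rewrite -(def_pblock triv PB Bx) (def_pblock triv PC' C'x).
apply/andP; split.
- pose f B := oapp (porbit s) finset.set0 (r B).
  have f_inj : {in P ::&: C &, injective f}.
    move=> B1 B2; rewrite !finset.inE => /andP[PB1 _] /andP[PB2 _].
    rewrite /f.
    have [[x1 e1 Bx1] [x2 e2 Bx2]] := (rP _ _ P0 PB1, rP _ _ P0 PB2).
    rewrite e1 e2 /= => e; have := subsetP (sub_orb _ _ PB2 Bx2) x1.
    rewrite -e porbit_id => /(_ isT) Bx1'.
    by rewrite -(def_pblock triv PB1 Bx1) (def_pblock triv PB2 Bx1').
  rewrite -(card_in_imset f_inj); apply/subset_leq_card/subsetP => D /imsetP[B].
  rewrite finset.inE => /andP[PB BC] -> {D}; have [x e Bx] := rP _ _ P0 PB.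
  by rewrite finset.inE /f e /= imset_f // (subset_trans (sub_orb _ _ PB Bx)).
- apply: leq_trans (leq_imset_card (porbit s) C).
  apply/subset_leq_card/subsetP => B; rewrite finset.inE => /andP[/imsetP[x _ ->] BC].
  by apply: imset_f; apply: (subsetP BC); apply: porbit_id.
Qed.

Let pp_size_ge0 (x : surfperm d) (C : {set 'I_d}) :
  0 <= pp_size (sp_part x) (sp_perm x) C.
Proof.
have /and3P[partx refx _] := surfpermP x.
have /andP[le1 le2] := card_blocks C partx refx.
rewrite /pp_size /sp_part /sp_perm; move: le1 le2 => /=; lia.
Qed.

Local Open Scope classical_set_scope.

Let finite_bounded N :
  finite_set [set x : surfperm d | forall B, (sp_genus x B <= N)%N].
Proof.
pose F := ({set {set 'I_d}} * {perm 'I_d} * {ffun {set 'I_d} -> 'I_N.+1})%type.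
pose dec (u : F) := (u.1, [ffun B => u.2 B : nat]).
apply: (@sub_finite_set _ _ [set` pmap (insub : _ -> option (surfperm d))
    [seq dec u | u <- enum {: F}]]); last exact: finite_seq.
move=> x /= xN; rewrite mem_pmap_sub; apply/mapP.
exists ((val x).1, [ffun B => inord (sp_genus x B)]); first by rewrite mem_enum.
rewrite /dec /= [LHS]surjective_pairing; congr pair.
by apply/ffunP => B; rewrite !ffunE inordK // ltnS.
Qed.

Let size_bound (x : surfperm d) (B C : {set 'I_d}) :
  B \in sp_part x -> B \subset C -> (sp_genus x B)%:Z <= sp_size x C.
Proof.
move=> xB BC; rewrite /sp_size (bigD1 B) /=; last by rewrite finset.inE xB.
by rewrite addrCA lerDl addr_ge0 ?pp_size_ge0 ?sumr_ge0.
Qed.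

Let size_ge0 (x : surfperm d) (C : {set 'I_d}) : 0 <= sp_size x C.
Proof. by rewrite addr_ge0 ?pp_size_ge0 ?sumr_ge0. Qed.

Lemma finite_sp_prod (z : surfperm d) :
  finite_set [set p : surfperm d * surfperm d | sp_prod p.1 p.2 z].
Proof.
pose N := (\sum_(C in sp_part z) (sp_genus z C + 2 * #|C|))%N.
have bound (x y : surfperm d) (C : {set 'I_d}) : C \in sp_part z ->
    (sp_genus z C)%:Z = sp_size x C + sp_size y C - pp_size [set C]%SET (sp_perm z) C ->
    sp_size x C <= N%:Z /\ sp_size y C <= N%:Z.
  move=> zC e; have := size_ge0 x C; have := size_ge0 y C.
  have le_pp : pp_size [set C]%SET (sp_perm z) C <= (2 * #|C|)%:Z.
    rewrite /pp_size; have : (#|porbits (sp_perm z) ::&: C| <= #|C|)%N.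
      by have /and3P[partz refz _] := surfpermP z; have /andP[] := card_blocks C partz refz.
    by lia.
  have : (sp_genus z C + 2 * #|C| <= N)%N.
    by rewrite /N (bigD1 C) //= leq_addr.
  by move: e le_pp; lia.
apply: (@sub_finite_set _ _ ([set x | forall B, (sp_genus x B <= N)%N] `*`
   [set x | forall B, (sp_genus x B <= N)%N])); last exact: finite_setX.
have gen_le (x : surfperm d) : refines (sp_part x) (sp_part z) ->
    (forall C, C \in sp_part z -> sp_size x C <= N%:Z) ->
    forall B, (sp_genus x B <= N)%N.
  move=> /forall_inP ref leN B; have [xB|xB] := boolP (B \in sp_part x).
    have /exists_inP[C zC BC] := ref _ xB.
    by have := size_bound xB BC; have := leN C zC; lia.
  have /and3P[_ _ /forallP/(_ B)] := surfpermP x.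
  by rewrite xB /= => /eqP; rewrite /sp_genus => ->.
move=> [x y] /= /and3P[/eqP zP _ /forall_inP zG].
have [/and3P[partx _ _] /and3P[party _ _]] := (surfpermP x, surfpermP y).
split; apply: gen_le => [|C zC]; rewrite ?zP ?part_join_ubl ?part_join_ubr //.
- by have [] := bound x y C zC (eqP (zG C zC)).
- by have [] := bound x y C zC (eqP (zG C zC)).
Qed.

End Finiteness.

Local Open Scope classical_set_scope.

(* The sum is finite by finite_sp_prod. *)
Definition conv (K : fieldType) d (f1 f2 : surfperm d -> K) : surfperm d -> K :=
  fun z => \sum_(p \in [set p : surfperm d * surfperm d | sp_prod p.1 p.2 z])
             f1 p.1 * f2 p.2.

Definition sp_unit (K : fieldType) d (x : surfperm d) : K :=
  [&& sp_part x == porbits (1 : {perm 'I_d})%g, sp_perm x == 1%g &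
      sp_genus x == [ffun=> 0%N]]%:R.

Definition sp_zeta (K : fieldType) d (x : surfperm d) : K :=
  ((sp_part x == porbits (sp_perm x)) && (sp_genus x == [ffun=> 0%N]))%:R.

Definition sp_mu (K : fieldType) d : surfperm d -> K :=
  xget (fun=> 0) [set m : surfperm d -> K |
    conv m (@sp_zeta K d) = @sp_unit K d /\ conv (@sp_zeta K d) m = @sp_unit K d].

(* phi G [:: a_1; ...; a_n] is phi_{G/2, n}(a_1, ..., a_n); the value on the
   empty sequence is irrelevant, as n >= 1. *)
Record is_sps (K : fieldType) (A : algType K) (phi : halfnat -> seq A -> K)
    : Prop := IsSps {
  sps_linear : forall (G : halfnat) (s t : seq A) (c : K) (x y : A),
    phi G (s ++ (c *: x + y) :: t)
    = c * phi G (s ++ x :: t) + phi G (s ++ y :: t);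
  sps_sym : forall (G : halfnat) (s t : seq A), perm_eq s t -> phi G s = phi G t;
  sps_trace : forall (G : halfnat) (s t : seq A) (x y : A),
    phi G (s ++ (x * y) :: t) = phi G (s ++ (y * x) :: t);
  sps_unit : phi 0%N [:: 1] = 1;
  sps_unit0 : forall (G : halfnat) (s : seq A),
    (G, size s) <> (0%N, 0%N) -> phi G (1 :: s) = 0 }.

(* The products of the a_i along the cycles of s included in B; each cycle is
   read from its canonical representative, which is immaterial since the forms
   are tracial. *)
Definition cycle_words (K : fieldType) (A : algType K) d (s : {perm 'I_d})
    (B : {set 'I_d}) (a : 'I_d -> A) : seq A :=
  [seq \prod_(j <- fingraph.orbit s i) a j | i <- enum 'I_d & froots s i && (i \in B)].

Definition sp_moment (K : fieldType) (A : algType K)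
    (phi : halfnat -> seq A -> K) d (a : 'I_d -> A) (x : surfperm d) : K :=
  \prod_(B in sp_part x) phi (sp_genus x B) (cycle_words (sp_perm x) B a).

Definition sp_cumulant (K : fieldType) (A : algType K)
    (phi : halfnat -> seq A -> K) d (a : 'I_d -> A) : surfperm d -> K :=
  conv (@sp_mu K d) (sp_moment phi a).

(* (0 ... l_1-1)(l_1 ... l_1+l_2-1)..., and the identity from sumn l on *)
Fixpoint cycles_next (l : seq nat) (i : nat) : nat :=
  if l is m :: l' then
    if (i < m)%N then (if i.+1 == m then 0 else i.+1)%N
    else (m + cycles_next l' (i - m))%N
  else i.

Lemma cycles_next_lt (l : seq nat) (i : nat) :
  (i < sumn l)%N -> (cycles_next l i < sumn l)%N.
Proof.
elim: l i => [|m l IHl] i //= lt_i; case: (ltnP i m) => [lt_im|le_mi].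
  case: ifPn => [_|ne_im]; first by apply: leq_ltn_trans lt_i.
  by rewrite (leq_trans _ (leq_addr _ _)) // ltn_neqAle ne_im.
by rewrite ltn_add2l IHl // -(ltn_add2l m) subnKC.
Qed.

Lemma cycles_next_inj (l : seq nat) : injective (cycles_next l).
Proof.
have lt_next m i n : (i < m)%N ->
    (if i.+1 == m then 0 else i.+1)%N = (m + n)%N -> False.
  move=> lt_im; case: ifPn => [_|ne_im] e.
    by move: lt_im; rewrite ltnNge (leq_trans (leq_addr n m)) // -e.
  by have := leq_addr n m; rewrite -e leqNgt ltn_neqAle ne_im lt_im.
elim: l => [|m l IHl] i j //=.
case: (ltnP i m) => [lt_im|le_mi]; case: (ltnP j m) => [lt_jm|le_mj].
- case: ifPn => [/eqP ei|_]; case: ifPn => [/eqP ej|_] //; last by case.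
  by move=> _; apply: succn_inj; rewrite ei ej.
- by move=> /lt_next -/(_ lt_im).
- by move=> /esym/lt_next -/(_ lt_jm).
- by move=> /addnI /IHl e; rewrite -(subnKC le_mi) e subnKC.
Qed.

Lemma cycles_next_ord d (l : seq nat) (hl : sumn l = d) (i : 'I_d) :
  (cycles_next l i < d)%N.
Proof. by subst d; apply: cycles_next_lt. Qed.

Lemma cycles_ord_inj d (l : seq nat) (hl : sumn l = d) :
  injective (fun i : 'I_d => Ordinal (cycles_next_ord hl i)).
Proof. by move=> i j [/cycles_next_inj/val_inj]. Qed.

Definition cycles_perm d (l : seq nat) (hl : sumn l = d) : {perm 'I_d} :=
  perm (@cycles_ord_inj d l hl).

Lemma sumn_sort (k : seq nat) d : sumn k = d -> sumn (sort geq k) = d.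
Proof. by move=> <-; apply/perm_sumn; rewrite perm_sort. Qed.

Lemma sp_top_subproof d (s : {perm 'I_d.+1}) (G : halfnat) :
  is_surfperm ([set [set: 'I_d.+1]]%SET, s,
    [ffun B : {set 'I_d.+1} => if B == [set: 'I_d.+1]%SET then G else 0%N]).
Proof.
apply/and3P; split=> /=.
- apply/and3P; split.
  + by rewrite /cover big_set1.
  + by rewrite /trivIset /cover !big_set1.
  + rewrite inE; apply/eqP => e.
    by have := finset.in_setT (@ord0 d); rewrite -e finset.inE.
- apply/forall_inP => B _; apply/exists_inP.
  by exists [set: 'I_d.+1]%SET; rewrite ?finset.inE ?subsetT.
- by apply/forallP => B; apply/implyP; rewrite finset.inE ffunE => /negbTE ->.
Qed.

(* (1_d, s, G/2), for d >= 1 *)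
Definition sp_top d (s : {perm 'I_d.+1}) (G : halfnat) : surfperm d.+1 :=
  SurfPerm (sp_top_subproof s G).

Definition free_cumulant (K : fieldType) (A : algType K)
    (phi : halfnat -> seq A -> K) (G : halfnat) d (k : seq nat)
    (hk : sumn k = d.+1) (a : 'I_d.+1 -> A) : K :=
  sp_cumulant phi a (sp_top (cycles_perm (sumn_sort hk)) G).

Record typ := Typ {
  typ_genus : halfnat;
  typ_num : nat;
  typ_num_gt0 : (0 < typ_num)%N }.

Inductive typ_ext :=
  | TypFin of typ
  | TypInf of halfnat
  | TypInfInf.

(* The order between elements of Typ and of its extension; g + n is doubled. *)
Definition typ_le (t : typ) (u : typ_ext) : bool :=
  match u with
  | TypFin t' => (typ_genus t <= typ_genus t')%N &&
      (typ_genus t + (typ_num t).*2 <= typ_genus t' + (typ_num t').*2)%N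
  | TypInf G' => (typ_genus t <= G')%N
  | TypInfInf => true
  end.

(* As n and the k_i are positive, so is their sum, written d.+1 here. *)
Definition is_free (K : fieldType) (A : algType K) (phi : halfnat -> seq A -> K)
    (I : Type) (X : I -> set A) (t0 : typ_ext) : Prop :=
  forall t : typ, typ_le t t0 ->
  forall (d : nat) (i : 'I_d.+1 -> I) (a : 'I_d.+1 -> A),
    (forall p, X (i p) (a p)) ->
  forall (k : seq nat) (hk : sumn k = d.+1),
    size k = typ_num t -> all (leq 1) k ->
    (exists p q, i p <> i q) ->
    free_cumulant phi (typ_genus t) hk a = 0.

(* subalg_closed includes 1: the generated subalgebra is unital. *)
Definition gen_subalg (K : fieldType) (A : algType K) (X : set A) : set A :=
  smallest [set S : set A | GRing.subalg_closed (mem S)] X.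

(* Main.v *)
Require Import Defs.
From mathcomp Require Import all_boot all_order all_algebra.
From mathcomp Require Import classical_sets reals.
From mathcomp.real_closed Require Import complex.
From mathcomp Require Import boolp classical_sets functions cardinality fsbigop.
From mathcomp Require Import all_boot all_order all_algebra all_fingroup.
From mathcomp Require Import zify ring lra.

(* Let kappa be the free cumulants and phi the moments of (a_1, ..., a_d), so that
   phi = zeta * kappa. Every permutation of d + 1 points is geodesically a product of one
   fixing a point q and of a transposition (q j) (Jucys-Murphy), so zeta_{d+1} factors as
   zeta_d * J and as J * zeta_d. As the moments of (..., bc, ...) are those of (..., b, c, ...)
   at the surfaced permutation ins p x in which q is inserted after p, this gives the
   product formula
     kappa[..., bc, ...](x) = sum_j sum_(y with (q j) . y = ins p x) kappa[..., b, c, ...](y),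
   and similarly kappa vanishes at the one-block elements when d > 1 and some argument is 1.
   For x = (1_d, s, g) the elements y on the right have one or two blocks, whose types are
   below (g, #cycles s). In the two-block case b and c lie in different blocks, so one of the
   blocks is mixed if the family of arguments is; kappa being multiplicative over blocks,
   all terms vanish. Hence an argument may be replaced by products of generators one factor
   at a time. *)

Set Implicit Arguments.
Unset Strict Implicit.
Unset Printing Implicit Defensive.
Import Order.TTheory GRing.Theory Num.Theory.
Local Open Scope ring_scope.

(** * Blocks, saturated sets and sizes *)

(** The function mu is never computed. The product of a permutation (an element of the support of
    zeta) with any y exists, so convolution by zeta is a sum over fibres of maps, and it is
    unitriangular for the total size, which is additive. Two functions thus agree as soon as their
    images under zeta do, and identities between cumulants are checked on moments.

    A transposition (q j) with j <> q has size 1. Comparing sizes in (q j) . y = ins p x gives: if y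
    has one block, either its genus is g and it has one cycle fewer, or its genus is g - 1 and it
    has one cycle more; if y has two blocks, their genera add up to g and their numbers of cycles to
    #cycles s + 1. A gain of a cycle leaves g + n unchanged, which is why the order on types bounds
    g + n.

    The blocks of y are arbitrary subsets with unsorted cycles, whereas freeness speaks of standard
    permutations only. Blocks are therefore relabelled along arbitrary bijections, and vanishing is
    assumed for the subtuples along all injections. *)

Lemma mem_porbit1 (T : finType) (s : {perm T}) i : s i \in porbit s i.
Proof. by have := mem_porbit s 1 i; rewrite expg1. Qed.

Section Points.
Variable d : nat.
Implicit Types (w x y z : surfperm d) (C E : {set 'I_d}) (i j : 'I_d).

Definition cl w i : {set 'I_d} := pblock (sp_part w) i.
Definition gn w i : nat := sp_genus w (cl w i).
Definition saturated w C : bool := [forall i in C, cl w i \subset C].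

Lemma sp_partP w : partition (sp_part w) [set: 'I_d].
Proof. by have /and3P[] := surfpermP w. Qed.

Lemma sp_cover w i : i \in cover (sp_part w).
Proof. by rewrite (cover_partition (sp_partP w)) in_setT. Qed.

Lemma sp_triv w : trivIset (sp_part w).
Proof. by have /and3P[] := sp_partP w. Qed.

Lemma cl_id w i : i \in cl w i.
Proof. by rewrite mem_pblock sp_cover. Qed.

Lemma cl_mem w i : cl w i \in sp_part w.
Proof. by rewrite pblock_mem ?sp_cover. Qed.

Lemma cl_eq w i j : (cl w i == cl w j) = (j \in cl w i).
Proof. by rewrite eq_pblock ?sp_triv ?sp_cover. Qed.

Lemma cl_sym w i j : (j \in cl w i) = (i \in cl w j).
Proof. by rewrite -!cl_eq eq_sym. Qed.

Lemma cl_trans w i j : j \in cl w i -> cl w j = cl w i.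
Proof. by rewrite -cl_eq => /eqP. Qed.

Lemma cl_blockP w B : reflect (exists i, B = cl w i) (B \in sp_part w).
Proof.
apply: (iffP idP) => [wB|[i ->]]; last exact: cl_mem.
have [i Bi] : exists i, i \in B.
  apply/set0Pn; have /and3P[_ _] := sp_partP w.
  by apply: contraNneq => <-.
by exists i; rewrite /cl (def_pblock (sp_triv w) wB Bi).
Qed.

Lemma perm_cl w i : sp_perm w i \in cl w i.
Proof.
have /and3P[_ /forall_inP ref _] := surfpermP w.
have /ref/exists_inP[B wB sB] : porbit (sp_perm w) i \in porbits (sp_perm w).
  exact: imset_f.
have Bi : i \in B by apply: (subsetP sB); apply: porbit_id.
rewrite /cl (def_pblock (sp_triv w) wB Bi) (subsetP sB) //.
by rewrite mem_porbit1.
Qed.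

Lemma porbit_cl w i : porbit (sp_perm w) i \subset cl w i.
Proof.
apply/subsetP => _ /porbitP[n ->]; elim: n => [|n IHn]; first by rewrite expg0 perm1 cl_id.
by rewrite expgSr permM -(cl_trans IHn) perm_cl.
Qed.

Lemma saturatedP w C : reflect {in C, forall i, cl w i \subset C} (saturated w C).
Proof. exact: (iffP forall_inP). Qed.

Lemma saturated_cl w i : saturated w (cl w i).
Proof. by apply/saturatedP => j /cl_trans ->. Qed.

Lemma saturated_mem w C i j : saturated w C -> j \in cl w i -> (j \in C) = (i \in C).
Proof.
move=> /saturatedP sC ji; apply/idP/idP => [jC|iC]; last exact: (subsetP (sC _ iC)).
by apply: (subsetP (sC _ jC)); rewrite -cl_sym.
Qed.

Lemma saturated_setC w C : saturated w C -> saturated w (~: C).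
Proof.
move=> sC; apply/saturatedP => i; rewrite in_setC => iC; apply/subsetP => j ji.
by rewrite in_setC (saturated_mem sC ji).
Qed.

Lemma saturatedT w : saturated w [set: 'I_d].
Proof. by apply/saturatedP => i _; apply: subsetT. Qed.

(* Summed over a union [C] of blocks, the weights give |(A_{|C}, s_{|C}, g_{|C})| (sp_sizeE):
   sizes become additive, and a product is determined by its saturated sets, its permutation
   and its sizes (sp_prodP), which makes associativity formal. *)
Definition weight w i : rat :=
  2 * (1 - #|cl w i|%:R^-1) - (1 - #|porbit (sp_perm w) i|%:R^-1)
  + (gn w i)%:R / #|cl w i|%:R.

Definition wsize w C : rat := \sum_(i in C) weight w i.

Definition ncyc (s : {perm 'I_d}) C : rat := \sum_(i in C) #|porbit s i|%:R^-1.

Lemma sum_pblock (P : {set {set 'I_d}}) C (F : {set 'I_d} -> rat) :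
    partition P [set: 'I_d] -> {in C, forall i, pblock P i \subset C} ->
  \sum_(i in C) F (pblock P i) / #|pblock P i|%:R = \sum_(B in P ::&: C) F B.
Proof.
move=> partP sC; have /and3P[/eqP covP trivP P0] := partP.
have partC : partition (P ::&: C) C.
  apply/and3P; split.
  - rewrite eqEsubset; apply/andP; split; apply/subsetP => i.
      by move=> /bigcupP[B]; rewrite finset.inE => /andP[_ /subsetP]; apply.
    move=> iC; have iP : i \in cover P by rewrite covP.
    apply/bigcupP; exists (pblock P i); last by rewrite mem_pblock.
    by rewrite finset.inE pblock_mem //= sC.
  - by apply: trivIsetS trivP; apply/subsetP => B; rewrite finset.inE => /andP[].
  - by rewrite finset.inE (negbTE P0).
rewrite (set_partition_big _ partC) /=; apply: eq_bigr => B.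
rewrite finset.inE => /andP[PB BC].
rewrite (eq_bigr (fun=> F B / #|B|%:R)) => [|i iB].
  rewrite sumr_const -[_ / _ *+ _]mulr_natr divfK // pnatr_eq0 cards_eq0.
  by apply: contraNneq P0 => <-.
by rewrite (def_pblock trivP PB iB).
Qed.

Lemma porbits_partition (s : {perm 'I_d}) : partition (porbits s) [set: 'I_d].
Proof.
have [tr cov] : trivIset (porbits s) /\ cover (porbits s) = [set: 'I_d].
  split.
    apply/trivIsetP => _ _ /imsetP[i _ ->] /imsetP[j _ ->] nij.
    rewrite -setI_eq0; apply: contraNT nij => /set0Pn[k].
    by rewrite finset.inE -!eq_porbit_mem => /andP[/eqP -> /eqP ->].
  apply/setP => i; rewrite in_setT; apply/bigcupP; exists (porbit s i).
    exact: imset_f.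
  exact: porbit_id.
apply/and3P; split; rewrite ?cov //.
by apply/imsetP => -[i _ /setP/(_ i)]; rewrite porbit_id finset.inE.
Qed.

Lemma pblock_porbits (s : {perm 'I_d}) i : pblock (porbits s) i = porbit s i.
Proof.
have /and3P[_ tr _] := porbits_partition s.
by apply: (def_pblock tr); [apply: imset_f | apply: porbit_id].
Qed.

Definition stable (s : {perm 'I_d}) C : bool := [forall i in C, s i \in C].

Lemma stableP (s : {perm _}) C : reflect {in C, forall i, s i \in C} (stable s C).
Proof. exact: (iffP forall_inP). Qed.

Lemma stable_porbit (s : {perm _}) C : stable s C -> {in C, forall i, porbit s i \subset C}.
Proof.
move=> /stableP sC i iC; apply/subsetP => _ /porbitP[n ->].
by elim: n => [|n IHn]; rewrite ?expg0 ?perm1 // expgSr permM sC.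
Qed.

Lemma stable_mem (s : {perm _}) C i j : stable s C -> j \in porbit s i -> (j \in C) = (i \in C).
Proof.
move=> sC ji; apply/idP/idP => [jC|iC]; last exact: (subsetP (stable_porbit sC iC)).
by apply: (subsetP (stable_porbit sC jC)); rewrite porbit_sym.
Qed.

Lemma stable_perm (s : {perm _}) C i : stable s C -> (s i \in C) = (i \in C).
Proof. by move=> sC; rewrite (stable_mem sC (mem_porbit1 s i)). Qed.

Lemma ncycE (s : {perm _}) C : stable s C -> ncyc s C = #|porbits s ::&: C|%:R.
Proof.
move=> sC; rewrite -sum1_card natr_sum -(sum_pblock (fun=> 1%:R) (porbits_partition s)).
  by apply: eq_bigr => i _; rewrite pblock_porbits mul1r.
by move=> i iC; rewrite pblock_porbits stable_porbit.
Qed.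

Lemma saturated_stable w C : saturated w C -> stable (sp_perm w) C.
Proof.
by move=> /saturatedP sC; apply/stableP => i iC; apply: (subsetP (sC i iC)) (perm_cl w i).
Qed.

Lemma sp_sizeE w C : saturated w C -> (sp_size w C)%:~R = wsize w C.
Proof.
move=> sC; have stC := saturated_stable sC; have /saturatedP sC' := sC.
rewrite /sp_size /pp_size /wsize /weight !(rmorphD, rmorphN, rmorphM, rmorph_sum) /=.
rewrite big_split sumrB -mulr_sumr !sumrB !sumr_const /= -/(ncyc _ C) ncycE //.
rewrite -(sum_pblock (fun B => (sp_genus w B)%:R) (sp_partP w)) //; congr (_ + _).
rewrite -[\sum_(i in C) #|cl w i|%:R^-1]/(\sum_(i in C) #|pblock (sp_part w) i|%:R^-1).
under [\sum_(i in C) _^-1]eq_bigr do rewrite -[_^-1]mul1r.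
by rewrite (sum_pblock (fun=> 1) (sp_partP w)) // sumr_const.
Qed.

Lemma wsize_cl w i :
  wsize w (cl w i) = #|cl w i|%:R - 2 + ncyc (sp_perm w) (cl w i) + (gn w i)%:R.
Proof.
have n0 : #|cl w i|%:R != 0 :> rat.
  by rewrite pnatr_eq0 cards_eq0; apply/set0Pn; exists i; apply: cl_id.
rewrite /wsize /weight big_split sumrB /= sumrB -/(ncyc _ _).
rewrite (eq_bigr (fun=> 2 * (1 - #|cl w i|%:R^-1))) => [|j /cl_trans -> //].
rewrite [X in _ + X](eq_bigr (fun=> (gn w i)%:R / #|cl w i|%:R)) => [|j ji]; last first.
  by rewrite /gn (cl_trans ji).
have sC (r : rat) : \sum_(j in cl w i) r = r * #|cl w i|%:R by rewrite sumr_const mulr_natr.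
by rewrite !sC; field.
Qed.

Lemma sp_ext x y :
  cl x =1 cl y -> sp_perm x = sp_perm y -> gn x =1 gn y -> x = y.
Proof.
move=> ecl es eg; apply: val_inj.
have eP : sp_part x = sp_part y.
  apply/setP => B; apply/cl_blockP/cl_blockP => -[i ->]; exists i; [exact: ecl|].
  by rewrite -ecl.
rewrite [LHS]surjective_pairing [RHS]surjective_pairing; congr pair.
  rewrite [LHS]surjective_pairing [RHS]surjective_pairing; congr pair; [exact: eP|exact: es].
apply/ffunP => B; have [xB|xB] := boolP (B \in sp_part x).
  by have /cl_blockP[i ->] := xB; have := eg i; rewrite /gn -ecl.
have z w : B \notin sp_part w -> (val w).2 B = 0%N.
  by move=> wB; have /and3P[_ _ /forallP/(_ B)/implyP/(_ wB)/eqP] := surfpermP w.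
by rewrite !z // -?eP.
Qed.

(** The block of a point is its least saturated set, and by [wsize_cl] the size of a block
    determines its genus once the permutation is known. *)
Lemma sp_ext_sat x y :
    saturated x =1 saturated y -> sp_perm x = sp_perm y ->
    (forall C, saturated x C -> wsize x C = wsize y C) -> x = y.
Proof.
move=> esat es ew.
have ecl : cl x =1 cl y.
  move=> i; apply/eqP; rewrite eqEsubset; apply/andP; split.
    have := saturated_cl y i; rewrite -esat => /saturatedP; apply; exact: cl_id.
  have := saturated_cl x i; rewrite esat => /saturatedP; apply; exact: cl_id.
apply: sp_ext => // i; have := ew _ (saturated_cl x i).
rewrite {2}ecl !wsize_cl ecl es => /addrI/eqP.
by rewrite eqr_nat => /eqP.
Qed.

(** A set closed under both families of blocks is closed under each edge of the relation whose
    connected components are the blocks of the join. *)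
Lemma saturated_join x y C :
  reflect {in C, forall i, pblock (part_join (sp_part x) (sp_part y)) i \subset C}
    (saturated x C && saturated y C).
Proof.
set P := part_join _ _.
have partP : partition P [set: 'I_d] by apply: part_joinP; apply: sp_partP.
have /and3P[/eqP covP trivP _] := partP.
have sub w : refines (sp_part w) P -> forall i, cl w i \subset pblock P i.
  move=> /forall_inP/= ref i; have /exists_inP[B PB sB] := ref _ (cl_mem w i).
  by rewrite (def_pblock trivP PB) // (subsetP sB) ?cl_id.
have subx := sub x (part_join_ubl _ (sp_partP x)).
have suby := sub y (part_join_ubr _ (sp_partP y)).
apply: (iffP andP) => [[sx sy] i iC|sC]; last first.
  by split; apply/saturatedP => i iC; apply: subset_trans (sC i iC).
apply/subsetP => j; rewrite pblock_equivalence_partition ?in_setT //; last first.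
  apply: in3W; apply/equivalence_relP; split=> [k|k l]; first exact: connect0.
  apply: same_connect; apply: sym_connect_sym => {}k {}l /=.
  by rewrite -/(cl x k) -/(cl y k) -/(cl x l) -/(cl y l) cl_sym [l \in cl y k]cl_sym.
move=> /connectP[p ep ->] {j}; elim: p i iC ep => //= k p IHp i iC /andP[e1 ep]; apply: IHp ep.
by case/orP: e1 => [/(saturated_mem sx)|/(saturated_mem sy)] ->.
Qed.

Lemma sp_prodP x y z :
  sp_prod x y z <->
  [/\ forall C, saturated z C = saturated x C && saturated y C,
      sp_perm z = (sp_perm y * sp_perm x)%g &
      forall C, saturated z C -> wsize z C = wsize x C + wsize y C].
Proof.
set P := part_join (sp_part x) (sp_part y).
have partP : partition P [set: 'I_d] by apply: part_joinP; apply: sp_partP.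
have /and3P[/eqP covP trivP P0] := partP.
have sat_of : sp_part z = P -> forall C, saturated z C = saturated x C && saturated y C.
  move=> e C; apply/saturatedP/saturated_join => sC i iC; have := sC i iC;
  by rewrite /cl e.
have gE C : C \in sp_part z -> saturated x C -> saturated y C ->
  ((sp_genus z C)%:Z == sp_size x C + sp_size y C - pp_size [set C]%SET (sp_perm z) C) =
  (wsize z C == wsize x C + wsize y C).
  move=> zC sx sy; have sz : saturated z C by have /cl_blockP[i ->] := zC; apply: saturated_cl.
  rewrite -!sp_sizeE // -rmorphD /= eqr_int.
  have e : sp_part z ::&: C = [set C]%SET.
    apply/setP => B; rewrite !finset.inE; apply/andP/eqP => [[]|-> //].
    have /cl_blockP[i ->] := zC => /cl_blockP[j ->] sji.
    by apply: cl_trans; apply: (subsetP sji); apply: cl_id.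
  rewrite [sp_size z C]/sp_size e big_set1.
  have -> : pp_size (sp_part z) (sp_perm z) C = pp_size [set C]%SET (sp_perm z) C.
    have e1 : [set C]%SET ::&: C = [set C]%SET.
      by apply/setP => B; rewrite !finset.inE; case: eqP => // ->; rewrite subxx.
    by rewrite /pp_size e e1.
  by rewrite eq_sym subr_eq eq_sym addrC.
split.
- case/and3P => /eqP eP /eqP es /forall_inP/= eg.
  split=> //; first exact: sat_of.
  (* The genus equation concerns single blocks of [z]; sizes being sums over points, it extends to
     every union of blocks. *)
  move=> C sC; rewrite /wsize -big_split /=.
  have /saturatedP sC' := sC.
  have partC : partition (sp_part z ::&: C) C.
    apply/and3P; split.
    - rewrite eqEsubset; apply/andP; split; apply/subsetP => i.
        by move=> /bigcupP[B]; rewrite finset.inE => /andP[_ /subsetP]; apply.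
      move=> iC; apply/bigcupP; exists (cl z i); last exact: cl_id.
      by rewrite finset.inE cl_mem sC'.
    - by apply: trivIsetS (sp_triv z); apply/subsetP => B; rewrite finset.inE => /andP[].
    - have /and3P[_ _ z0] := sp_partP z.
      by rewrite finset.inE (negbTE z0).
  rewrite !(set_partition_big _ partC) /=; apply: eq_bigr => B.
  rewrite finset.inE => /andP[zB _].
  have : saturated z B by have /cl_blockP[i ->] := zB; apply: saturated_cl.
  rewrite sat_of // => /andP[sx sy]; have := eg B zB; rewrite gE // => /eqP.
  by rewrite /wsize -big_split.
- case=> esat es ew.
  have eP : sp_part z = P.
    have ecl i : cl z i = pblock P i.
      apply/eqP; rewrite eqEsubset; apply/andP; split.
        have : saturated z (pblock P i).
          rewrite esat; apply/saturated_join => j; rewrite -/P => ji.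
          by rewrite (same_pblock trivP ji).
        by move/saturatedP; apply; rewrite mem_pblock covP in_setT.
      have := saturated_cl z i; rewrite esat => /saturated_join; apply; exact: cl_id.
    apply/setP => B; apply/cl_blockP/idP => [[i ->]|PB].
      by rewrite ecl pblock_mem // covP in_setT.
    have [i Bi] : exists i, i \in B by apply/set0Pn; apply: contraNneq P0 => <-.
    by exists i; rewrite ecl (def_pblock trivP PB Bi).
  apply/and3P; split; [exact/eqP|exact/eqP|].
  apply/forall_inP => C zC.
  have sz : saturated z C by have /cl_blockP[i ->] := zC; apply: saturated_cl.
  have := sz; rewrite esat => /andP[sx sy]; rewrite gE //; apply/eqP; exact: ew.
Qed.

End Points.

(** * Products of surfaced permutations *)

Section Products.
Variable d : nat.
Implicit Types (w x y z u v : surfperm d) (C E : {set 'I_d}) (i j : 'I_d)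
  (s t : {perm 'I_d}).

Lemma sp_exists (e : rel 'I_d) (s : {perm 'I_d}) (g : 'I_d -> nat) :
    equivalence_rel e -> (forall i, e i (s i)) ->
    (forall i j, e i j -> g i = g j) ->
  exists w, [/\ forall i, cl w i = [set j | e i j], sp_perm w = s
    & forall i, gn w i = g i].
Proof.
move=> eqe es eg; have /equivalence_relP[ee et] := eqe; set P := equivalence_partition e [set: 'I_d].
have eqD : {in [set: 'I_d] & &, equivalence_rel e} by apply: in3W.
have partP : partition P [set: 'I_d] by apply: equivalence_partitionP.
have /and3P[/eqP covP trivP P0] := partP.
have pbP i : pblock P i = [set j | e i j].
  by apply/setP => j; rewrite pblock_equivalence_partition ?in_setT // finset.inE.
pose G : {ffun {set 'I_d} -> nat} :=
  [ffun B => if B \in P then (if [pick i in B] is Some i then g i else 0%N) else 0%N].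
have isP : is_surfperm (P, s, G).
  apply/and3P; split=> //=.
  - apply/forall_inP => _ /imsetP[i _ ->]; apply/exists_inP; exists (pblock P i).
      by rewrite pblock_mem // covP in_setT.
    have e1 k : e i ((s ^+ k)%g i).
      elim: k => [|k IHk]; first by rewrite expg0 perm1.
      by rewrite expgSr permM (et _ _ IHk).
    by apply/subsetP => _ /porbitP[k ->]; rewrite pbP finset.inE.
  - by apply/forallP => B; apply/implyP => /negbTE nB; rewrite ffunE nB.
exists (SurfPerm isP); rewrite /gn /cl /sp_genus /sp_perm /sp_part /=; split=> // i.
rewrite ffunE pblock_mem ?covP ?in_setT // pbP.
case: pickP => [j|/(_ i)]; rewrite finset.inE; first by move=> /eg.
by rewrite ee.
Qed.

(** The only obstruction to a product is the sign of the genus that it prescribes, since doubled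
    genera are integers anyway. The sets [C] are the blocks of the join, described as minimal
    nonempty common saturated sets, and the left side is the size that [C] would have in genus 0. *)
Lemma sp_prod_exists x y :
    (forall C, saturated x C -> saturated y C ->
      (forall E i, saturated x E -> saturated y E -> i \in C -> i \in E -> C \subset E) ->
      C != finset.set0 ->
      #|C|%:R - 2 + ncyc (sp_perm y * sp_perm x)%g C <= wsize x C + wsize y C) ->
  exists z, sp_prod x y z.
Proof.
move=> le_size; set P := part_join (sp_part x) (sp_part y); pose s := (sp_perm y * sp_perm x)%g.
have partP : partition P [set: 'I_d] by apply: part_joinP; apply: sp_partP.
have /and3P[/eqP covP trivP P0] := partP.
pose e := [rel i j | j \in pblock P i].
have satP i : saturated x (pblock P i) && saturated y (pblock P i).
  by apply/saturated_join => j ji; rewrite -/P (same_pblock trivP ji).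
have idP i : i \in pblock P i by rewrite mem_pblock covP in_setT.
have minP E i : saturated x E -> saturated y E -> i \in E -> pblock P i \subset E.
  by move=> sx sy iE; apply: (elimT (saturated_join x y E)) => //; rewrite sx.
pose q C : int := sp_size x C + sp_size y C - (#|C|%:Z - 2 + #|porbits s ::&: C|%:Z).
have ss C : saturated x C -> saturated y C -> stable s C.
  move=> /saturated_stable sx /saturated_stable sy.
  by apply/stableP => i iC; rewrite permM !stable_perm.
have qE C : saturated x C -> saturated y C ->
    (q C)%:~R = wsize x C + wsize y C - (#|C|%:R - 2 + ncyc s C).
  move=> sx sy.
  by rewrite -!sp_sizeE // ncycE ?ss // /q !(rmorphD, rmorphN, rmorphB) /=.
have q_ge0 i : 0 <= q (pblock P i).
  have /andP[sx sy] := satP i.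
  rewrite -(ler_int rat) qE // subr_ge0; apply: le_size => //.
    move=> E j sxE syE ji jE; rewrite -(same_pblock trivP ji).
    exact: minP.
  by apply/set0Pn; exists i.
have [||i j|w [clw sw gw]] := @sp_exists e s (fun i => `|q (pblock P i)|%N).
- apply/equivalence_relP; split=> [i|i j ij k]; first exact: idP.
  by rewrite /= (same_pblock trivP ij).
- move=> i; have /andP[sx sy] := satP i.
  by rewrite /= (stable_perm _ (ss _ sx sy)).
- by move=> ij; rewrite (same_pblock trivP ij).
have {}clw i : cl w i = pblock P i by rewrite clw; apply/setP => j; rewrite finset.inE.
have satw C : saturated w C = saturated x C && saturated y C.
  by apply/saturatedP/saturated_join => sC i iC; have := sC i iC; rewrite clw.
exists w; apply/sp_prodP; split=> // C sC.
have wcl i : wsize w (cl w i) = wsize x (cl w i) + wsize y (cl w i).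
  rewrite wsize_cl sw gw clw; have /andP[sx sy] := satP i.
  have := qE _ sx sy; rewrite -[q _]gez0_abs // -pmulrn => ->; by rewrite addrC subrK.
have partC : partition [set cl w i | i in C] C.
  apply/and3P; split.
  - rewrite cover_imset eqEsubset; apply/andP; split; last first.
      by apply/subsetP => i iC; apply/bigcupP; exists i; rewrite ?cl_id.
    by apply/bigcupsP => i; have /saturatedP := sC; apply.
  - apply: trivIsetS (sp_triv w); apply/subsetP => _ /imsetP[i _ ->]; exact: cl_mem.
  - by apply/imsetP => -[i _ /setP/(_ i)]; rewrite cl_id finset.inE.
rewrite /wsize -big_split /=.
rewrite !(set_partition_big _ partC) /=; apply: eq_bigr => _ /imsetP[i _ ->].
by rewrite [RHS]big_split; apply: wcl.
Qed.

Lemma sp_prod_uniq x y z z' : sp_prod x y z -> sp_prod x y z' -> z = z'.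
Proof.
move=> /sp_prodP[sz pz wz] /sp_prodP[sz' pz' wz'].
apply: sp_ext_sat => [C||C sC]; rewrite ?sz ?sz' ?pz ?pz' //.
by rewrite wz // wz' // sz' -sz.
Qed.

Lemma sp_prod_assocl x y z u v w :
  sp_prod x y u -> sp_prod u z v -> sp_prod y z w -> sp_prod x w v.
Proof.
move=> /sp_prodP[su pu wu] /sp_prodP[sv pv wv] /sp_prodP[sw pw ww].
apply/sp_prodP; split=> [C||C sC].
- by rewrite sv su sw andbA.
- by rewrite pv pu pw mulgA.
- have := sC; rewrite sv su => /andP[/andP[sx sy] sz].
  by rewrite wv // wu ?su ?sx // ww ?sw ?sy // addrA.
Qed.

Lemma sp_prod_assocr x y z u v w :
  sp_prod x w v -> sp_prod y z w -> sp_prod x y u -> sp_prod u z v.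
Proof.
move=> /sp_prodP[sv pv wv] /sp_prodP[sw pw ww] /sp_prodP[su pu wu].
apply/sp_prodP; split=> [C||C sC].
- by rewrite sv su sw andbA.
- by rewrite pv pu pw mulgA.
- have := sC; rewrite sv sw => /andP[sx /andP[sy sz]].
  by rewrite wv // ww ?sw ?sy // wu ?su ?sx // addrA.
Qed.

(** Inverting the permutation while keeping blocks and genera preserves sizes and reverses products.
    This anti-involution turns statements on left products into statements on right products. *)
Lemma spinv_exists x :
  exists z, [/\ forall i, cl z i = cl x i, sp_perm z = (sp_perm x)^-1%g
    & forall i, gn z i = gn x i].
Proof.
have [||i j|z [clz ? ?]] := @sp_exists [rel i j | j \in cl x i] (sp_perm x)^-1 (gn x).
- apply/equivalence_relP; split=> [i|i j] /=; first exact: cl_id.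
  by move=> /cl_trans ji k /=; rewrite ji.
- by move=> j /=; rewrite cl_sym -{1}[j](permKV (sp_perm x)) perm_cl.
- by move=> /cl_trans; rewrite /gn => ->.
by exists z; split=> // i; rewrite clz; apply/setP => j; rewrite finset.inE.
Qed.

Definition spinv x : surfperm d := projT1 (cid (spinv_exists x)).

Lemma spinv_perm x : sp_perm (spinv x) = (sp_perm x)^-1%g.
Proof. by rewrite /spinv; case: cid => z []. Qed.

Lemma spinv_cl x : cl (spinv x) =1 cl x.
Proof. by rewrite /spinv; case: cid => z []. Qed.

Lemma spinv_gn x : gn (spinv x) =1 gn x.
Proof. by rewrite /spinv; case: cid => z []. Qed.

Lemma spinv_sat x C : saturated (spinv x) C = saturated x C.
Proof. by apply/saturatedP/saturatedP => sC i /sC; rewrite spinv_cl. Qed.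

Lemma spinv_wsize x C : wsize (spinv x) C = wsize x C.
Proof.
by apply: eq_bigr => i _; rewrite /weight spinv_cl spinv_perm porbitV spinv_gn.
Qed.

Lemma spinvK : involutive spinv.
Proof.
by move=> x; apply: sp_ext => [i||i]; rewrite ?spinv_cl ?spinv_perm ?invgK ?spinv_gn.
Qed.

Lemma sp_prodV x y z : sp_prod x y z -> sp_prod (spinv y) (spinv x) (spinv z).
Proof.
move=> /sp_prodP[sz pz wz]; apply/sp_prodP; split=> [C||C].
- by rewrite !spinv_sat sz andbC.
- by rewrite !spinv_perm pz invMg.
- by rewrite !spinv_sat !spinv_wsize addrC; apply: wz.
Qed.

(** The elements (0_s, s, 0) form the support of zeta. *)
Lemma emb_exists s :
  exists z, [/\ forall i, cl z i = porbit s i, sp_perm z = s & forall i, gn z i = 0%N].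
Proof.
have [||//|z [clz ? ?]] := @sp_exists [rel i j | j \in porbit s i] s (fun=> 0%N).
- apply/equivalence_relP; split=> [i|i j] /=; first exact: porbit_id.
  by rewrite -eq_porbit_mem => /eqP ji k /=; rewrite ji.
- by move=> i; apply: mem_porbit1.
by exists z; split=> // i; rewrite clz; apply/setP => j; rewrite finset.inE.
Qed.

Definition emb s : surfperm d := projT1 (cid (emb_exists s)).

Lemma emb_perm s : sp_perm (emb s) = s.
Proof. by rewrite /emb; case: cid => z []. Qed.

Lemma emb_cl s i : cl (emb s) i = porbit s i.
Proof. by rewrite /emb; case: cid => z []. Qed.

Lemma emb_gn s i : gn (emb s) i = 0%N.
Proof. by rewrite /emb; case: cid => z []. Qed.

Lemma emb_sat s C : saturated (emb s) C = stable s C.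
Proof.
apply/saturatedP/stableP => sC i iC.
  by have /subsetP := sC i iC; apply; rewrite emb_cl mem_porbit1.
by rewrite emb_cl; apply: stable_porbit => //; apply/stableP.
Qed.

Lemma emb_wsize s C : wsize (emb s) C = #|C|%:R - ncyc s C.
Proof.
rewrite -sum1_card natr_sum -sumrB; apply: eq_bigr => i _.
by rewrite /weight emb_perm emb_cl emb_gn; ring.
Qed.

Lemma emb_inj : injective emb.
Proof. by move=> s t e; rewrite -(emb_perm s) e emb_perm. Qed.

Lemma spinv_emb s : spinv (emb s) = emb s^-1.
Proof.
apply: sp_ext => [i||i]; rewrite ?spinv_cl ?spinv_perm ?spinv_gn !(emb_perm, emb_cl, emb_gn) //.
by rewrite porbitV.
Qed.

Lemma porbit_fix s i : s i = i -> porbit s i = [set i].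
Proof.
move=> si; apply/setP => j; rewrite in_set1; apply/porbitP/eqP => [[n ->]|->]; last first.
  by exists 0%N; rewrite expg0 perm1.
by elim: n => [|n IHn]; rewrite ?expg0 ?perm1 // expgSr permM IHn.
Qed.

Lemma sp_mul1x x : sp_prod (emb 1) x x.
Proof.
apply/sp_prodP; split=> [C||C sC].
- rewrite emb_sat; suff -> : stable 1 C by [].
  by apply/stableP => i; rewrite perm1.
- by rewrite emb_perm mulg1.
- rewrite emb_wsize; suff -> : ncyc 1 C = #|C|%:R :> rat by ring.
  rewrite -sum1_card natr_sum; apply: eq_bigr => i _.
  by rewrite porbit_fix ?perm1 // cards1 invr1.
Qed.

End Products.

(** * The action of permutations *)

Lemma big_disjointU (R : Type) (idx : R) (op : Monoid.com_law idx) (T : finType)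
    (C E : {set T}) (F : T -> R) : [disjoint C & E] ->
  \big[op/idx]_(i in C :|: E) F i = op (\big[op/idx]_(i in C) F i) (\big[op/idx]_(i in E) F i).
Proof.
move=> CE; rewrite (big_setID C) /=; congr (op _ _); apply: eq_bigl => i.
  by rewrite !finset.inE; case: (i \in C); rewrite ?andbT ?andbF.
rewrite !finset.inE; case: (boolP (i \in C)) => //= iC.
by rewrite (disjointFr CE iC).
Qed.

Section Action.
Variable d : nat.
Implicit Types (w x y z u v : surfperm d) (C E : {set 'I_d}) (i j : 'I_d)
  (s t : {perm 'I_d}).

Lemma porbit_agree s t C :
  stable s C -> {in C, s =1 t} -> {in C, porbit s =1 porbit t}.
Proof.
move=> sC st i iC.
have e n : (t ^+ n)%g i = (s ^+ n)%g i /\ (s ^+ n)%g i \in C.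
  elim: n => [|n [IH1 IH2]]; first by rewrite !expg0 perm1.
  by rewrite !expgSr !permM IH1 -st // stable_perm.
apply/setP => j; apply/porbitP/porbitP => -[n ->]; exists n; by have [] := e n.
Qed.

Lemma ncyc_agree s t C : stable s C -> {in C, s =1 t} -> ncyc s C = ncyc t C.
Proof. by move=> sC st; apply: eq_bigr => i iC; rewrite (porbit_agree sC st). Qed.

Lemma stable_setC s C : stable s C -> stable s (~: C).
Proof. by move=> sC; apply/stableP => i; rewrite !in_setC stable_perm. Qed.

Lemma stableT s : stable s [set: 'I_d].
Proof. by apply/stableP => i; rewrite !in_setT. Qed.

Lemma stableM s t C : stable s C -> stable t C -> stable (s * t)%g C.
Proof. by move=> sC tC; apply/stableP => i iC; rewrite permM !stable_perm. Qed.

Lemma stable_tperm i j C : stable (tperm i j) C = ((i \in C) == (j \in C)).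
Proof.
apply/stableP/eqP => [sC|ij k kC]; last first.
  by case: tpermP kC => [->|->|] //; rewrite ij.
apply/idP/idP => /sC; by rewrite (tpermL, tpermR).
Qed.

Lemma ncycT s : ncyc s [set: 'I_d] = #|porbits s|%:R.
Proof.
rewrite ncycE ?stableT //; congr (_%:R); apply: eq_card => B.
by rewrite finset.inE subsetT andbT.
Qed.

Lemma ncycID s C : ncyc s [set: 'I_d] = ncyc s C + ncyc s (~: C).
Proof.
rewrite /ncyc (bigID (mem C)) /=; congr (_ + _); apply: eq_bigl => i.
  by rewrite in_setT.
by rewrite in_setT in_setC.
Qed.

Lemma ncyc_tperm s i j C : stable s C -> i \in C -> j \in C -> i != j ->
  ncyc (s * tperm i j)%g C = ncyc s C + (if j \in porbit s i then 1 else -1).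
Proof.
move=> sC iC jC nij; set t := tperm i j.
have eC : ncyc (s * t)%g (~: C) = ncyc s (~: C).
  apply: ncyc_agree => [|k]; first by rewrite stableM ?stable_setC // stable_tperm iC jC.
  rewrite in_setC => kC; rewrite permM tpermD //; apply: contraNneq kC => e.
    by rewrite -(stable_perm _ sC) -e.
  by rewrite -(stable_perm _ sC) -e.
(* [porbits_mul_tperm] has the transposition on the left; passing to inverses, which have the same
   cycles as sets, moves it to the right. *)
have := porbits_mul_tperm s^-1 i j; rewrite /= -/t.
rewrite -[porbits (t * _)]porbitsV invMg invgK tpermV porbitsV porbitV nij porbit_sym => e.
have : ncyc (s * t)%g [set: 'I_d] + (j \notin porbit s i).*2%:R = ncyc s [set: 'I_d] + 1.
  by rewrite !ncycT -natrD e natrD.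
rewrite (ncycID _ C) (ncycID s C) eC -mul2n natrM.
by case: (j \in _); rewrite /= ?mulr0n ?mulr1n; lra.
Qed.

Lemma ncyc1 C : ncyc 1 C = #|C|%:R.
Proof.
rewrite -sum1_card natr_sum; apply: eq_bigr => i _.
by rewrite porbit_fix ?perm1 // cards1 invr1.
Qed.

Lemma stable1 C : stable 1 C.
Proof. by apply/stableP => i; rewrite perm1. Qed.

Lemma tperm_wsize i j C : i != j -> stable (tperm i j) C ->
  wsize (emb (tperm i j)) C = (i \in C)%:R.
Proof.
move=> nij sC; rewrite emb_wsize; case: (boolP (i \in C)) => iC; last first.
  rewrite -(@ncyc_agree 1) ?stable1 ?ncyc1 ?subrr // => k kC.
  rewrite perm1 tpermD //; first by apply: contraNneq iC => ->.
  by apply: contraNneq iC => e; move: sC; rewrite stable_tperm => /eqP ->; rewrite e.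
have jC : j \in C by move: sC; rewrite stable_tperm iC => /eqP <-.
rewrite -[tperm i j]mul1g ncyc_tperm ?stable1 // ncyc1 porbit_fix ?perm1 // in_set1.
by rewrite eq_sym (negbTE nij) /=; ring.
Qed.

Lemma cl_disjoint w i j : j \notin cl w i -> [disjoint cl w i & cl w j].
Proof.
move=> ji; rewrite -setI_eq0; apply: contraNT ji => /set0Pn[k].
by rewrite finset.inE -!cl_eq => /andP[/eqP -> /eqP ->].
Qed.

(** Blocks avoiding [i] and [j] are unchanged. If [i] and [j] share a block, its doubled genus grows
    by 0 when the transposition cuts a cycle and by 2 when it joins two. If they lie in two blocks,
    these merge and their genera add. The prescribed genus is never negative. *)
Lemma tperm_prod_exists i j y : exists z, sp_prod (emb (tperm i j)) y z.
Proof.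
have [->|nij] := eqVneq i j; first by exists y; rewrite tperm1; apply: sp_mul1x.
apply: sp_prod_exists => C; rewrite emb_sat emb_perm => tC sC minC /set0Pn[k kC].
have sCs : stable (sp_perm y) C := saturated_stable sC.
rewrite tperm_wsize //; case: (boolP (i \in C)) => iC; last first.
  have jC : j \notin C by move: tC; rewrite stable_tperm (negbTE iC) => /eqP <-.
  have -> : ncyc (sp_perm y * tperm i j)%g C = ncyc (sp_perm y) C.
    apply/esym/ncyc_agree => // l lC; rewrite permM tpermD //.
      by apply: contraNneq iC => ->; rewrite stable_perm.
    by apply: contraNneq jC => ->; rewrite stable_perm.
  have kyC : cl y k \subset C by have /saturatedP := sC; apply.
  have eC : C = cl y k.
    apply/eqP; rewrite eqEsubset kyC andbT; apply: (minC _ k) => //; rewrite ?cl_id ?saturated_cl //.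
    rewrite emb_sat stable_tperm; apply/eqP.
    by rewrite !(contraNF (subsetP kyC _)).
  rewrite [in wsize y C]eC wsize_cl -eC /=.
  by have := ler0n rat (gn y k); lra.
have jC : j \in C by move: tC; rewrite stable_tperm iC => /eqP <-.
have [ji|ji] := boolP (j \in cl y i).
  have eC : C = cl y i.
    apply/eqP; rewrite eqEsubset; apply/andP; split; last by have /saturatedP := sC; apply.
    apply: (minC _ i); rewrite ?cl_id ?saturated_cl //.
    by rewrite emb_sat stable_tperm cl_id ji.
  rewrite [in wsize y C]eC wsize_cl -eC ncyc_tperm //= mulr1n.
  by have := ler0n rat (gn y i); case: ifP => _; lra.
have eC : C = cl y i :|: cl y j.
  apply/eqP; rewrite eqEsubset; apply/andP; split; last first.
    by rewrite subUset; apply/andP; split; have /saturatedP := sC; apply.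
  apply: (minC _ i) => //; last by rewrite in_setU cl_id.
    by rewrite emb_sat stable_tperm !in_setU !cl_id orbT.
  apply/saturatedP => l; rewrite in_setU => /orP[] /cl_trans ->; rewrite ?subsetUl ?subsetUr //.
have dis := cl_disjoint ji.
have eq_card : #|C| = (#|cl y i| + #|cl y j|)%N.
  by rewrite eC -(cardsUI (cl y i)) (eqP (_ : cl y i :&: cl y j == finset.set0)) ?cards0 ?addn0 // setI_eq0.
have eq_cyc : ncyc (sp_perm y) C = ncyc (sp_perm y) (cl y i) + ncyc (sp_perm y) (cl y j).
  by rewrite eC /ncyc big_disjointU.
have jporb : j \notin porbit (sp_perm y) i by apply: contra ji => /(subsetP (porbit_cl _ _)).
rewrite ncyc_tperm // (negbTE jporb) [in wsize y C]eC [wsize y _]big_disjointU // -!/(wsize _ _) !wsize_cl eq_cyc eq_card natrD /= mulr1n.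
by have := ler0n rat (gn y i); have := ler0n rat (gn y j); lra.
Qed.

(* Multiplying a permutation fixing [i] by a transposition moving [i] is a geodesic step. *)
Lemma emb_tperm s i j : s i = i -> j != i ->
  sp_prod (emb (tperm i j)) (emb s) (emb (s * tperm i j)%g).
Proof.
move=> si ji.
have st C : stable (s * tperm i j)%g C = stable (tperm i j) C && stable s C.
  apply/idP/andP => [stC|[tC sC]]; last exact: stableM.
  have tC : stable (tperm i j) C.
    by rewrite stable_tperm -{1}(stable_perm _ stC) permM si tpermL.
  by split=> //; rewrite -[s](mulgK (tperm i j)) tpermV stableM.
apply/sp_prodP; split=> [C||C]; first by rewrite !emb_sat st.
  by rewrite !emb_perm.
rewrite emb_sat st => /andP[tC sC]; rewrite tperm_wsize ?[i == j]eq_sym // !emb_wsize.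
case: (boolP (i \in C)) => iC.
  rewrite ncyc_tperm 1?eq_sym //; last by move: tC; rewrite stable_tperm iC => /eqP <-.
  by rewrite porbit_fix // in_set1 (negbTE ji) /= mulr1n; lra.
rewrite (@ncyc_agree s (s * tperm i j)) // ?add0r // => k kC.
rewrite permM tpermD //; first by apply: contraNneq iC => ->; rewrite stable_perm.
by apply: contraNneq iC => e; move: tC; rewrite stable_tperm => /eqP ->; rewrite e stable_perm.
Qed.

(** Induction on the number of moved points: [s'] fixes [i] and all fixed points of [s], and by
    [emb_tperm] the element [emb s] is the product of [emb t] and [emb s'], so that associativity
    yields the product with [y]. Permutations thus act by total maps. *)
Lemma lmul_exists s y : exists z, sp_prod (emb s) y z.
Proof.
have [n] := ubnP #|[set i | s i != i]|; elim: n s => // n IHn s les.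
have [->|/eqP s1] := eqVneq s 1%g; first by exists y; apply: sp_mul1x.
have [i si] : exists i, s i != i.
  apply/existsP; apply: contra_notT s1; rewrite negb_exists => /forallP s1.
  by apply/permP => i; rewrite perm1; apply/eqP; have := s1 i; rewrite negbK.
set t := tperm i (s i); pose s' := (s * t)%g.
have s'i : s' i = i by rewrite permM tpermR.
have [|z' z'P] := IHn s'.
  rewrite ltnS in les; apply: leq_trans les; apply: proper_card; apply/properP; split.
    apply/subsetP => k; rewrite !finset.inE; apply: contraNneq => sk.
    rewrite permM sk tpermD //; first by apply: contraNneq si => ->; rewrite sk.
    by apply: contraNneq si => e; rewrite -(inj_eq (@perm_inj _ s)) e sk.
  by exists i; rewrite !finset.inE ?s'i ?eqxx.
have [z zP] := tperm_prod_exists i (s i) z'.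
exists z; apply: (sp_prod_assocr zP z'P).
have e : (s' * t)%g = s by rewrite /s' -mulgA tperm2 mulg1.
by have := emb_tperm s'i si; rewrite -/t e.
Qed.

Definition lmul s y : surfperm d := projT1 (cid (lmul_exists s y)).
Definition rmul y s : surfperm d := spinv (lmul s^-1 (spinv y)).

Lemma lmulP s y : sp_prod (emb s) y (lmul s y).
Proof. exact: projT2 (cid (lmul_exists s y)). Qed.

Lemma rmulP y s : sp_prod y (emb s) (rmul y s).
Proof.
have := sp_prodV (lmulP s^-1 (spinv y)).
by rewrite spinvK spinv_emb invgK.
Qed.

Lemma lmul_eq s y z : (lmul s y == z) = sp_prod (emb s) y z.
Proof.
apply/eqP/idP => [<-|h]; first exact: lmulP.
exact: sp_prod_uniq (lmulP _ _) h.
Qed.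

Lemma rmul_eq s y z : (rmul y s == z) = sp_prod y (emb s) z.
Proof.
apply/eqP/idP => [<-|h]; first exact: rmulP.
exact: sp_prod_uniq (rmulP _ _) h.
Qed.

Lemma lmul1 y : lmul 1 y = y.
Proof. by apply/eqP; rewrite lmul_eq sp_mul1x. Qed.

Lemma lmul_rmul s y t : lmul s (rmul y t) = rmul (lmul s y) t.
Proof.
apply/eqP; rewrite lmul_eq; apply: (@sp_prod_assocl _ (emb s) y (emb t) (lmul s y)).
- exact: lmulP.
- exact: rmulP.
- exact: rmulP.
Qed.

Lemma lmul_comp s t r y : sp_prod (emb s) (emb t) (emb r) -> lmul r y = lmul s (lmul t y).
Proof.
move=> h; apply/eqP; rewrite lmul_eq.
exact: sp_prod_assocr (lmulP _ _) (lmulP _ _) h.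
Qed.

Lemma sp_prod_rmul x s y z : sp_prod (rmul x s) y z = sp_prod x (lmul s y) z.
Proof.
apply/idP/idP => h; first exact: sp_prod_assocl (rmulP _ _) h (lmulP _ _).
exact: sp_prod_assocr h (lmulP _ _) (rmulP _ _).
Qed.

Lemma emb_tperm_r s i j : s i = i -> j != i ->
  sp_prod (emb s) (emb (tperm i j)) (emb (tperm i j * s)%g).
Proof.
move=> si ji; have := @emb_tperm s^-1 i j _ ji; rewrite -{1}si permK => /(_ erefl).
by move=> /sp_prodV; rewrite !spinv_emb invMg !invgK tpermV.
Qed.

End Action.

(** * Convolution with the zeta function *)

Section Size.
Variable d : nat.
Implicit Types (w x y z : surfperm d) (C : {set 'I_d}) (s : {perm 'I_d}).

Lemma card_cl_gt0 w i : 0 < #|cl w i|%:R :> rat.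
Proof. by rewrite ltr0n card_gt0; apply/set0Pn; exists i; apply: cl_id. Qed.

(** With b and c the sizes of the block and of the cycle of [i], the part without genus is (1 - 1/b)
    + (1/c - 1/b), and c <= b because a cycle lies inside its block. *)
Lemma weight_ge w i : (gn w i)%:R / #|cl w i|%:R <= weight w i.
Proof.
rewrite /weight lerDr.
have : #|cl w i|%:R^-1 <= #|porbit (sp_perm w) i|%:R^-1 :> rat.
  rewrite lef_pV2 ?posrE ?card_cl_gt0 ?ler_nat ?subset_leq_card ?porbit_cl //.
  by rewrite ltr0n lt0n card_porbit_neq0.
have : #|cl w i|%:R^-1 <= 1 :> rat.
  by rewrite invf_le1 ?card_cl_gt0 // ler1n -(ltr0n rat) card_cl_gt0.
lra.
Qed.

Lemma weight_ge0 w i : 0 <= weight w i.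
Proof. by apply: le_trans (weight_ge w i); rewrite divr_ge0. Qed.

(** Sizes are nonnegative, so the absolute value only changes the type. Additive under products and
    positive on every permutation but the identity, this is the grading that makes zeta
    unitriangular. *)
Definition tot w : nat := `|sp_size w [set: 'I_d]|%N.

Lemma totE w : (tot w)%:R = wsize w [set: 'I_d].
Proof.
rewrite -sp_sizeE ?saturatedT // /tot pmulrn gez0_abs //.
by rewrite -(ler_int rat) sp_sizeE ?saturatedT // sumr_ge0 // => i _; apply: weight_ge0.
Qed.

Lemma tot_prod x y z : sp_prod x y z -> tot z = (tot x + tot y)%N.
Proof.
move=> /sp_prodP[_ _ h]; apply/eqP; rewrite -(eqr_nat rat) natrD !totE.
by rewrite h // saturatedT.
Qed.

Lemma tot_emb s : tot (emb s) = 0%N -> s = 1%g.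
Proof.
move=> e; apply/permP => i; rewrite perm1.
have : wsize (emb s) [set: 'I_d] = 0 by rewrite -totE e.
move=> /psumr_eq0P-/(_ (fun k _ => weight_ge0 (emb s) k))/(_ i (in_setT i)).
rewrite /weight emb_perm emb_cl emb_gn mul0r addr0 => /eqP.
rewrite (_ : _ - _ = 1 - #|porbit s i|%:R^-1) ?subr_eq0 1?eq_sym ?invr_eq1 ?pnatr_eq1; last by ring.
move=> /cards1P[k ek]; have := mem_porbit1 s i; have := porbit_id s i.
by rewrite ek !in_set1 => /eqP ik /eqP ->.
Qed.

Lemma gn_le w i : (gn w i <= d * tot w)%N.
Proof.
rewrite -(ler_nat rat) natrM totE.
have : weight w i <= wsize w [set: 'I_d].
  rewrite /wsize (bigD1 i) ?in_setT // lerDl sumr_ge0 // => k _; exact: weight_ge0.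
move=> /(le_trans (weight_ge w i)); rewrite ler_pdivrMr ?card_cl_gt0 // => /le_trans; apply.
rewrite mulrC ler_wpM2r ?ler_nat //; last by have := max_card (mem (cl w i)); rewrite card_ord.
by rewrite -totE ler0n.
Qed.

(** There are finitely many elements of bounded total size, since [gn_le] bounds their doubled
    genera by [d * N]. Sums over such lists can be exchanged and reindexed freely. *)
Definition spseq (N : nat) : seq (surfperm d) :=
  undup [seq x <- pmap (insub : _ -> option (surfperm d))
    [seq (u.1, [ffun B => u.2 B : nat])
    | u : {set {set 'I_d}} * {perm 'I_d} * {ffun {set 'I_d} -> 'I_(d * N).+1}]
  | (tot x <= N)%N].

Lemma spseq_uniq N : uniq (spseq N).
Proof. exact: undup_uniq. Qed.

Lemma mem_spseq N x : (x \in spseq N) = (tot x <= N)%N.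
Proof.
rewrite mem_undup mem_filter; case: (leqP (tot x) N) => //= le.
rewrite mem_pmap_sub; apply/mapP.
exists ((val x).1, [ffun B => inord (sp_genus x B)]); first by rewrite mem_enum.
rewrite /= [LHS]surjective_pairing; congr pair.
apply/ffunP => B; rewrite !ffunE inordK // ltnS.
have [/cl_blockP[i ->]|xB] := boolP (B \in sp_part x).
  by rewrite -/(gn x i); apply: leq_trans (gn_le x i) _; rewrite leq_mul2l le orbT.
have /and3P[_ _ /forallP/(_ B)/implyP/(_ xB)/eqP] := surfpermP x.
by rewrite /sp_genus => ->.
Qed.

End Size.

Section Fibre.
Variable K : fieldType.

Definition growing m d (F : surfperm m -> surfperm d) : Prop :=
  forall x, (tot x <= tot (F x))%N.

(** Push-forward of [f] along [F]. When [F] does not decrease the total size, the list contains the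
    whole fibre of [w], so any larger bound gives the same sum ([fibE]). *)
Definition fib m d (F : surfperm m -> surfperm d) (f : surfperm m -> K) (w : surfperm d) : K :=
  \sum_(y <- spseq m (tot w) | F y == w) f y.

Lemma fibE m d (F : surfperm m -> surfperm d) f w N :
  growing F -> (tot w <= N)%N -> fib F f w = \sum_(y <- spseq m N | F y == w) f y.
Proof.
move=> gF le; rewrite /fib -big_filter -[RHS]big_filter; apply: perm_big.
apply: uniq_perm; rewrite ?filter_uniq ?spseq_uniq // => y.
rewrite !mem_filter !mem_spseq; case: eqP => //= e.
by rewrite -e !(leq_trans (gF y)) // e.
Qed.

Lemma eq_bigr_in (T : eqType) (r : seq T) (P : pred T) (F G : T -> K) :
  (forall x, x \in r -> P x -> F x = G x) ->
  \sum_(x <- r | P x) F x = \sum_(x <- r | P x) G x.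
Proof.
move=> FG; rewrite big_seq_cond [RHS]big_seq_cond.
by apply: eq_bigr => x /andP[]; apply: FG.
Qed.

Lemma sum_delta (T : eqType) (r : seq T) (a : T) (G : T -> K) : uniq r ->
  \sum_(x <- r | a == x) G x = if a \in r then G a else 0.
Proof.
move=> ur; case: ifP => ar.
  by rewrite big_mkcond (bigD1_seq a) //= eqxx big1 ?addr0 // => x /negbTE; rewrite eq_sym => ->.
by rewrite big_seq_cond big1 // => x /andP[xr /eqP e]; rewrite e xr in ar.
Qed.

Lemma fib_comp l m d (F : surfperm m -> surfperm d) (G : surfperm l -> surfperm m) f w :
  growing F -> growing G -> fib (F \o G) f w = fib F (fib G f) w.
Proof.
move=> gF gG; rewrite [RHS]/fib.
under eq_bigr_in => u.
  rewrite mem_spseq => le _; rewrite (fibE _ gG le); over.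
rewrite (exchange_big_dep xpredT) //= [LHS]big_mkcond /=; apply: eq_bigr => y _.
rewrite -big_filter_cond sum_delta ?filter_uniq ?spseq_uniq //.
rewrite mem_filter mem_spseq; case: eqP => //= e.
by rewrite -e gF.
Qed.

Lemma fib_inj m d (F : surfperm m -> surfperm d) f y :
  growing F -> injective F -> fib F f (F y) = f y.
Proof.
move=> gF iF; rewrite /fib (eq_bigl (fun x => y == x)) => [|x]; last by rewrite (inj_eq iF) eq_sym.
by rewrite sum_delta ?spseq_uniq // mem_spseq gF.
Qed.

Lemma fib_notin m d (F : surfperm m -> surfperm d) f w :
  (forall y, F y <> w) -> fib F f w = 0.
Proof. by move=> nF; rewrite /fib big1 // => y /eqP /nF. Qed.

Lemma eq_fib m d (F G : surfperm m -> surfperm d) f g w :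
  F =1 G -> f =1 g -> fib F f w = fib G g w.
Proof. by move=> FG fg; apply: eq_big => y; rewrite ?FG. Qed.

Lemma fib_sum m d (I : finType) (F : surfperm m -> surfperm d) (f : I -> surfperm m -> K) w :
  fib F (fun y => \sum_i f i y) w = \sum_i fib F (f i) w.
Proof. exact: exchange_big. Qed.

(* Base change along the cartesian square [F' \o h = h \o F]. *)
Lemma fib_cartesian m d (h : surfperm m -> surfperm d) (F : surfperm m -> surfperm m)
    (F' : surfperm d -> surfperm d) f x :
    injective h -> growing h -> growing F -> growing F' -> (forall y, F' (h y) = h (F y)) ->
    (forall u, F' u = h x -> exists y, u = h y) ->
  fib F' f (h x) = fib F (f \o h) x.
Proof.
move=> ih gh gF gF' e lift; rewrite (fibE _ gF (gh x)) /fib.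
rewrite -big_filter -[RHS]big_filter.
rewrite -[RHS](big_map h xpredT f); apply: perm_big.
apply: uniq_perm; rewrite ?map_inj_uniq ?filter_uniq ?spseq_uniq // => u.
rewrite mem_filter mem_spseq; apply/andP/mapP => [[/eqP Fu le]|[y]].
  have [y ey] := lift u Fu; exists y => //; rewrite mem_filter mem_spseq.
  move: Fu; rewrite ey e => /ih ->; rewrite eqxx /=.
  by apply: leq_trans (gh y) _; rewrite -ey.
rewrite mem_filter => /andP[/eqP Fy _] ->; rewrite e Fy eqxx; split=> //.
by rewrite -Fy -e gF'.
Qed.

Lemma lmul_growing d (s : {perm 'I_d}) : growing (lmul s).
Proof. by move=> y; rewrite (tot_prod (lmulP s y)) leq_addl. Qed.

Lemma rmul_growing d (s : {perm 'I_d}) : growing (fun y => rmul y s).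
Proof. by move=> y; rewrite (tot_prod (rmulP y s)) leq_addr. Qed.

Definition zeta_act d (f : surfperm d -> K) (w : surfperm d) : K :=
  \sum_(s : {perm 'I_d}) fib (lmul s) f w.

Lemma convE d (f g : surfperm d -> K) w N : (tot w <= N)%N ->
  conv f g w = \sum_(x <- spseq d N) \sum_(y <- spseq d N | sp_prod x y w) f x * g y.
Proof.
move=> le; rewrite /conv; under [RHS]eq_bigr do rewrite big_mkcond.
rewrite -(big_allpairs_dep (h := fun x y : surfperm d => (x, y)) (F := fun p => if sp_prod p.1 p.2 w then f p.1 * g p.2 else 0)) /=.
rewrite -big_mkcond [RHS]bigfs //; first by rewrite allpairs_uniq ?spseq_uniq // => -[? ?] [].
move=> [x y] /= h /negP[]; apply/allpairsP; exists (x, y); split=> //=;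
  rewrite mem_spseq (leq_trans _ le) // (tot_prod h) ?leq_addr ?leq_addl //.
Qed.

(** As [emb] is injective, the sum has at most one term; in this form zeta can be exchanged with the
    sums over factorisations. *)
Lemma sp_zetaE d (x : surfperm d) :
  sp_zeta K x = \sum_(s : {perm 'I_d} | emb s == x) 1.
Proof.
have -> : sp_zeta K x = (x == emb (sp_perm x))%:R.
  rewrite /sp_zeta; congr ((_ : bool)%:R); apply/andP/eqP => [[/eqP eP /eqP eg]|->].
    apply: sp_ext => [i||i]; rewrite ?emb_perm ?emb_cl ?emb_gn //.
      by rewrite /cl eP pblock_porbits.
    by rewrite /gn eg ffunE.
  rewrite emb_perm; split; apply/eqP.
    apply/setP => B; apply/cl_blockP/imsetP => [[i ->]|[i _ ->]]; exists i; rewrite ?emb_cl //.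
  apply/ffunP => B; rewrite ffunE; have [/cl_blockP[i ->]|xB] := boolP (B \in sp_part (emb (sp_perm x))).
    exact: emb_gn.
  by have /and3P[_ _ /forallP/(_ B)/implyP/(_ xB)/eqP] := surfpermP (emb (sp_perm x)).
have [e|ne] := eqVneq x (emb (sp_perm x)); last first.
  rewrite big1 // => s /eqP e; move: ne; by rewrite -e emb_perm eqxx.
rewrite e (eq_bigl (fun s => s == sp_perm x)) ?big_pred1_eq // => s.
by rewrite (inj_eq (@emb_inj d)).
Qed.

Lemma conv_zetal d (f : surfperm d -> K) : conv (@sp_zeta K d) f = zeta_act f.
Proof.
apply/funext => w; rewrite (convE _ _ (leqnn _)) /zeta_act.
under eq_bigr => x _.
  rewrite -mulr_sumr sp_zetaE mulr_suml; under eq_bigr do rewrite mul1r.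
  over.
rewrite (exchange_big_dep xpredT) //=; apply: eq_bigr => s _.
rewrite sum_delta ?spseq_uniq // mem_spseq /fib; case: ifP => le.
  by apply: eq_bigl => y; rewrite lmul_eq.
rewrite big1 // => y; rewrite lmul_eq => /tot_prod h.
by move: le; rewrite h leq_addr.
Qed.

Lemma conv_zetar d (f : surfperm d -> K) w :
  conv f (@sp_zeta K d) w = \sum_(s : {perm 'I_d}) fib (fun y => rmul y s) f w.
Proof.
rewrite (convE _ _ (leqnn _)); rewrite (exchange_big_dep xpredT) //=.
under eq_bigr => y _.
  rewrite -mulr_suml sp_zetaE mulr_sumr; under eq_bigr do rewrite mulr1.
  over.
rewrite (exchange_big_dep xpredT) //=; apply: eq_bigr => s _.
rewrite sum_delta ?spseq_uniq // mem_spseq /fib; case: ifP => le.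
  by apply: eq_bigl => y; rewrite rmul_eq.
rewrite big1 // => y; rewrite rmul_eq => /tot_prod h.
by move: le; rewrite h leq_addl.
Qed.

(** Both sides sum [f x * g y] over the triples (x, s, y) with x . s . y = w. With zeta in the
    middle, the only intermediate products are those with permutations, which always exist. *)
Lemma conv_zetaA d (f g : surfperm d -> K) :
  conv f (conv (@sp_zeta K d) g) = conv (conv f (@sp_zeta K d)) g.
Proof.
apply/funext => w; set N := tot w; rewrite conv_zetal !(convE _ _ (leqnn N)).
pose T x s y := if sp_prod x (lmul s y) w then f x * g y else 0.
transitivity (\sum_(x <- spseq d N) \sum_(s : {perm 'I_d}) \sum_(y <- spseq d N) T x s y).
  apply: eq_bigr => x _; rewrite -mulr_sumr.
  under eq_bigr_in => z.
    rewrite mem_spseq => le _; rewrite /zeta_act.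
    under eq_bigr do rewrite (fibE _ (@lmul_growing _ _) le).
    over.
  rewrite exchange_big mulr_sumr; apply: eq_bigr => s _ /=.
  rewrite (exchange_big_dep xpredT) //= mulr_sumr; apply: eq_bigr => y _.
  rewrite -big_filter_cond sum_delta ?filter_uniq ?spseq_uniq // mem_filter mem_spseq /T.
  case: ifP => [/andP[-> _] //|]; case: ifP => h /=; rewrite ?mulr0 //.
  by rewrite /N (tot_prod h) leq_addl.
rewrite [RHS](exchange_big_dep xpredT) //=.
rewrite exchange_big [RHS](eq_bigr (fun y => \sum_(s : {perm 'I_d}) \sum_(x <- spseq d N) T x s y)).
  by rewrite [RHS]exchange_big /=; apply: eq_bigr => s _; rewrite exchange_big.
move=> y _; rewrite -mulr_suml.
under eq_bigr_in => z.
  rewrite mem_spseq => le _; rewrite conv_zetar.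
  under eq_bigr do rewrite (fibE _ (@rmul_growing _ _) le).
  over.
rewrite exchange_big mulr_suml; apply: eq_bigr => s _ /=.
rewrite (exchange_big_dep xpredT) //= mulr_suml; apply: eq_bigr => x _.
rewrite -big_filter_cond sum_delta ?filter_uniq ?spseq_uniq // mem_filter mem_spseq /T.
rewrite sp_prod_rmul.
case: ifP => [/andP[-> _] //|]; case: ifP => h /=; rewrite ?mul0r //.
by move: h; rewrite -sp_prod_rmul /N => /tot_prod ->; rewrite leq_addr.
Qed.

Lemma sp_unitE d (x : surfperm d) : sp_unit K x = (x == emb 1)%:R.
Proof.
rewrite /sp_unit; congr ((_ : bool)%:R); apply/and3P/eqP => [[/eqP eP /eqP es /eqP eg]|->].
  apply: sp_ext => [i||i]; rewrite ?emb_perm ?emb_cl ?emb_gn //.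
    by rewrite /cl eP pblock_porbits.
  by rewrite /gn eg ffunE.
rewrite emb_perm; split=> //; apply/eqP.
  apply/setP => B; apply/cl_blockP/imsetP => [[i ->]|[i _ ->]]; exists i; rewrite ?emb_cl //.
apply/ffunP => B; rewrite ffunE; have [/cl_blockP[i ->]|xB] := boolP (B \in sp_part (@emb d 1)).
  exact: emb_gn.
by have /and3P[_ _ /forallP/(_ B)/implyP/(_ xB)/eqP] := surfpermP (@emb d 1).
Qed.

Lemma conv_unitl d (f : surfperm d -> K) : conv (@sp_unit K d) f = f.
Proof.
apply/funext => w; rewrite (convE _ _ (leqnn _)).
rewrite (bigD1_seq (emb 1)) ?spseq_uniq ?mem_spseq //=; last first.
  have /tot_prod := sp_mul1x w; lia.
rewrite [X in _ + X]big1 ?addr0 => [|x /negbTE nx]; last first.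
  by rewrite big1 // => y _; rewrite sp_unitE nx mul0r.
under eq_bigr do rewrite sp_unitE eqxx mul1r.
rewrite (eq_bigl (fun y => w == y)) ?sum_delta ?spseq_uniq ?mem_spseq ?leqnn // => y.
by rewrite -lmul_eq lmul1 eq_sym.
Qed.

Lemma zeta_actE d (f : surfperm d -> K) w :
  zeta_act f w = f w + \sum_(s : {perm 'I_d} | s != 1%g) fib (lmul s) f w.
Proof.
rewrite /zeta_act (bigD1 1%g) //=; congr (_ + _).
rewrite /fib (eq_bigl (fun y => w == y)) ?sum_delta ?spseq_uniq ?mem_spseq ?leqnn // => y.
by rewrite lmul1 eq_sym.
Qed.

Lemma tot_lmul_lt d (s : {perm 'I_d}) y : s != 1%g -> (tot y < tot (lmul s y))%N.
Proof.
move=> s1; rewrite (tot_prod (lmulP s y)) -[X in (X < _)%N]add0n ltn_add2r lt0n.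
by apply: contraNneq s1 => /tot_emb ->.
Qed.

(** In [zeta_act f w] the terms with [s != 1] involve only elements of smaller total size than [w],
    whence an induction. The set [D], closed under passing to right factors, allows functions to be
    compared on part of the surfaced permutations only. *)
Lemma zeta_act_uniq d (D : pred (surfperm d)) (f g : surfperm d -> K) :
    (forall s y, D (lmul s y) -> D y) ->
    (forall w, D w -> zeta_act f w = zeta_act g w) ->
  forall w, D w -> f w = g w.
Proof.
move=> Ddown fg w; have [n] := ubnP (tot w); elim: n w => // n IHn w le Dw.
have := fg w Dw; rewrite !zeta_actE.
rewrite [X in _ + X](eq_bigr (fun s => fib (lmul s) g w)) => [/addIr //|s s1].
apply: eq_bigr => y /eqP e; apply: IHn; last by apply: (Ddown s); rewrite e.
by apply: leq_trans (_ : _ < tot w)%N _; rewrite -?e ?tot_lmul_lt // e -ltnS.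
Qed.

(** The triangular system is solved by iteration: [F n w] no longer depends on [n] once [n] exceeds
    [tot w]. *)
Lemma zeta_act_surj d (g : surfperm d -> K) : exists f, zeta_act f = g.
Proof.
pose step (f : surfperm d -> K) w := g w - \sum_(s : {perm 'I_d} | s != 1%g) fib (lmul s) f w.
pose F n := iter n step (fun=> 0).
have FE n m w : (tot w < n)%N -> (tot w < m)%N -> F n w = F m w.
  elim: n m w => // n IHn [//|m] w; rewrite !ltnS /= => lewn lewm.
  rewrite /F /= -/(F n) -/(F m) /step; congr (_ - _); apply: eq_bigr => s s1.
  apply: eq_bigr => y /eqP e; have := tot_lmul_lt y s1; rewrite e => lt.
  by apply: IHn; apply: leq_trans lt _.
exists (fun w => F (tot w).+1 w); apply/funext => w; rewrite zeta_actE.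
rewrite [F _ _]/= -/(F (tot w)) /step -addrA; apply/eqP.
rewrite -subr_eq0 addrAC subrr add0r addrC subr_eq0; apply/eqP; apply: eq_bigr => s s1.
apply: eq_bigr => y /eqP e; have := tot_lmul_lt y s1; rewrite e => lt.
exact: FE.
Qed.

End Fibre.

(** * Moebius inversion *)

Section Mu.
Variables (K : fieldType) (A : algType K) (phi : nat -> seq A -> K).

Lemma tot_spinv d (x : surfperm d) : tot (spinv x) = tot x.
Proof. by apply/eqP; rewrite -(eqr_nat rat) !totE spinv_wsize. Qed.

Lemma big_spinv d N (P : pred (surfperm d)) (F : surfperm d -> K) :
  \sum_(x <- spseq d N | P x) F x = \sum_(x <- spseq d N | P (spinv x)) F (spinv x).
Proof.
rewrite -(big_map (@spinv d) P F); apply: perm_big; apply: uniq_perm.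
- exact: spseq_uniq.
- by rewrite (map_inj_uniq (can_inj (@spinvK d))) spseq_uniq.
- move=> x; rewrite mem_spseq; apply/idP/mapP => [le|[y]].
    by exists (spinv x); rewrite ?spinvK // mem_spseq tot_spinv.
  by rewrite mem_spseq => le ->; rewrite tot_spinv.
Qed.

Lemma conv_spinv d (f g : surfperm d -> K) w :
  conv f g (spinv w) = conv (g \o @spinv d) (f \o @spinv d) w.
Proof.
rewrite !(@convE _ _ _ _ _ (tot w)) ?tot_spinv // big_spinv.
rewrite [RHS](exchange_big_dep xpredT) //=; apply: eq_bigr => x _.
rewrite big_spinv; apply: eq_big => y; last by rewrite mulrC.
apply/idP/idP => /sp_prodV; by rewrite ?spinvK.
Qed.

Lemma sp_unit_spinv d (x : surfperm d) : sp_unit K (spinv x) = sp_unit K x.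
Proof.
by rewrite [LHS]sp_unitE [RHS]sp_unitE (can2_eq (@spinvK d) (@spinvK d)) spinv_emb invg1.
Qed.

Lemma sp_zeta_spinv d (x : surfperm d) : sp_zeta K (spinv x) = sp_zeta K x.
Proof.
rewrite [LHS]sp_zetaE [RHS]sp_zetaE [RHS](reindex_inj (@invg_inj _)) /=; apply: eq_bigl => s.
by rewrite -spinv_emb (can2_eq (@spinvK d) (@spinvK d)).
Qed.

Lemma conv_unitr d (f : surfperm d -> K) : conv f (@sp_unit K d) = f.
Proof.
apply/funext => w; rewrite -[w]spinvK conv_spinv.
have -> : @sp_unit K d \o @spinv d = @sp_unit K d by apply/funext => x /=; apply: sp_unit_spinv.
by rewrite conv_unitl.
Qed.

(** [zeta_act_surj] gives a right inverse [m] of zeta. As zeta is invariant under [spinv], the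
    function [m \o spinv] is a left inverse, and associativity identifies the two; hence [xget]
    chooses from a nonempty set. *)
Lemma sp_muP d : conv (@sp_mu K d) (@sp_zeta K d) = @sp_unit K d.
Proof.
have [m em] := zeta_act_surj (@sp_unit K d).
have zm : conv (@sp_zeta K d) m = @sp_unit K d by rewrite conv_zetal.
have zm' : conv (m \o @spinv d) (@sp_zeta K d) = @sp_unit K d.
  apply/funext => w; have -> : @sp_zeta K d = @sp_zeta K d \o @spinv d.
    by apply/funext => x /=; rewrite sp_zeta_spinv.
  by rewrite -conv_spinv zm sp_unit_spinv.
have emm : m \o @spinv d = m.
  by rewrite -[LHS]conv_unitr -{1}zm conv_zetaA zm' conv_unitl.
rewrite emm in zm'; rewrite /sp_mu; case: xgetP => [? -> [] //|/(_ m)]; by case.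
Qed.

(** Writing the moments as zeta * f puts zeta in the middle of mu * zeta * f, where associativity is
    available. *)
Lemma zeta_act_cumulant d (a : 'I_d -> A) :
  zeta_act (sp_cumulant phi a) = sp_moment phi a.
Proof.
have [f ef] := zeta_act_surj (sp_moment phi a).
suff -> : sp_cumulant phi a = f by [].
by rewrite /sp_cumulant -ef -(conv_zetal f) conv_zetaA sp_muP conv_unitl.
Qed.

End Mu.

(** * Disjoint unions *)

Section Pull.
Variables (m d : nat) (f : 'I_m -> 'I_d) (f_inj : injective f).

Lemma perm_pull (s : {perm 'I_d}) : stable s (f @: [set: 'I_m]) ->
  exists t : {perm 'I_m}, forall i, s (f i) = f (t i).
Proof.
move=> sf; have ex i : exists j, f j == s (f i).
  have : s (f i) \in f @: [set: 'I_m] by rewrite stable_perm ?imset_f ?in_setT.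
  by case/imsetP => j _ ->; exists j.
pose t i := xchoose (ex i).
have tE i : f (t i) = s (f i) by apply/eqP; exact: (xchooseP (ex i)).
have t_inj : injective t by move=> i j e; apply/f_inj/(@perm_inj _ s); rewrite -!tE e.
by exists (perm t_inj) => i; rewrite permE tE.
Qed.

Lemma sp_pull (u : surfperm d) (s : {perm 'I_m}) :
    (forall i, f (s i) \in cl u (f i)) ->
  exists w : surfperm m, [/\ forall i j, (j \in cl w i) = (f j \in cl u (f i)),
    sp_perm w = s & forall i, gn w i = gn u (f i)].
Proof.
move=> us; have [|//|i j|w [clw pw gw]] :=
    @sp_exists m [rel i j | f j \in cl u (f i)] s (fun i => gn u (f i)).
- apply/equivalence_relP; split=> [i|i j] /=; first exact: cl_id.
  by move=> /cl_trans ij k /=; rewrite ij.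
- by move=> /cl_trans; rewrite /gn => ->.
by exists w; split=> // i j; rewrite clw finset.inE.
Qed.

Lemma porbit_pull (s : {perm 'I_d}) (t : {perm 'I_m}) i :
  (forall i, s (f i) = f (t i)) -> porbit s (f i) = f @: porbit t i.
Proof.
move=> st; have e k : (s ^+ k)%g (f i) = f ((t ^+ k)%g i).
  by elim: k => [|k IHk]; rewrite ?expg0 ?perm1 // !expgSr !permM IHk.
apply/setP => x; apply/porbitP/imsetP => [[k ->]|[_ /porbitP[k ->] ->]].
  by exists ((t ^+ k)%g i); rewrite ?mem_porbit.
by exists k.
Qed.

End Pull.

Section Glue.
Variables (m n d : nat) (h : 'I_m + 'I_n -> 'I_d) (h' : 'I_d -> 'I_m + 'I_n).
Hypotheses (hK : cancel h h') (h'K : cancel h' h).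

Let f i := h (inl i).
Let g j := h (inr j).

Let f_inj : injective f. Proof. by move=> i j /(can_inj hK)[]. Qed.
Let g_inj : injective g. Proof. by move=> i j /(can_inj hK)[]. Qed.

Lemma glueP (P : 'I_d -> Prop) :
  (forall i, P (h (inl i))) -> (forall j, P (h (inr j))) -> forall x, P x.
Proof. by move=> Pl Pr x; rewrite -(h'K x); case: (h' x). Qed.

Lemma glue_lr i j : h (inl i) != h (inr j).
Proof. by rewrite (can_eq hK). Qed.

Definition glue_fun (T : Type) (F : 'I_m -> T) (G : 'I_n -> T) (x : 'I_d) : T :=
  match h' x with inl i => F i | inr j => G j end.

Lemma glue_funl T F G i : @glue_fun T F G (h (inl i)) = F i.
Proof. by rewrite /glue_fun hK. Qed.

Lemma glue_funr T F G j : @glue_fun T F G (h (inr j)) = G j.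
Proof. by rewrite /glue_fun hK. Qed.

Lemma glue_perm_inj (s : {perm 'I_m}) (t : {perm 'I_n}) :
  injective (glue_fun (fun i => h (inl (s i))) (fun j => h (inr (t j)))).
Proof.
move=> x y; elim/glueP: x => x; elim/glueP: y => y; rewrite ?(glue_funl, glue_funr);
  by move=> /(can_inj hK) // [/perm_inj ->].
Qed.

Definition glue_perm (s : {perm 'I_m}) (t : {perm 'I_n}) : {perm 'I_d} :=
  perm (@glue_perm_inj s t).

Lemma glue_perml s t i : glue_perm s t (h (inl i)) = h (inl (s i)).
Proof. by rewrite permE glue_funl. Qed.

Lemma glue_permr s t j : glue_perm s t (h (inr j)) = h (inr (t j)).
Proof. by rewrite permE glue_funr. Qed.

Lemma glue_permM s s' t t' :
  glue_perm (s * s')%g (t * t')%g = (glue_perm s t * glue_perm s' t')%g.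
Proof.
apply/permP; apply: glueP => i.
  by rewrite permM !glue_perml permM.
by rewrite permM !glue_permr permM.
Qed.

Lemma glue_perm_eq s s' t t' : glue_perm s t = glue_perm s' t' -> s = s' /\ t = t'.
Proof.
move=> /permP e; split; apply/permP => i.
  by have := e (h (inl i)); rewrite !glue_perml => /f_inj.
by have := e (h (inr i)); rewrite !glue_permr => /g_inj.
Qed.

Definition glue_left : {set 'I_d} := f @: [set: 'I_m].

Lemma glue_leftl i : h (inl i) \in glue_left.
Proof. by rewrite imset_f ?in_setT. Qed.

Lemma glue_leftr j : h (inr j) \notin glue_left.
Proof. by apply/imsetP => -[i _ /eqP]; rewrite eq_sym (negbTE (glue_lr _ _)). Qed.

Lemma glue_leftC : ~: glue_left = g @: [set: 'I_n].
Proof.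
apply/setP; apply: glueP => i; rewrite in_setC.
  rewrite glue_leftl; apply/esym/negbTE/imsetP => -[j _ /eqP].
  by rewrite (negbTE (glue_lr _ _)).
by rewrite glue_leftr imset_f ?in_setT.
Qed.

Lemma glue_perm_split (r : {perm 'I_d}) :
  stable r glue_left <-> exists s t, r = glue_perm s t.
Proof.
split=> [sr|[s [t ->]]].
  have [s es] := perm_pull f_inj sr.
  have [|t et] := perm_pull g_inj (s := r); first by rewrite -glue_leftC stable_setC.
  exists s, t; apply/permP; apply: glueP => i; first by rewrite es glue_perml.
  by rewrite et glue_permr.
by apply/stableP => _ /imsetP[i _ ->]; rewrite glue_perml glue_leftl.
Qed.

(** The identification [h] is arbitrary because it serves both to insert one point at any place and
    to list the points of a block in the order of its sorted cycles. *)
Lemma glue_exists (w1 : surfperm m) (w2 : surfperm n) : exists w : surfperm d,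
  [/\ forall i, cl w (h (inl i)) = f @: cl w1 i, forall j, cl w (h (inr j)) = g @: cl w2 j,
    sp_perm w = glue_perm (sp_perm w1) (sp_perm w2),
    forall i, gn w (h (inl i)) = gn w1 i & forall j, gn w (h (inr j)) = gn w2 j].
Proof.
pose e := [rel x y | match h' x, h' y with
  | inl i, inl j => j \in cl w1 i | inr i, inr j => j \in cl w2 i | _, _ => false end].
have [|x|x y|w [clw pw gw]] :=
    @sp_exists d e (glue_perm (sp_perm w1) (sp_perm w2)) (glue_fun (gn w1) (gn w2)).
- apply/equivalence_relP; split=> [x|x y]; first by rewrite /=; case: (h' x) => i; apply: cl_id.
  move=> exy z; move: exy; rewrite /=.
  by case: (h' x) => i; case: (h' y) => j // /cl_trans ij; case: (h' z) => k //=; rewrite ij.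
- by elim/glueP: x => i; rewrite /= ?(glue_perml, glue_permr) !hK perm_cl.
- elim/glueP: x => i; elim/glueP: y => j; rewrite /= !hK // ?(glue_funl, glue_funr) => /cl_trans;
  by rewrite /gn => ->.
exists w; split=> // [i|j|i|j].
- rewrite clw; apply/setP; apply: glueP => j; rewrite finset.inE /= !hK.
    by rewrite (mem_imset _ _ f_inj).
  by apply/esym/negbTE/imsetP => -[k _ /eqP]; rewrite eq_sym (negbTE (glue_lr _ _)).
- rewrite clw; apply/setP; apply: glueP => i; rewrite finset.inE /= !hK.
    by apply/esym/negbTE/imsetP => -[k _ /eqP]; rewrite (negbTE (glue_lr _ _)).
  by rewrite (mem_imset _ _ g_inj).
- by rewrite gw glue_funl.
- by rewrite gw glue_funr.
Qed.

Definition glue w1 w2 : surfperm d := projT1 (cid (glue_exists w1 w2)).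

Lemma glue_cll w1 w2 i : cl (glue w1 w2) (h (inl i)) = f @: cl w1 i.
Proof. by rewrite /glue; case: cid => w []. Qed.

Lemma glue_clr w1 w2 j : cl (glue w1 w2) (h (inr j)) = g @: cl w2 j.
Proof. by rewrite /glue; case: cid => w []. Qed.

Lemma glue_sp_perm w1 w2 : sp_perm (glue w1 w2) = glue_perm (sp_perm w1) (sp_perm w2).
Proof. by rewrite /glue; case: cid => w []. Qed.

Lemma glue_gnl w1 w2 i : gn (glue w1 w2) (h (inl i)) = gn w1 i.
Proof. by rewrite /glue; case: cid => w []. Qed.

Lemma glue_gnr w1 w2 j : gn (glue w1 w2) (h (inr j)) = gn w2 j.
Proof. by rewrite /glue; case: cid => w []. Qed.

Lemma glue_eq w1 w2 x1 x2 : glue w1 w2 = glue x1 x2 -> w1 = x1 /\ w2 = x2.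
Proof.
move=> e; have := congr1 (@sp_perm d) e; rewrite !glue_sp_perm => /glue_perm_eq[e1 e2].
split; apply: sp_ext => // i.
- by apply: (imset_inj f_inj); have := glue_cll w1 w2 i; rewrite e glue_cll => ->.
- by have := glue_gnl w1 w2 i; rewrite e glue_gnl => ->.
- by apply: (imset_inj g_inj); have := glue_clr w1 w2 i; rewrite e glue_clr => ->.
- by have := glue_gnr w1 w2 i; rewrite e glue_gnr => ->.
Qed.

Lemma glue_sat w1 w2 E : saturated (glue w1 w2) E =
  saturated w1 [set i | h (inl i) \in E] && saturated w2 [set j | h (inr j) \in E].
Proof.
apply/saturatedP/andP => [sE|[/saturatedP s1 /saturatedP s2]].
  split; apply/saturatedP => i; rewrite finset.inE => iE; apply/subsetP => j ij;
  rewrite finset.inE; apply: (subsetP (sE _ iE)).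
    by rewrite glue_cll (mem_imset _ _ f_inj).
  by rewrite glue_clr (mem_imset _ _ g_inj).
apply: glueP => i iE; rewrite ?(glue_cll, glue_clr); apply/subsetP => _ /imsetP[j ji ->].
  by have := subsetP (s1 i _) j ji; rewrite !finset.inE => /(_ iE).
by have := subsetP (s2 i _) j ji; rewrite !finset.inE => /(_ iE).
Qed.

Lemma glue_sum (R : nmodType) (F : 'I_d -> R) (E : {set 'I_d}) : \sum_(x in E) F x =
  \sum_(i | h (inl i) \in E) F (h (inl i)) + \sum_(j | h (inr j) \in E) F (h (inr j)).
Proof.
rewrite (reindex h) /=; last by exists h' => x _; [exact: hK|exact: h'K].
by rewrite big_mkcond big_sumType /= -!big_mkcond.
Qed.

Lemma glue_wsize w1 w2 E : wsize (glue w1 w2) E =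
  wsize w1 [set i | h (inl i) \in E] + wsize w2 [set j | h (inr j) \in E].
Proof.
rewrite /wsize glue_sum; congr (_ + _); apply: eq_big => i; rewrite ?finset.inE // => _.
  rewrite /weight glue_cll glue_gnl glue_sp_perm (card_imset _ f_inj).
  rewrite (porbit_pull _ (fun j => glue_perml (sp_perm w1) (sp_perm w2) j)).
  by rewrite (card_imset _ f_inj).
rewrite /weight glue_clr glue_gnr glue_sp_perm (card_imset _ g_inj).
rewrite (porbit_pull _ (fun j => glue_permr (sp_perm w1) (sp_perm w2) j)).
by rewrite (card_imset _ g_inj).
Qed.

Lemma glue_tot w1 w2 : tot (glue w1 w2) = (tot w1 + tot w2)%N.
Proof.
apply/eqP; rewrite -(eqr_nat rat) natrD !totE glue_wsize.
by apply/eqP; congr (_ + _); congr wsize; apply/setP => i; rewrite !finset.inE.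
Qed.

Lemma glue_prod x1 x2 y1 y2 z1 z2 : sp_prod x1 y1 z1 -> sp_prod x2 y2 z2 ->
  sp_prod (glue x1 x2) (glue y1 y2) (glue z1 z2).
Proof.
move=> /sp_prodP[s1 p1 w1] /sp_prodP[s2 p2 w2]; apply/sp_prodP; split=> [E||E].
- by rewrite !glue_sat s1 s2 andbACA.
- by rewrite !glue_sp_perm p1 p2 glue_permM.
- by rewrite glue_sat !glue_wsize => /andP[/w1 -> /w2 ->]; rewrite addrACA.
Qed.

Lemma emb_glue s t : emb (glue_perm s t) = glue (emb s) (emb t).
Proof.
apply: sp_ext; first apply: glueP => i; last apply: glueP => i.
- rewrite emb_cl glue_cll emb_cl.
  by rewrite (porbit_pull _ (fun j => glue_perml s t j)).
- rewrite emb_cl glue_clr emb_cl.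
  by rewrite (porbit_pull _ (fun j => glue_permr s t j)).
- by rewrite emb_perm glue_sp_perm !emb_perm.
- by rewrite emb_gn glue_gnl emb_gn.
- by rewrite emb_gn glue_gnr emb_gn.
Qed.

Lemma lmul_glue s t y1 y2 :
  lmul (glue_perm s t) (glue y1 y2) = glue (lmul s y1) (lmul t y2).
Proof.
by apply/eqP; rewrite lmul_eq emb_glue; apply: glue_prod; apply: lmulP.
Qed.

Lemma glue_split u : saturated u glue_left <-> exists w1 w2, u = glue w1 w2.
Proof.
split=> [su|[w1 [w2 ->]]]; last first.
  apply/saturatedP => _ /imsetP[i _ ->]; rewrite glue_cll.
  by apply/subsetP => _ /imsetP[j _ ->]; apply: glue_leftl.
have /glue_perm_split[s [t est]] := saturated_stable su.
have [|w1 [c1 p1 g1]] := @sp_pull _ _ f u s.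
  by move=> i; rewrite /f -(glue_perml s t) -est perm_cl.
have [|w2 [c2 p2 g2]] := @sp_pull _ _ g u t.
  by move=> i; rewrite /g -(glue_permr s t) -est perm_cl.
have mem i x : x \in cl u i -> (x \in glue_left) = (i \in glue_left) by apply: saturated_mem.
exists w1, w2; apply: sp_ext; first apply: glueP => i; last apply: glueP => i.
- rewrite glue_cll; apply/setP; apply: glueP => j.
    by rewrite (mem_imset _ _ f_inj) c1.
  apply/idP/imsetP => [/mem|[k _ /eqP]]; last by rewrite eq_sym (negbTE (glue_lr _ _)).
  by rewrite glue_leftl (negbTE (glue_leftr _)).
- rewrite glue_clr; apply/setP; apply: glueP => j; last first.
    by rewrite (mem_imset _ _ g_inj) c2.
  apply/idP/imsetP => [/mem|[k _ /eqP]]; last by rewrite (negbTE (glue_lr _ _)).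
  by rewrite glue_leftl (negbTE (glue_leftr _)).
- by rewrite glue_sp_perm p1 p2.
- by rewrite glue_gnl g1.
- by rewrite glue_gnr g2.
Qed.

Section Multiplicative.
Variables (K : fieldType) (k : surfperm d -> K) (k1 : surfperm m -> K) (k2 : surfperm n -> K).
Hypothesis zeta_glue : forall w1 w2,
  zeta_act k (glue w1 w2) = zeta_act k1 w1 * zeta_act k2 w2.

(** Extension by 0 of the product of [k1] and [k2] to elements that are not glued, so that zeta can
    act on it. *)
Let H u : K := if pselect (exists p, u = glue p.1 p.2) is left e
  then k1 (projT1 (cid e)).1 * k2 (projT1 (cid e)).2 else 0.

Let H_glue w1 w2 : H (glue w1 w2) = k1 w1 * k2 w2.
Proof.
rewrite /H; case: pselect => [e|[]]; last by exists (w1, w2).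
by case: cid => -[x1 x2] /= /glue_eq[-> ->].
Qed.

(** The fibre over a glued element is the product of two fibres: a set saturated for a product is
    saturated for its factors, so every element of the fibre is itself glued. *)
Let fib_glue s t w1 w2 :
  fib (lmul (glue_perm s t)) H (glue w1 w2) = fib (lmul s) k1 w1 * fib (lmul t) k2 w2.
Proof.
pose N := tot (glue w1 w2); have le1 : (tot w1 <= N)%N by rewrite /N glue_tot leq_addr.
have le2 : (tot w2 <= N)%N by rewrite /N glue_tot leq_addl.
rewrite (fibE _ (@lmul_growing _ s) le1) (fibE _ (@lmul_growing _ t) le2) /fib -/N.
rewrite -big_filter -[\sum_(y <- _ | lmul s _ == _) _]big_filter.
rewrite -[\sum_(y <- _ | lmul t _ == _) _]big_filter.
rewrite big_distrlr /=; under [RHS]eq_bigr do under eq_bigr do rewrite -H_glue.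
rewrite -(big_allpairs_dep (h := glue) (F := H)); apply: perm_big.
apply: uniq_perm; rewrite ?filter_uniq ?spseq_uniq //.
  rewrite allpairs_uniq ?filter_uniq ?spseq_uniq //.
  by move=> [x1 x2] [y1 y2] _ _ /= /glue_eq[-> ->].
move=> u; rewrite mem_filter mem_spseq; apply/andP/allpairsP => [[/eqP eu le]|[[y1 y2]]] /=.
  have /glue_split[y1 [y2 ey]] : saturated u glue_left.
    have : saturated (lmul (glue_perm s t) u) glue_left by rewrite eu; apply/glue_split; eauto.
    by have /sp_prodP[-> _ _] := lmulP (glue_perm s t) u; case/andP.
  move: eu le; rewrite ey lmul_glue glue_tot => /glue_eq[e1 e2] le.
  exists (y1, y2); split=> //=; rewrite mem_filter mem_spseq ?e1 ?e2 eqxx /=; lia.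
rewrite !mem_filter !mem_spseq => -[/andP[/eqP e1 _] /andP[/eqP e2 _] ->].
by rewrite lmul_glue e1 e2 eqxx /N -e1 -e2 -lmul_glue lmul_growing.
Qed.

(** It is enough to compare the images of [k] and [H] under zeta on the elements for which the left
    part is saturated. There only permutations preserving the left part contribute, and these are
    the pairs of permutations of the two parts. *)
Lemma multiplicative_glue w1 w2 : k (glue w1 w2) = k1 w1 * k2 w2.
Proof.
rewrite -H_glue; apply: (@zeta_act_uniq _ _ (fun u => saturated u glue_left)).
- by move=> s y; have /sp_prodP[-> _ _] := lmulP s y; case/andP.
- move=> w /glue_split[x1 [x2 ->]]; rewrite zeta_glue big_distrlr /=.
  rewrite [RHS](bigID (fun s => stable s glue_left)) /=.
  rewrite [X in _ + X]big1 ?addr0 => [|s ns]; last first.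
    apply: fib_notin => y e; case/negP: ns.
    have := saturated_stable (_ : saturated (glue x1 x2) glue_left).
    have sg : saturated (glue x1 x2) glue_left by apply/glue_split; eauto.
    move: sg; rewrite -e; have /sp_prodP[-> _ _] := lmulP s y.
    by rewrite emb_sat => /andP[].
  rewrite pair_big /=; pose gp (p : {perm 'I_m} * {perm 'I_n}) := glue_perm p.1 p.2.
  have gp_inj : injective gp by move=> [a b] [a' b'] /= /glue_perm_eq[/= -> ->].
  rewrite (eq_bigl [in gp @: [set: _]]) => [|s]; last first.
    apply/idP/imsetP => [/glue_perm_split[a [b ->]]|[[a b] _ ->]]; first by exists (a, b).
    by apply/glue_perm_split; exists a, b.
  rewrite big_imset /=; last exact: in2W.
  by apply: eq_big => p; rewrite ?in_setT // => _; rewrite fib_glue.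
- by apply/glue_split; eauto.
Qed.

End Multiplicative.
End Glue.

(** * Moments *)

Section Words.
Variables (K : fieldType) (A : algType K).

Definition word d (s : {perm 'I_d}) (a : 'I_d -> A) i : A :=
  \prod_(j <- fingraph.orbit s i) a j.

Lemma orbit_head d (s : {perm 'I_d}) i p :
  fcycle s (i :: p) -> uniq (i :: p) -> fingraph.orbit s i = i :: p.
Proof.
by move=> cp up; rewrite (fingraph.orbitE cp up) ?mem_head //= eqxx rot0.
Qed.

Lemma mem_orbit_porbit d (s : {perm 'I_d}) i j :
  (j \in fingraph.orbit s i) = (j \in porbit s i).
Proof.
rewrite -fconnect_orbit; apply/idP/porbitP => [/iter_findex <-|[n ->]].
  exists (findex s i j); by rewrite permX.
by rewrite permX fconnect_iter.
Qed.

Lemma orbit_cons d (s : {perm 'I_d}) i :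
  exists l, [/\ fingraph.orbit s i = i :: l, fcycle s (i :: l) & uniq (i :: l)].
Proof.
have := cycle_orbit (@perm_inj _ s) i; have := orbit_uniq s i.
rewrite /fingraph.orbit -orderSpred /=; set l := traject _ _ _ => u c.
by exists l.
Qed.

(** The canonical roots read by [cycle_words] are not preserved by relabelling or insertion.
    Traciality and symmetry allow any system of representatives instead ([phi_words]). *)
Definition transversal_of d (s : {perm 'I_d}) (B : {set 'I_d}) (r : seq 'I_d) : Prop :=
  [/\ uniq r, {subset r <= B}, forall x, x \in B -> exists2 i, i \in r & x \in porbit s i
    & {in r &, forall i j, j \in porbit s i -> i = j}].

Lemma froot_porbit d (s : {perm 'I_d}) i : froot s i \in porbit s i.
Proof. by rewrite -mem_orbit_porbit -fconnect_orbit connect_root. Qed.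

Lemma froot_eq d (s : {perm 'I_d}) i j : (froot s i == froot s j) = (j \in porbit s i).
Proof.
rewrite -mem_orbit_porbit -fconnect_orbit root_connect //.
by move=> x y; apply: fconnect_sym; apply: perm_inj.
Qed.

Lemma froots_froot d (s : {perm 'I_d}) i : froots s (froot s i).
Proof. by apply: roots_root => x y; apply: fconnect_sym; apply: perm_inj. Qed.

Definition reps d (s : {perm 'I_d}) (B : {set 'I_d}) : seq 'I_d :=
  [seq i <- enum 'I_d | froots s i && (i \in B)].

Lemma mem_reps d (s : {perm 'I_d}) B i : (i \in reps s B) = froots s i && (i \in B).
Proof. by rewrite mem_filter mem_enum andbT. Qed.

Lemma reps_transversal d (s : {perm 'I_d}) B : stable s B -> transversal_of s B (reps s B).
Proof.
move=> sB; split.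
- by rewrite filter_uniq ?enum_uniq.
- by move=> i; rewrite mem_reps => /andP[].
- move=> x xB; exists (froot s x); last by rewrite porbit_sym froot_porbit.
  by rewrite mem_reps froots_froot (stable_mem sB (froot_porbit s x)).
- move=> i j; rewrite !mem_reps => /andP[/eqP ri _] /andP[/eqP rj _].
  by rewrite -froot_eq ri rj => /eqP.
Qed.

(** With [p] as first representative, the argument at [p] becomes the first letter of the first word
    and occurs in no other word. *)
Lemma transversal_at d (s : {perm 'I_d}) (B : {set 'I_d}) p : stable s B -> p \in B ->
  exists2 r, transversal_of s B (p :: r) & {in r, forall j, p \notin porbit s j}.
Proof.
move=> sB pB; have [r0 [ur rB cr ir]] : exists r0, transversal_of s B r0.
  by exists (reps s B); apply: reps_transversal.
exists [seq i <- r0 | p \notin porbit s i]; last by move=> j; rewrite mem_filter => /andP[].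
split.
- by rewrite /= filter_uniq // mem_filter porbit_id.
- by move=> i; rewrite in_cons mem_filter => /predU1P[-> //|/andP[_ /rB]].
- move=> x xB; have [pi|npi] := boolP (x \in porbit s p).
    by exists p; rewrite ?mem_head.
  have [i ri xi] := cr x xB; exists i => //; rewrite in_cons mem_filter ri andbT.
  apply/orP; right; apply: contra npi => pi; rewrite porbit_sym.
  by move: xi pi; rewrite -!eq_porbit_mem => /eqP -> /eqP ->.
- move=> i j; rewrite !in_cons !mem_filter => /predU1P[->|/andP[pi ri]] /predU1P[->|/andP[pj rj]] //.
  + by rewrite porbit_sym (negbTE pj).
  + by rewrite (negbTE pi).
  + exact: ir.
Qed.

Lemma eq_word d (s : {perm 'I_d}) (a b : 'I_d -> A) i :
  {in porbit s i, a =1 b} -> word s a i = word s b i.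
Proof. by move=> ab; apply: eq_big_seq => j; rewrite mem_orbit_porbit; apply: ab. Qed.

Variable phi : nat -> seq A -> K.
Hypothesis hphi : is_sps phi.

Lemma phi_word_rot G d (s : {perm 'I_d}) a (u v : seq A) i j : j \in porbit s i ->
  phi G (u ++ word s a i :: v) = phi G (u ++ word s a j :: v).
Proof.
rewrite -mem_orbit_porbit => ij.
have [k ek] : {k | fingraph.orbit s j = rot k (fingraph.orbit s i)}.
  by apply: orbit_rot_cycle ij; [exact: cycle_orbit (@perm_inj _ s) i | exact: orbit_uniq].
rewrite /word ek /rot big_cat /= -{1}(cat_take_drop k (fingraph.orbit s i)) big_cat /=.
exact: sps_trace.
Qed.

Lemma phi_words_froot G d (s : {perm 'I_d}) a (r : seq 'I_d) :
  phi G [seq word s a i | i <- r] = phi G [seq word s a (froot s i) | i <- r].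
Proof.
rewrite -[LHS]/(phi G ([::] ++ _)) -[RHS]/(phi G ([::] ++ _)).
elim: r [::] => [|i r IHr] u //=.
rewrite (phi_word_rot G a u _ (froot_porbit s i)) -cat_rcons IHr.
by rewrite cat_rcons.
Qed.

Lemma phi_words G d (s : {perm 'I_d}) (a : 'I_d -> A) (B : {set 'I_d}) r :
  stable s B -> transversal_of s B r ->
  phi G (cycle_words s B a) = phi G [seq word s a i | i <- r].
Proof.
move=> sB [ur rB cr ir]; rewrite phi_words_froot (map_comp (word s a) (froot s)).
apply: (sps_sym hphi); rewrite /cycle_words -/(reps s B); apply: perm_map.
rewrite perm_sym; apply: uniq_perm.
- rewrite map_inj_in_uniq // => i j ri rj /eqP; rewrite froot_eq; exact: ir.
- by rewrite filter_uniq ?enum_uniq.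
- move=> i; rewrite mem_reps; apply/mapP/andP => [[j rj ->]|[/eqP ri iB]].
    by rewrite froots_froot (stable_mem sB (froot_porbit s j)) rB.
  have [j rj ij] := cr i iB; exists j => //.
  by rewrite -ri; apply/eqP; rewrite froot_eq porbit_sym.
Qed.

Lemma eq_phi_words G d (s : {perm 'I_d}) (a b : 'I_d -> A) (B : {set 'I_d}) :
  stable s B -> {in B, a =1 b} -> phi G (cycle_words s B a) = phi G (cycle_words s B b).
Proof.
move=> sB ab; rewrite !(phi_words _ _ sB (reps_transversal sB)); congr phi.
apply/eq_in_map => i; rewrite mem_reps => /andP[_ iB]; apply: eq_word => j ji.
by apply: ab; rewrite (stable_mem sB ji).
Qed.

Lemma phi_words_inj G m d (f : 'I_m -> 'I_d) (s : {perm 'I_d}) (t : {perm 'I_m})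
    (B : {set 'I_m}) a : injective f -> (forall i, s (f i) = f (t i)) -> stable t B ->
  phi G (cycle_words s (f @: B) a) = phi G (cycle_words t B (a \o f)).
Proof.
move=> fi st tB.
have po i : porbit s (f i) = f @: porbit t i by apply: porbit_pull.
have sB : stable s (f @: B).
  by apply/stableP => _ /imsetP[i iB ->]; rewrite st imset_f ?stable_perm.
have [ur rB cr ir] := reps_transversal tB.
rewrite (phi_words _ _ tB (reps_transversal tB)) (phi_words (r := map f (reps t B)) _ _ sB).
  congr phi; rewrite -map_comp; apply: eq_map => i /=; rewrite /word.
  have [l [el cl ul]] := orbit_cons t i.
  rewrite (@orbit_head _ s (f i) (map f l)) ?el -?map_cons ?big_map //.
    by rewrite cycle_map; apply: sub_cycle cl => x y /=; rewrite st => /eqP ->.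
  by rewrite map_inj_uniq.
split.
- by rewrite map_inj_uniq.
- by move=> _ /mapP[i /rB iB ->]; apply: imset_f.
- move=> _ /imsetP[x xB ->]; have [i ri xi] := cr x xB.
  by exists (f i); rewrite ?map_f // po imset_f.
- move=> _ _ /mapP[i ri ->] /mapP[j rj ->]; rewrite po (mem_imset _ _ fi) => ji.
  by congr f; apply: ir.
Qed.

Lemma moment_glue m n d (h : 'I_m + 'I_n -> 'I_d) h' (hK : cancel h h') (h'K : cancel h' h) a w1 w2 :
  sp_moment phi a (glue hK h'K w1 w2) =
  sp_moment phi (fun i => a (h (inl i))) w1 * sp_moment phi (fun j => a (h (inr j))) w2.
Proof.
set f := fun i => h (inl i); set g := fun j => h (inr j); set w := glue _ _ _ _.
have fi : injective f by move=> i j /(can_inj hK)[].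
have gi : injective g by move=> i j /(can_inj hK)[].
have fl i : cl w (f i) = f @: cl w1 i by apply: glue_cll.
have gr j : cl w (g j) = g @: cl w2 j by apply: glue_clr.
have eP : sp_part w = (fun B : {set _} => f @: B) @: sp_part w1 :|:
    (fun B : {set _} => g @: B) @: sp_part w2.
  apply/setP => B; rewrite in_setU; apply/cl_blockP/orP.
    case=> x ->; elim/(glueP h'K): x => i; [left|right].
      by rewrite [cl _ _]fl imset_f ?cl_mem.
    by rewrite [cl _ _]gr imset_f ?cl_mem.
  case=> /imsetP[_ /cl_blockP[i ->] ->]; first by exists (f i).
  by exists (g i).
rewrite /sp_moment eP big_disjointU /=; last first.
  rewrite -setI_eq0; apply/eqP/setP => B; rewrite !finset.inE; apply/negbTE/negP.
  case/andP => /imsetP[_ /cl_blockP[i ->] ->] /imsetP[_ /cl_blockP[j ->]] /setP/(_ (f i)).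
  rewrite imset_f ?cl_id // => /esym/imsetP[k _ /eqP].
  by rewrite (negbTE (glue_lr hK _ _)).
rewrite !big_imset /=; first last.
- by move=> B C _ _; apply: imset_inj.
- by move=> B C _ _; apply: imset_inj.
congr (_ * _); apply: eq_bigr => _ /cl_blockP[i ->].
  rewrite -fl -/(gn w (f i)) [gn w _]glue_gnl fl.
  apply: phi_words_inj => // [j|]; last exact: saturated_stable (saturated_cl _ _).
  by rewrite glue_sp_perm glue_perml.
rewrite -gr -/(gn w (g i)) [gn w _]glue_gnr gr.
apply: phi_words_inj => // [j|]; last exact: saturated_stable (saturated_cl _ _).
by rewrite glue_sp_perm glue_permr.
Qed.

Lemma moment_emb1 (a : 'I_1 -> A) : sp_moment phi a (emb 1) = phi 0%N [:: a ord0].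
Proof.
have eB : [set ord0 : 'I_1] = cl (emb 1) ord0 by rewrite emb_cl porbit_fix ?perm1.
have eP : sp_part (emb (1 : {perm 'I_1})) = [set [set ord0 : 'I_1]].
  apply/setP => B; rewrite in_set1; apply/cl_blockP/eqP => [[i ->]|->]; last by exists ord0.
  by rewrite (ord1 i) -eB.
rewrite /sp_moment eP big_set1 {1}eB -/(gn _ _) emb_gn emb_perm.
have s1 : stable 1 [set ord0 : 'I_1] by apply: stable1.
rewrite (phi_words (r := [:: ord0]) _ _ s1) /=; last first.
  split=> // [i|x|i j _ _ _]; rewrite ?finset.inE ?in_cons ?orbF //.
    by move=> /eqP ->; exists ord0; rewrite ?mem_head ?porbit_id.
  by rewrite (ord1 i) (ord1 j).
by rewrite /word (@orbit_head _ _ _ [::]) ?big_seq1 //= perm1 eqxx.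
Qed.

(** Only the factor of the block of [p] involves the argument at [p]; there it is made the first
    letter of the first word. *)
Lemma moment_linear d (a b c : 'I_d -> A) p (r : K) w :
    a p = r *: b p + c p -> (forall i, i != p -> a i = b i /\ a i = c i) ->
  sp_moment phi a w = r * sp_moment phi b w + sp_moment phi c w.
Proof.
move=> ap anp.
have D b' : sp_moment phi b' w = phi (gn w p) (cycle_words (sp_perm w) (cl w p) b') *
    \prod_(B in sp_part w | B != cl w p) phi (sp_genus w B) (cycle_words (sp_perm w) B b').
  by rewrite /sp_moment (bigD1 (cl w p)) ?cl_mem.
rewrite !D.
have rest (b' : 'I_d -> A) : (forall i, i != p -> a i = b' i) ->
    \prod_(B in sp_part w | B != cl w p) phi (sp_genus w B) (cycle_words (sp_perm w) B b') =
    \prod_(B in sp_part w | B != cl w p) phi (sp_genus w B) (cycle_words (sp_perm w) B a).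
  move=> ab; apply: eq_bigr => _ /andP[/cl_blockP[i ->] ni].
  apply: eq_phi_words; first exact: saturated_stable (saturated_cl _ _).
  move=> j ji; apply/esym/ab; apply: contraNneq ni => ejp.
  by rewrite -ejp (cl_trans ji).
rewrite (rest b) => [|i /anp[]//]; rewrite (rest c) => [|i /anp[]//].
rewrite mulrA -mulrDl; congr (_ * _).
have sB : stable (sp_perm w) (cl w p) := saturated_stable (saturated_cl w p).
have [l tl pl] := transversal_at sB (cl_id w p).
rewrite !(phi_words _ _ sB tl) /=.
have el (b' : 'I_d -> A) : (forall i, i != p -> a i = b' i) ->
    map (word (sp_perm w) b') l = map (word (sp_perm w) a) l.
  move=> ab; apply/eq_in_map => i /pl ip; apply: eq_word => j ji; apply/esym/ab.
  by apply: contraNneq ip => <-.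
rewrite (el b) => [|i /anp[]//]; rewrite (el c) => [|i /anp[]//].
have [t [et _ /andP[pt _]]] := orbit_cons (sp_perm w) p.
have we (b' : 'I_d -> A) : (forall i, i != p -> a i = b' i) ->
    word (sp_perm w) b' p = b' p * \prod_(j <- t) a j.
  move=> ab; rewrite /word et big_cons; congr (_ * _).
  by apply: eq_big_seq => j jt; apply/esym/ab; apply: contraNneq pt => <-.
rewrite (we a) // (we b) => [|i /anp[]//]; rewrite (we c) => [|i /anp[]//].
rewrite ap mulrDl -scalerAl.
exact: (sps_linear hphi _ [::]).
Qed.

End Words.

(** * Inserting a point *)

Section Insertion.
Variables (d : nat) (q : 'I_d.+1).

Definition ins_h (x : 'I_d + 'I_1) : 'I_d.+1 := if x is inl i then lift q i else q.
Definition ins_h' (x : 'I_d.+1) : 'I_d + 'I_1 := if unlift q x is Some i then inl i else inr ord0.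

Lemma ins_hK : cancel ins_h ins_h'.
Proof. by case=> i; rewrite /ins_h' /= ?liftK // unlift_none (ord1 i). Qed.

Lemma ins_h'K : cancel ins_h' ins_h.
Proof. by move=> x; rewrite /ins_h'; case: unliftP => [j|] ->. Qed.

(** The point [q] is added as a fixed point forming a block of genus 0. *)
Definition iota (x : surfperm d) : surfperm d.+1 := glue ins_hK ins_h'K x (emb 1).
Definition iotap (s : {perm 'I_d}) : {perm 'I_d.+1} := glue_perm ins_hK ins_h'K s 1.
Definition tq (j : 'I_d.+1) : {perm 'I_d.+1} := tperm q j.
(* The point [q] is inserted right after [p], in the same cycle and block. *)
Definition ins (p : 'I_d) (x : surfperm d) : surfperm d.+1 := rmul (iota x) (tq (lift q p)).

Lemma liftq_neq i : (lift q i == q) = false.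
Proof. by rewrite eq_sym (negbTE (neq_lift q i)). Qed.

Lemma liftqP (P : 'I_d.+1 -> Prop) : (forall i, P (lift q i)) -> P q -> forall x, P x.
Proof. by move=> Pl Pq x; case: (unliftP q x) => [j|] ->. Qed.

Lemma iotap_lift s i : iotap s (lift q i) = lift q (s i).
Proof. exact: (glue_perml ins_hK ins_h'K s 1 i). Qed.

Lemma iotap_q s : iotap s q = q.
Proof. by have := glue_permr ins_hK ins_h'K s 1 ord0; rewrite perm1. Qed.

Lemma iota_perm x : sp_perm (iota x) = iotap (sp_perm x).
Proof. by rewrite /iota glue_sp_perm emb_perm. Qed.

Lemma tot_emb1 n : tot (@emb n 1) = 0%N.
Proof. by have := tot_prod (sp_mul1x (@emb n 1)); lia. Qed.

Lemma iota_tot x : tot (iota x) = tot x.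
Proof. by rewrite /iota glue_tot tot_emb1 addn0. Qed.

Lemma iota_growing : growing iota.
Proof. by move=> x; rewrite iota_tot. Qed.

Lemma iota_inj : injective iota.
Proof. by move=> x y /glue_eq[]. Qed.

Lemma iota_sat x E : saturated (iota x) E = saturated x [set i | lift q i \in E].
Proof.
rewrite /iota glue_sat emb_sat stable1 andbT; congr saturated.
Qed.

Lemma iota_wsize x E : wsize (iota x) E = wsize x [set i | lift q i \in E].
Proof. by rewrite /iota glue_wsize emb_wsize ncyc1 subrr addr0. Qed.

Lemma ins_growing p : growing (ins p).
Proof. by move=> x; rewrite (tot_prod (rmulP _ _)) iota_tot leq_addr. Qed.

Lemma ins_prod p x : sp_prod (iota x) (emb (tq (lift q p))) (ins p x).
Proof. exact: rmulP. Qed.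

Lemma ins_sat p x E : saturated (ins p x) E =
  saturated x [set i | lift q i \in E] && ((q \in E) == (lift q p \in E)).
Proof.
by have /sp_prodP[-> _ _] := ins_prod p x; rewrite iota_sat emb_sat stable_tperm.
Qed.

Lemma ins_wsize p x E : saturated (ins p x) E ->
  wsize (ins p x) E = wsize x [set i | lift q i \in E] + (q \in E)%:R.
Proof.
have /sp_prodP[_ _ w] := ins_prod p x => sE; rewrite w // iota_wsize tperm_wsize ?neq_lift //.
by rewrite stable_tperm; move: sE; rewrite ins_sat => /andP[].
Qed.

Lemma ins_perm p x : sp_perm (ins p x) = (tq (lift q p) * iotap (sp_perm x))%g.
Proof. by have /sp_prodP[_ -> _] := ins_prod p x; rewrite emb_perm iota_perm. Qed.

Lemma ins_perm_lift p x i :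
  sp_perm (ins p x) (lift q i) = if i == p then q else lift q (sp_perm x i).
Proof.
rewrite ins_perm permM; case: eqP => [->|/eqP np]; first by rewrite tpermR iotap_q.
by rewrite tpermD ?iotap_lift ?neq_lift // (inj_eq (@lift_inj _ q)) eq_sym.
Qed.

Lemma ins_perm_q p x : sp_perm (ins p x) q = lift q (sp_perm x p).
Proof. by rewrite ins_perm permM tpermL iotap_lift. Qed.

Definition ext p (B : {set 'I_d}) : {set 'I_d.+1} :=
  lift q @: B :|: (if p \in B then [set q] else finset.set0).

Lemma mem_ext_lift p B i : (lift q i \in ext p B) = (i \in B).
Proof.
rewrite in_setU (mem_imset _ _ (@lift_inj _ q)); case: ifP => _; rewrite finset.inE ?orbF //.
by rewrite liftq_neq orbF.
Qed.

Lemma mem_ext_q p B : (q \in ext p B) = (p \in B).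
Proof.
rewrite in_setU; case: imsetP => [[i _ /eqP]|_]; first by rewrite eq_sym liftq_neq.
by case: ifP => _; rewrite finset.inE ?eqxx.
Qed.

Lemma ext_inj p : injective (ext p).
Proof. by move=> B C /setP e; apply/setP => i; rewrite -!(mem_ext_lift p) e. Qed.

Lemma ins_cl p x i : cl (ins p x) (lift q i) = ext p (cl x i).
Proof.
have sE : saturated (ins p x) (ext p (cl x i)).
  rewrite ins_sat mem_ext_q mem_ext_lift eqxx andbT.
  have -> : [set j | lift q j \in ext p (cl x i)] = cl x i.
    by apply/setP => j; rewrite finset.inE mem_ext_lift.
  exact: saturated_cl.
have sC := saturated_cl (ins p x) (lift q i).
move: (sC); rewrite ins_sat => /andP[sx /eqP eqp].
have sub : {in cl x i, forall j, lift q j \in cl (ins p x) (lift q i)}.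
  have /saturatedP/(_ i) := sx; rewrite finset.inE cl_id => /(_ isT)/subsetP sub j /sub.
  by rewrite finset.inE.
apply/eqP; rewrite eqEsubset; apply/andP; split.
  by have /saturatedP := sE; apply; rewrite mem_ext_lift cl_id.
apply/subsetP; apply: liftqP => [j|]; first by rewrite mem_ext_lift => /sub.
by rewrite mem_ext_q eqp => /sub.
Qed.

Lemma ins_cl_q p x : cl (ins p x) q = cl (ins p x) (lift q p).
Proof. by apply: cl_trans; rewrite ins_cl mem_ext_q cl_id. Qed.

Lemma ncycV n (s : {perm 'I_n}) C : ncyc s^-1 C = ncyc s C.
Proof. by apply: eq_bigr => i _; rewrite porbitV. Qed.

Lemma big_lift (B : {set 'I_d.+1}) (F : 'I_d.+1 -> rat) : \sum_(i in B) F i =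
  \sum_(i | lift q i \in B) F (lift q i) + (if q \in B then F q else 0).
Proof.
rewrite (glue_sum ins_hK ins_h'K) /=; congr (_ + _).
by rewrite big_mkcond big_ord1.
Qed.

Lemma card_ext p B : #|ext p B|%:R = #|B|%:R + (p \in B)%:R :> rat.
Proof.
rewrite -!sum1_card !natr_sum big_lift mem_ext_q; congr (_ + _); last by case: ifP.
by apply: eq_bigl => i; rewrite mem_ext_lift.
Qed.

Lemma ncyc_iotap s p B : stable s B -> ncyc (iotap s) (ext p B) = ncyc s B + (p \in B)%:R.
Proof.
move=> sB; rewrite /ncyc big_lift mem_ext_q; congr (_ + _); last first.
  by rewrite porbit_fix ?iotap_q // cards1 invr1; case: ifP.
apply: eq_big => i; rewrite ?mem_ext_lift // => _.
rewrite (porbit_pull (f := lift q) _ (iotap_lift s)).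
by rewrite card_imset //; apply: lift_inj.
Qed.

Lemma ncyc_ins p x i : ncyc (sp_perm (ins p x)) (ext p (cl x i)) = ncyc (sp_perm x) (cl x i).
Proof.
set B := cl x i; have sB : stable (sp_perm x) B := saturated_stable (saturated_cl _ _).
have sE : stable (iotap (sp_perm x)) (ext p B).
  apply/stableP; apply: liftqP => [j|]; last by rewrite iotap_q.
  by rewrite iotap_lift !mem_ext_lift stable_perm.
(* The transposition is the first factor here, while [ncyc_tperm] wants it last; the inverse has the
   same cycles as sets. It absorbs the fixed point [q] into the cycle of [p], so the number of
   cycles stays that of [x]. *)
rewrite ins_perm -ncycV invMg; have [pB|pB] := boolP (p \in B).
  rewrite tpermV /tq ncyc_tperm ?neq_lift ?mem_ext_q ?mem_ext_lift //; last first.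
    apply/stableP => j jE; rewrite -(stable_perm _ sE) permKV //.
  rewrite ncycV ncyc_iotap // porbitV porbit_fix ?iotap_q // in_set1 liftq_neq pB.
  by rewrite /= mulr1n addrK.
rewrite (@ncyc_agree _ _ (iotap (sp_perm x))^-1) ?ncycV ?ncyc_iotap ?(negbTE pB) ?addr0 //.
  apply: stableM; first by apply/stableP => j jE; rewrite -(stable_perm _ sE) permKV.
  by rewrite tpermV stable_tperm mem_ext_q mem_ext_lift.
move=> j jE; rewrite permM tpermV; set k := fun_of_perm (iotap (sp_perm x))^-1 j.
have kE : k \in ext p B by rewrite -(stable_perm _ sE) permKV.
rewrite tpermD //; first by apply: contraNneq pB => e; rewrite -(mem_ext_q p) e.
by apply: contraNneq pB => e; rewrite -(mem_ext_lift p) e.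
Qed.

(** Insertion into a block adds one point and no cycle, which accounts for exactly the size 1 of the
    transposition; the genus cannot change. *)
Lemma ins_gn p x i : gn (ins p x) (lift q i) = gn x i.
Proof.
have := ins_wsize (saturated_cl (ins p x) (lift q i)).
have e : [set j | lift q j \in cl (ins p x) (lift q i)] = cl x i.
  by apply/setP => j; rewrite finset.inE ins_cl mem_ext_lift.
rewrite e !wsize_cl ins_cl mem_ext_q card_ext ncyc_ins => h.
by apply/eqP; rewrite -(eqr_nat rat); apply/eqP; lra.
Qed.

Lemma ins_gn_q p x : gn (ins p x) q = gn x p.
Proof. by rewrite -(ins_gn p) /gn ins_cl_q. Qed.

Lemma ins_inj p : injective (ins p).
Proof.
move=> x y e; apply: sp_ext => [i||i].
- by apply: (@ext_inj p); rewrite -!ins_cl e.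
- have := ins_perm p x; rewrite e ins_perm => /mulgI/glue_perm_eq[//].
- by rewrite -(ins_gn p) e ins_gn.
Qed.

(** Removing the transposition from the permutation of [u] leaves [q] fixed, so the rest comes from
    a permutation of the other points; blocks and genera are then restricted to these points. *)
Lemma ins_surj p u : sp_perm u (lift q p) = q -> exists x, u = ins p x.
Proof.
move=> up; have stq : stable (tq (lift q p) * sp_perm u)%g (glue_left ins_h).
  rewrite -[X in stable _ X]setCK; apply: stable_setC.
  have -> : ~: glue_left ins_h = [set q].
    apply/setP; apply: liftqP => [i|]; rewrite in_setC in_set1.
      by rewrite (glue_leftl ins_h i) liftq_neq.
    by rewrite (glue_leftr ins_hK ord0) eqxx.
  by apply/stableP => i; rewrite !in_set1 => /eqP ->; rewrite permM tpermL up.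
have [s [t est]] := proj1 (glue_perm_split ins_hK ins_h'K _) stq.
have pu : sp_perm u = (tq (lift q p) * iotap s)%g.
  rewrite /iotap (_ : 1%g = t) -?est ?mulgA ?tperm2 ?mul1g //.
  by apply/permP => i; rewrite (ord1 i) (ord1 (t ord0)) perm1.
have [i|x [clx px gx]] := @sp_pull _ _ (lift q) u s.
  have [->|ni] := eqVneq i p.
    rewrite -(cl_trans (perm_cl u (lift q p))) up -iotap_lift.
    by have := perm_cl u q; rewrite {1}pu permM tpermL.
  have := perm_cl u (lift q i); rewrite {1}pu permM tpermD ?iotap_lift ?neq_lift //.
  by rewrite (inj_eq (@lift_inj _ q)) eq_sym.
exists x; apply: sp_ext; first apply: liftqP.
- move=> i; rewrite ins_cl; apply/setP; apply: liftqP => [j|]; first by rewrite mem_ext_lift clx.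
  by rewrite mem_ext_q clx -{1}up (saturated_mem (saturated_cl u _) (perm_cl u _)).
- have := cl_trans (perm_cl u (lift q p)); rewrite up => ->; rewrite ins_cl_q ins_cl.
  apply/setP; apply: liftqP => [j|]; first by rewrite mem_ext_lift clx.
  by rewrite mem_ext_q cl_id -{1}up perm_cl.
- by rewrite ins_perm px.
- apply: liftqP => [i|]; first by rewrite ins_gn gx.
  rewrite ins_gn_q gx /gn; have := cl_trans (perm_cl u (lift q p)).
  by rewrite up => ->.
Qed.

Lemma lmul_iota s x : lmul (iotap s) (iota x) = iota (lmul s x).
Proof. by rewrite /iotap /iota lmul_glue lmul1. Qed.

Lemma lmul_ins s p x : lmul (iotap s) (ins p x) = ins p (lmul s x).
Proof. by rewrite /ins lmul_rmul lmul_iota. Qed.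

(** Moving the transposition across the permutation of [x] conjugates it: inserting [q] after [p]
    from the right is inserting it before the successor of [p] from the left. *)
Lemma lmul_tq_iota p x : lmul (tq (lift q (sp_perm x p))) (iota x) = ins p x.
Proof.
have /sp_prodP[sl pl wl] := lmulP (tq (lift q (sp_perm x p))) (iota x).
apply: sp_ext_sat => [E||E].
- rewrite sl ins_sat emb_sat stable_tperm iota_sat andbC; apply: andb_id2l => sx.
  have := saturated_mem sx (perm_cl x p); by rewrite !finset.inE => ->.
- rewrite pl ins_perm emb_perm iota_perm; apply/permP; apply: liftqP => [i|].
    rewrite !permM iotap_lift; have [->|ni] := eqVneq i p; first by rewrite !tpermR iotap_q.
    by rewrite !tpermD ?iotap_lift ?neq_lift ?(inj_eq (@lift_inj _ q)) 1?eq_sym ?(inj_eq perm_inj) // eq_sym.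
  by rewrite !permM iotap_q !tpermL iotap_lift.
- move=> sE; rewrite wl //; have := sE; rewrite sl emb_sat iota_sat => /andP[sE1 sx].
  rewrite ins_wsize ?tperm_wsize ?neq_lift // ?iota_wsize 1?addrC //.
  rewrite ins_sat sx; have := saturated_mem sx (perm_cl x p); rewrite !finset.inE => <-.
  by move: sE1; rewrite stable_tperm.
Qed.

Lemma iotap_tq_inj : injective (fun p : 'I_d.+1 * {perm 'I_d} => (tq p.1 * iotap p.2)%g).
Proof.
move=> [j s] [k t] /= e; have ejk : j = k.
  have := congr1 (fun r : {perm _} => r^-1%g q) e.
  have iq r : (iotap r)^-1%g q = q by rewrite -{1}(iotap_q r) permK.
  by rewrite !invMg !permM !iq !tpermV !tpermL.
by move: e; rewrite ejk => /mulgI/glue_perm_eq[->].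
Qed.

Lemma tq_iotap_inj : injective (fun p : 'I_d.+1 * {perm 'I_d} => (iotap p.2 * tq p.1)%g).
Proof.
move=> [j s] [k t] /= e; have ejk : j = k.
  by have := congr1 (fun r : {perm _} => r q) e; rewrite !permM !iotap_q !tpermL.
by move: e; rewrite ejk => /mulIg/glue_perm_eq[->].
Qed.

Lemma emb_iotap_tq s j : sp_prod (emb (iotap s)) (emb (tq j)) (emb (tq j * iotap s)%g).
Proof.
have [->|nj] := eqVneq j q; last exact: emb_tperm_r (iotap_q s) nj.
rewrite /tq tperm1 mul1g; have := sp_prodV (sp_mul1x (emb (iotap s)^-1)).
by rewrite !spinv_emb invgK invg1.
Qed.

Lemma emb_tq_iotap s j : sp_prod (emb (tq j)) (emb (iotap s)) (emb (iotap s * tq j)%g).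
Proof.
have [->|nj] := eqVneq j q; last exact: emb_tperm (iotap_q s) nj.
by rewrite /tq tperm1 mulg1; apply: sp_mul1x.
Qed.

Variable K : fieldType.

Lemma sum_perm_bij (g : 'I_d.+1 * {perm 'I_d} -> {perm 'I_d.+1}) (F : {perm 'I_d.+1} -> K) :
  injective g -> \sum_s F s = \sum_j \sum_s F (g (j, s)).
Proof.
move=> gi; rewrite pair_big (reindex g) /=; first by apply: eq_bigr => -[].
apply: onW_bij; apply: inj_card_bij => //.
by rewrite card_prod card_ord !card_Sn factS.
Qed.

(* Every permutation of d+1 points is uniquely, and geodesically, a product of a permutation
   fixing [q] and a transposition [tq j] (or 1). *)
Lemma zeta_act_iotap_tq (f : surfperm d.+1 -> K) w :
  zeta_act f w = \sum_s fib (lmul (iotap s)) (fun u => \sum_j fib (lmul (tq j)) f u) w.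
Proof.
rewrite /zeta_act (sum_perm_bij _ iotap_tq_inj) exchange_big /=; apply: eq_bigr => s _.
rewrite fib_sum; apply: eq_bigr => j _; rewrite -fib_comp; try exact: lmul_growing.
by apply: eq_fib => // y /=; apply: lmul_comp; apply: emb_iotap_tq.
Qed.

Lemma zeta_act_tq_iotap (f : surfperm d.+1 -> K) w :
  zeta_act f w = \sum_j fib (lmul (tq j)) (fun u => \sum_s fib (lmul (iotap s)) f u) w.
Proof.
rewrite /zeta_act (sum_perm_bij _ tq_iotap_inj) /=; apply: eq_bigr => j _.
rewrite fib_sum; apply: eq_bigr => s _; rewrite -fib_comp; try exact: lmul_growing.
by apply: eq_fib => // y /=; apply: lmul_comp; apply: emb_tq_iotap.
Qed.

(** Both sides have the same image under the zeta action on [d] points: once the transpositions are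
    split off, the fibre of [iotap s] over [ins p x] consists of the insertions of the fibre of [s]
    over [x]. *)
Lemma zeta_act_ins p (f : surfperm d.+1 -> K) (g : surfperm d -> K) :
    (forall x, zeta_act g x = zeta_act f (ins p x)) ->
  forall x, g x = \sum_j fib (lmul (tq j)) f (ins p x).
Proof.
move=> gf x.
apply: (@zeta_act_uniq _ _ xpredT g (fun x => \sum_j fib (lmul (tq j)) f (ins p x))) => // {}x _.
rewrite gf zeta_act_iotap_tq; apply: eq_bigr => s _.
(* As [iotap s] fixes [q], the permutation of [u] must already send [lift q p] to [q]. *)
have lift_ins u : lmul (iotap s) u = ins p x -> exists y, u = ins p y.
  move=> e; apply: ins_surj; have := ins_perm_lift p x p; rewrite eqxx -e.
  have /sp_prodP[_ -> _] := lmulP (iotap s) u; rewrite emb_perm permM => e1.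
  by apply: (@perm_inj _ (iotap s)); rewrite e1 iotap_q.
exact: (fib_cartesian _ (@ins_inj p) (ins_growing p) (@lmul_growing _ s)
  (@lmul_growing _ (iotap s)) (lmul_ins s p) lift_ins).
Qed.

Lemma zeta_act_fib_iota (f : surfperm d -> K) w :
  zeta_act (fib iota f) w = \sum_j fib (lmul (tq j) \o iota) (zeta_act f) w.
Proof.
rewrite zeta_act_tq_iotap; apply: eq_bigr => j _.
rewrite fib_comp; [|exact: lmul_growing|exact: iota_growing].
apply: eq_fib => // u; rewrite /zeta_act fib_sum; apply: eq_bigr => s _.
rewrite -!fib_comp; try exact: lmul_growing; try exact: iota_growing.
by apply: eq_fib => // y /=; rewrite lmul_iota.
Qed.

Section InsertionMoments.
Variables (A : algType K) (phi : nat -> seq A -> K).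
Hypothesis hphi : is_sps phi.

Lemma orbit_ins p x i : p \notin porbit (sp_perm x) i ->
  fingraph.orbit (sp_perm (ins p x)) (lift q i) = map (lift q) (fingraph.orbit (sp_perm x) i).
Proof.
move=> pi; have [l [el cyl ul]] := orbit_cons (sp_perm x) i; rewrite el.
apply: orbit_head; rewrite -map_cons; last by rewrite (map_inj_uniq (@lift_inj _ q)).
rewrite cycle_map; apply: (sub_in_cycle _ (allss _) cyl) => j k jl _ /= /eqP <-.
rewrite ins_perm_lift; have [ejp|_] := eqVneq j p; last exact: eqxx.
case/negP: pi.
by rewrite -mem_orbit_porbit el -ejp.
Qed.

Lemma orbit_ins_p p x l : fingraph.orbit (sp_perm x) p = p :: l ->
  fcycle (sp_perm x) (p :: l) -> uniq (p :: l) ->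
  fingraph.orbit (sp_perm (ins p x)) (lift q p) = lift q p :: q :: map (lift q) l.
Proof.
move=> el cyl ul; apply: orbit_head; last first.
  rewrite /= in_cons liftq_neq (mem_map (@lift_inj _ q)) (map_inj_uniq (@lift_inj _ q)).
  move: ul => /= /andP[-> ->]; rewrite andbT /=.
  by apply/mapP => -[k _ /eqP]; rewrite eq_sym liftq_neq.
rewrite /= ins_perm_lift eqxx eqxx /=.
have step : forall l' y, p \notin y :: l' -> fpath (sp_perm x) y (rcons l' p) ->
    fpath (sp_perm (ins p x)) (lift q y) (rcons (map (lift q) l') (lift q p)).
  elim=> [|z l' IHl] y /=.
    rewrite mem_seq1 eq_sym ins_perm_lift !andbT => /negbTE -> /eqP ->; exact: eqxx.
  rewrite in_cons negb_or ins_perm_lift eq_sym.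
  case/andP => /negbTE -> pl /andP[/eqP ez ph]; rewrite ez eqxx /=; exact: IHl.
move: cyl ul; case: l {el} => [|z l] /=; first by rewrite ins_perm_q => /andP[/eqP -> _] _; rewrite eqxx.
move=> /andP[/eqP ez ph] /andP[pl _]; rewrite ins_perm_q ez eqxx /=; exact: step.
Qed.

(** In the cycle of [p] the letters at [lift q p] and [q] are consecutive and multiply to [b p]; all
    other words are unchanged. *)
Lemma moment_ins p x (a : 'I_d.+1 -> A) (b : 'I_d -> A) :
    b p = a (lift q p) * a q -> (forall i, i != p -> b i = a (lift q i)) ->
  sp_moment phi a (ins p x) = sp_moment phi b x.
Proof.
move=> bp bnp; have eP : sp_part (ins p x) = ext p @: sp_part x.
  apply/setP => B; apply/cl_blockP/imsetP => [[i ->]|[_ /cl_blockP[i ->] ->]].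
    elim/liftqP: i => [i|]; first by exists (cl x i); rewrite ?cl_mem ?ins_cl.
    by exists (cl x p); rewrite ?cl_mem // ins_cl_q ins_cl.
  by exists (lift q i); rewrite ins_cl.
rewrite /sp_moment eP big_imset /=; last by move=> B C _ _; apply: ext_inj.
apply: eq_bigr => _ /cl_blockP[i ->]; set B := cl x i.
have -> : sp_genus (ins p x) (ext p B) = gn x i by rewrite -(ins_gn p) /gn ins_cl.
rewrite -[sp_genus x B]/(gn x i).
have sB : stable (sp_perm x) B := saturated_stable (saturated_cl _ _).
have sE : stable (sp_perm (ins p x)) (ext p B).
  by rewrite -ins_cl; apply: saturated_stable (saturated_cl _ _).
have porb j k : (lift q k \in porbit (sp_perm (ins p x)) (lift q j)) = (k \in porbit (sp_perm x) j).
  rewrite -!mem_orbit_porbit; have [pj|pj] := boolP (p \in porbit (sp_perm x) j); last first.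
    by rewrite orbit_ins // (mem_map (@lift_inj _ q)).
  rewrite !mem_orbit_porbit; have pj' : porbit (sp_perm x) j = porbit (sp_perm x) p.
    by apply/esym/eqP; rewrite eq_porbit_mem.
  have [l [el cyl ul]] := orbit_cons (sp_perm x) p.
  have eo := orbit_ins_p el cyl ul.
  have qj r : r \in p :: l -> lift q r \in porbit (sp_perm (ins p x)) (lift q p).
    move=> rl; rewrite -mem_orbit_porbit eo !in_cons (inj_eq (@lift_inj _ q)) liftq_neq /=.
    by rewrite (mem_map (@lift_inj _ q)) -in_cons.
  have jl : j \in p :: l by rewrite -el mem_orbit_porbit -pj' porbit_id.
  have := qj j jl; rewrite -eq_porbit_mem => /eqP ->.
  rewrite pj' -!mem_orbit_porbit eo el !in_cons (inj_eq (@lift_inj _ q)) liftq_neq /=.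
  by rewrite (mem_map (@lift_inj _ q)).
have tE r : transversal_of (sp_perm x) B r -> transversal_of (sp_perm (ins p x)) (ext p B) (map (lift q) r).
  case=> ur rB cr ir; split.
  - by rewrite (map_inj_uniq (@lift_inj _ q)).
  - by move=> _ /mapP[j /rB jB ->]; rewrite mem_ext_lift.
  - apply: liftqP => [j|]; rewrite ?mem_ext_lift ?mem_ext_q => jB.
      by have [k rk kj] := cr _ jB; exists (lift q k); rewrite ?map_f // porb.
    have [k rk kj] := cr _ jB; exists (lift q k); rewrite ?map_f //.
    have /eqP <- : porbit (sp_perm (ins p x)) (lift q p) == porbit (sp_perm (ins p x)) (lift q k).
      by rewrite eq_porbit_mem porb.
    by have := mem_porbit1 (sp_perm (ins p x)) (lift q p); rewrite ins_perm_lift eqxx.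
  - move=> _ _ /mapP[j rj ->] /mapP[k rk ->]; rewrite porb => kj; congr lift; exact: ir.
have wnp j : p \notin porbit (sp_perm x) j ->
    word (sp_perm (ins p x)) a (lift q j) = word (sp_perm x) b j.
  move=> pj; rewrite /word orbit_ins // big_map; apply: eq_big_seq => k kj.
  by rewrite bnp //; apply: contraNneq pj => <-; rewrite -mem_orbit_porbit.
have [pB|pB] := boolP (p \in B).
  have [r tr pr] := transversal_at sB pB.
  rewrite (phi_words hphi _ _ sB tr) (phi_words hphi _ _ sE (tE _ tr)) -map_comp /=.
  congr (phi _ (_ :: _)); last by apply/eq_in_map => j /pr; apply: wnp.
  have [l [el cyl ul]] := orbit_cons (sp_perm x) p.
  rewrite /word (orbit_ins_p el cyl ul) el !big_cons mulrA -bp; congr (_ * _).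
  rewrite big_map; apply: eq_big_seq => k kl; rewrite bnp //.
  by apply: contraTneq kl => ->; case/andP: ul.
have tr := reps_transversal sB.
rewrite (phi_words hphi _ _ sB tr) (phi_words hphi _ _ sE (tE _ tr)) -map_comp.
congr phi; apply/eq_in_map => j; rewrite mem_reps => /andP[_ jB]; apply: wnp.
by apply: contra pB => /(stable_mem sB) ->.
Qed.

Lemma iota_split w : sp_perm w q = q ->
  (exists x, w = iota x) \/ gn w q <> 0%N \/ cl w q <> [set q].
Proof.
move=> wq; have [cq|/eqP] := eqVneq (cl w q) [set q]; last by right; right.
have [gq|/eqP] := eqVneq (gn w q) 0%N; last by right; left.
left; have sw : saturated w (glue_left ins_h).
  rewrite -[X in saturated _ X]setCK; apply: saturated_setC.
  have -> : ~: glue_left ins_h = cl w q.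
    rewrite cq; apply/setP; apply: liftqP => [i|]; rewrite in_setC in_set1.
      by rewrite (glue_leftl ins_h i) liftq_neq.
    by rewrite (glue_leftr ins_hK ord0) eqxx.
  exact: saturated_cl.
have [x [y e]] := proj1 (glue_split ins_hK ins_h'K w) sw.
exists x; rewrite e /iota; congr glue; apply: sp_ext.
- move=> i; rewrite (ord1 i); apply/setP => j; rewrite (ord1 j) !cl_id //.
- by apply/permP => i; rewrite (ord1 (sp_perm y i)) (ord1 (sp_perm (emb 1) i)).
- move=> i; rewrite (ord1 i) emb_gn.
  by have := glue_gnr ins_hK ins_h'K x y ord0; rewrite -e /= gq => <-.
Qed.

(** The word of the fixed point [q] is 1, so the form on its block vanishes unless its type is (0,
    1), that is, unless [w] comes from [iota]. *)
Lemma moment_unit0 w (a : 'I_d.+1 -> A) : a q = 1 -> sp_perm w q = q ->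
  (forall x, w <> iota x) -> sp_moment phi a w = 0.
Proof.
move=> aq wq nw; rewrite /sp_moment (bigD1 (cl w q)) ?cl_mem //=.
rewrite -/(gn w q); have sB : stable (sp_perm w) (cl w q) := saturated_stable (saturated_cl _ _).
have [r tr _] := transversal_at sB (cl_id w q).
rewrite (phi_words hphi _ _ sB tr) /=.
have -> : word (sp_perm w) a q = 1.
  by rewrite /word (@orbit_head _ _ _ [::]) ?big_seq1 //= wq eqxx.
rewrite (sps_unit0 hphi) ?mul0r // size_map => -[gq /size0nil r0].
have [[x /nw] //|[//|]] := iota_split wq; apply.
apply/setP => i; rewrite in_set1; apply/idP/eqP => [iB|->]; last exact: cl_id.
have [_ _ /(_ i iB)[j + ij] _] := tr; rewrite r0 mem_seq1 => /eqP jq.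
by move: ij; rewrite jq porbit_fix // in_set1 => /eqP.
Qed.

Lemma moment_iota x (a : 'I_d.+1 -> A) : a q = 1 ->
  sp_moment phi a (iota x) = sp_moment phi (fun i => a (lift q i)) x.
Proof.
move=> aq; rewrite /iota moment_glue // (moment_emb1 hphi) /= aq (sps_unit hphi) mulr1.
by [].
Qed.

(** The cumulants with a unit at [q] are those without [q], extended by 0 off the image of [iota].
    The candidate is checked by applying zeta and comparing moments. *)
Lemma zeta_act_unit (a : 'I_d.+1 -> A) (f : surfperm d.+1 -> K) (g : surfperm d -> K) :
    a q = 1 -> zeta_act f = sp_moment phi a ->
    zeta_act g = sp_moment phi (fun i => a (lift q i)) ->
  f = fib iota g.
Proof.
move=> aq ef eg; apply/funext => w; apply: (@zeta_act_uniq K d.+1 xpredT f (fib iota g) _ _ w isT) => // {}w _.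
rewrite ef zeta_act_fib_iota eg.
have lq j y : sp_perm (lmul (tq j) (iota y)) q = j.
  have /sp_prodP[_ -> _] := lmulP (tq j) (iota y).
  by rewrite iota_perm emb_perm permM iotap_q tpermL.
(* The permutation of [lmul (tq j) (iota y)] sends [q] to [j], so a single [j] contributes at
   [w]. *)
rewrite (bigD1 (sp_perm w q)) //= big1 ?addr0 => [|j nj]; last first.
  by apply: fib_notin => y /= e; move: nj; rewrite -e lq eqxx.
have [j ej|ej] := unliftP q (sp_perm w q); last first.
  rewrite ej /tq tperm1 (eq_fib (G := iota) (g := sp_moment phi (fun i => a (lift q i)))) //; last first.
    by move=> y /=; rewrite lmul1.
  have [[x ex]|nx] := pselect (exists x, w = iota x).
    by rewrite ex fib_inj ?moment_iota //; [exact: iota_growing|exact: iota_inj].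
  rewrite fib_notin => [|y e]; last by apply: nx; exists y.
  by apply: moment_unit0 => // x ex; apply: nx; exists x.
rewrite ej; set F := lmul _ \o _.
have Fi : injective F.
  move=> x y e; have := congr1 (@sp_perm _) e.
  have pF z : sp_perm (F z) = (iotap (sp_perm z) * tq (lift q j))%g.
    by have /sp_prodP[_ -> _] := lmulP (tq (lift q j)) (iota z); rewrite iota_perm emb_perm.
  rewrite !pF => /mulIg/glue_perm_eq[exy _]; move: e; rewrite /F /= -(permKV (sp_perm x) j).
  by rewrite lmul_tq_iota exy lmul_tq_iota => /ins_inj.
have gF : growing F.
  by move=> x; rewrite (leq_trans (iota_growing x)) // lmul_growing.
(* With [lift q p] the predecessor of [q], the element [w] is an insertion of [q], and the letter 1
   at [q] leaves the moment unchanged. *)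
have [p ep] : exists p, sp_perm w (lift q p) = q.
  have := permKV (sp_perm w) q.
  case: (unliftP q ((sp_perm w)^-1%g q)) => [p ->|->]; first by exists p.
  by rewrite ej => /eqP; rewrite liftq_neq.
have [x ex] := ins_surj ep.
have jE : j = sp_perm x p by apply: (@lift_inj _ q); rewrite -ej ex ins_perm_q.
have -> : w = F x by rewrite /F /= jE lmul_tq_iota.
rewrite fib_inj // /F /= jE lmul_tq_iota; apply: moment_ins => //.
by rewrite aq mulr1.
Qed.

End InsertionMoments.
End Insertion.

(** * Vanishing of cumulants *)

Section SortedCycles.
Variable (d : nat) (s : {perm 'I_d}).

(** Writing the cycles of [s] one after the other conjugates [s] to the standard permutation with
    the same cycle lengths. *)
Lemma nth_cycles_next (x0 : 'I_d) (ls : seq (seq 'I_d)) i :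
  all (fun c => fcycle s c) ls -> (i < size (flatten ls))%N ->
  s (nth x0 (flatten ls) i) = nth x0 (flatten ls) (cycles_next (shape ls) i).
Proof.
elim: ls i => [|c ls IHls] i //= /andP[sc sls]; rewrite size_cat nth_cat => lti.
case: ltnP => [ltic|leci]; last first.
  by rewrite nth_cat ltnNge leq_addr /= addKn IHls // ltn_subLR.
case: c sc ltic {lti} => //= y c /(pathP x0) sc ltic.
have := sc i; rewrite size_rcons => /(_ ltic)/eqP.
rewrite -rcons_cons nth_rcons /= ltic => ->.
rewrite eqSS nth_rcons; have [->|ni] /= := eqVneq i (size c); first by rewrite ltnn.
have lt : (i < size c)%N by rewrite ltn_neqAle ni -ltnS.
by rewrite lt nth_cat lt.
Qed.

End SortedCycles.

Lemma cycles_next_start l i : (i < sumn l)%N ->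
  exists2 j, (j < size l)%N & exists n, i = iter n (cycles_next l) (sumn (take j l)).
Proof.
elim: l i => [|m l IHl] i //= lti; case: (ltnP i m) => [ltim|lemi].
  exists 0%N => //; exists i; rewrite /=.
  elim: i ltim {lti} => [|i IHi] ltim //=.
  by rewrite -IHi ?(ltnW ltim) // (ltn_eqF ltim).
have [|j ltj [n en]] := IHl (i - m)%N; first by rewrite ltn_subLR.
exists j.+1 => //; exists n => /=.
rewrite -{1}(subnKC lemi) en; elim: n {en} => [|n IHn] //=.
by rewrite -IHn ltnNge leq_addr /= addKn.
Qed.

(** Every cycle contains the starting index of some part. Empty parts contribute no cycle of their
    own, whence an inequality. *)
Lemma card_porbits_cycles d (l : seq nat) (hl : sumn l = d) :
  (#|porbits (cycles_perm hl)| <= size l)%N.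
Proof.
pose c (j : 'I_(size l)) : {set 'I_d} := [set x : 'I_d |
  [exists y : 'I_d, (val y == sumn (take j l)) && (x \in porbit (cycles_perm hl) y)]].
have sub : porbits (cycles_perm hl) \subset c @: [set: 'I_(size l)].
  apply/subsetP => _ /imsetP[x _ ->].
  have ltx : (x < sumn l)%N by rewrite hl.
  have [j ltj [n en]] := cycles_next_start ltx.
  have ltt : (sumn (take j l) < d)%N.
    rewrite ltnNge; apply/negP => le.
    (* A start at or beyond [d], as for trailing empty parts, is fixed by [cycles_next] and cannot
       lead to [x]. *)
    have fixed m i : (d <= i)%N -> iter m (cycles_next l) i = i.
      move=> lei; elim: m => //= m ->; move: lei; rewrite -hl.
      elim: (l) (i) => //= k l' IH i'; case: ltnP => [lt1 le1|le1 le2].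
        by move: (leq_trans lt1 (leq_trans (leq_addr (sumn l') k) le1)); rewrite ltnn.
      by rewrite IH ?subnKC // leq_subRL.
    by move: (ltn_ord x); rewrite ltnNge en fixed // le.
  pose y := Ordinal ltt; have xy : x \in porbit (cycles_perm hl) y.
    apply/porbitP; exists n; apply: val_inj; rewrite [LHS]en.
    rewrite -/(val y); elim: n {en} => [|n IHn] /=; first by rewrite expg0 perm1.
    by rewrite expgSr permM IHn permE.
  apply/imsetP; exists (Ordinal ltj); rewrite ?in_setT //; apply/setP => z.
  have -> : porbit (cycles_perm hl) x = porbit (cycles_perm hl) y.
    by apply/eqP; rewrite eq_porbit_mem.
  rewrite finset.inE; apply/idP/existsP => [zy|[y' /andP[/eqP e]]].
    by exists y; rewrite zy eqxx.
  by rewrite (_ : y' = y) //; apply: val_inj.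
by apply: leq_trans (subset_leq_card sub) _; rewrite (leq_trans (leq_imset_card _ _)) // cardsT card_ord.
Qed.

Section SpTop.
Variables (d : nat) (s : {perm 'I_d.+1}) (G : nat).

Lemma sp_top_cl i : cl (sp_top s G) i = [set: 'I_d.+1].
Proof.
by have := cl_mem (sp_top s G) i; rewrite /sp_part /= in_set1 => /eqP.
Qed.

Lemma sp_top_perm : sp_perm (sp_top s G) = s. Proof. by []. Qed.

Lemma sp_top_gn i : gn (sp_top s G) i = G.
Proof. by rewrite /gn sp_top_cl /sp_genus /= ffunE eqxx. Qed.

End SpTop.

Lemma typ_le_trans (t t' : typ) (t0 : typ_ext) : typ_le t t0 ->
  (typ_genus t' <= typ_genus t)%N ->
  (typ_genus t' + (typ_num t').*2 <= typ_genus t + (typ_num t).*2)%N -> typ_le t' t0.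
Proof. by case: t0 => [u|G|] //=; lia. Qed.

Section Freeness.
Variables (K : fieldType) (A : algType K) (phi : nat -> seq A -> K).
Hypothesis hphi : is_sps phi.
Variables (I : Type) (t0 : typ_ext).

Let kap d (a : 'I_d -> A) : surfperm d -> K := sp_cumulant phi a.

(** Freeness for one tuple, whose arguments may lie outside the given sets: this is what the
    induction carries. *)
Definition tops_vanish d (i : 'I_d.+1 -> I) (a : 'I_d.+1 -> A) : Prop :=
  forall t : typ, typ_le t t0 -> forall (k : seq nat) (hk : sumn k = d.+1),
    size k = typ_num t -> all (leq 1) k -> (exists p q, i p <> i q) ->
  free_cumulant phi (typ_genus t) hk a = 0.

Lemma cumulant_glue m n d (h : 'I_m + 'I_n -> 'I_d) h' (hK : cancel h h') (h'K : cancel h' h)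
    (a : 'I_d -> A) w1 w2 :
  kap a (glue hK h'K w1 w2) =
  kap (fun i => a (h (inl i))) w1 * kap (fun j => a (h (inr j))) w2.
Proof.
by apply: multiplicative_glue => x1 x2; rewrite !zeta_act_cumulant // moment_glue.
Qed.

(** The cumulant factors over the block and its complement. Listing the block cycle by cycle, in
    decreasing length, turns its factor into a free cumulant of a subtuple. *)
Lemma block_vanish d (i : 'I_d -> I) (a : 'I_d -> A) w x t :
    (forall m (f : 'I_m.+1 -> 'I_d), injective f -> tops_vanish (i \o f) (a \o f)) ->
    gn w x = typ_genus t -> #|porbits (sp_perm w) ::&: cl w x| = typ_num t -> typ_le t t0 ->
    (exists p q, [/\ p \in cl w x, q \in cl w x & i p <> i q]) ->
  kap a w = 0.
Proof.
move=> van gt nt tt0 [p [q [px qx ipq]]].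
set B := cl w x; set s := sp_perm w.
have sB : stable s B := saturated_stable (saturated_cl w x).
have [ur rB cr ir] := reps_transversal sB.
pose ls0 := [seq fingraph.orbit s y | y <- reps s B].
(* The cycles are sorted by length because [free_cumulant] uses the decreasing rearrangement of
   [k]. *)
pose k := map size ls0; pose ls := sort (relpre size geq) ls0.
have ek : shape ls = sort geq k by rewrite /shape /k sort_map.
have pls : perm_eq ls ls0 by rewrite perm_sort.
have memL y : (y \in flatten ls) = (y \in B).
  rewrite (perm_mem (perm_flatten pls)); apply/flatten_mapP/idP => [[z rz]|yB].
    by rewrite mem_orbit_porbit => /(stable_mem sB) ->; apply: rB.
  by have [z rz zy] := cr y yB; exists z; rewrite // mem_orbit_porbit.
have uL : uniq (flatten ls).
  rewrite (perm_uniq (perm_flatten pls)) /ls0; move: (reps s B) ur ir {rB cr ls0 k ls ek pls memL}.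
  elim=> [|z r IHr] //= /andP[zr ur] ir; rewrite cat_uniq orbit_uniq /= IHr //; last first.
    by move=> u v ru rv; apply: ir; rewrite in_cons (ru, rv) orbT.
  rewrite andbT; apply/hasPn => y /flatten_mapP[u ru yu]; apply/negP => yz.
  have : z = u.
    apply: ir; rewrite ?mem_head // ?in_cons ?ru ?orbT //.
    move: yu yz; rewrite !mem_orbit_porbit -!eq_porbit_mem => /eqP <- /eqP <-.
    by rewrite eqxx.
  by move=> e; rewrite e ru in zr.
have sizeL : size (flatten ls) = #|B|.
  by rewrite -(card_uniqP uL); apply: eq_card.
have B_gt0 : (0 < #|B|)%N by apply/card_gt0P; exists p.
pose m := #|B|.-1; have em : m.+1 = #|B| by rewrite prednK.
have cyc : all (fun c => fcycle s c) ls.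
  rewrite (perm_all _ pls); apply/allP => _ /mapP[y _ ->]; apply: cycle_orbit; exact: perm_inj.
have hk : sumn k = m.+1.
  by rewrite em -sizeL size_flatten ek; apply/esym/perm_sumn; rewrite perm_sort.
pose n := #|~: B|.
(* The block comes first, in the order of its sorted cycles; the order of the complement is
   immaterial. *)
pose h (z : 'I_m.+1 + 'I_n) : 'I_d :=
  match z with inl j => nth x (flatten ls) j | inr j => enum_val j end.
have ltL (j : 'I_m.+1) : (j < size (flatten ls))%N by rewrite sizeL -em.
have h_inj : injective h.
  move=> [j|j] [l|l] /=.
  - by move=> /eqP; rewrite nth_uniq // => /eqP/val_inj ->.
  - move=> e; have := enum_valP l; rewrite -e in_setC.
    by rewrite -memL mem_nth.
  - move=> e; have := enum_valP j; rewrite e in_setC.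
    by rewrite -memL mem_nth.
  - by move=> /enum_val_inj ->.
have [h' hK h'K] : bijective h.
  apply: inj_card_bij h_inj _.
  by rewrite card_sum !card_ord em /n cardsC card_ord.
have hl_B j : h (inl j) \in B by rewrite -memL mem_nth.
have hr_B j : h (inr j) \notin B by have := enum_valP j; rewrite in_setC.
have eB : glue_left h = B.
  apply/setP; apply: (glueP h'K) => j.
    by rewrite (glue_leftl h) hl_B.
  by rewrite (negbTE (glue_leftr hK j)) (negbTE (hr_B j)).
have sw : saturated w (glue_left h) by rewrite eB; apply: saturated_cl.
have [w1 [w2 ew]] := proj1 (glue_split hK h'K w) sw.
rewrite ew cumulant_glue; apply/eqP; rewrite mulf_eq0; apply/orP; left; apply/eqP.
have clh j : cl w (h (inl j)) = B by apply: cl_trans; apply: hl_B.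
have -> : w1 = sp_top (cycles_perm (sumn_sort hk)) (typ_genus t).
  apply: sp_ext => [j||j].
  - rewrite sp_top_cl; apply/setP => l; rewrite in_setT.
    have f_inj : injective (fun j => h (inl j)) by move=> ? ? /h_inj[].
    by rewrite -(mem_imset _ _ f_inj) -(glue_cll hK h'K w1 w2) -ew clh hl_B.
  - rewrite sp_top_perm; apply/permP => j.
    have : h (inl (sp_perm w1 j)) = s (h (inl j)).
      by rewrite /s ew glue_sp_perm glue_perml.
    rewrite /= (nth_cycles_next _ cyc) // => /eqP; rewrite nth_uniq //; last first.
      by rewrite sizeL -em ek; apply: (cycles_next_ord (sumn_sort hk)).
    by move=> /eqP e; apply: val_inj; rewrite /= e ek permE.
  - rewrite sp_top_gn -gt -(glue_gnl hK h'K w1 w2) -ew /gn clh.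
    by [].
apply: (van m (fun j => h (inl j))) => //.
- by move=> ? ? /h_inj[].
- rewrite -nt /k !size_map; rewrite -(size_map (porbit s)).
  rewrite -(card_uniqP _); last first.
    by rewrite map_inj_in_uniq // => u v ru rv /eqP; rewrite eq_sym eq_porbit_mem; apply: ir.
  apply: eq_card => C; rewrite finset.inE; apply/mapP/andP => [[u ru ->]|[/imsetP[u _ ->] uB]].
    by split; [exact: imset_f|exact: stable_porbit (rB u ru)].
  have uB' : u \in B by apply: (subsetP uB); apply: porbit_id.
  have [v rv vu] := cr u uB'; exists v => //; apply/eqP.
  by rewrite eq_porbit_mem.
- by apply/allP => _ /mapP[_ /mapP[y _ ->] ->]; rewrite size_orbit fingraph.order_gt0.
- have inB y : y \in B -> exists j, h (inl j) = y.
    move=> yB; have := memL y; rewrite yB => /(nthP x)[j ltj <-].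
    by rewrite sizeL -em in ltj; exists (Ordinal ltj).
  have [[jp ejp] [jq ejq]] := (inB p px, inB q qx).
  by exists jp, jq; rewrite -[(_ \o _) jp]/(i (h (inl jp))) -[(_ \o _) jq]/(i (h (inl jq))) ejp ejq.
Qed.

(** The zeta action is linear and injective, so cumulants inherit linearity from moments. *)
Lemma tops_vanish_linear d i (a b c : 'I_d.+1 -> A) p (r : K) :
    a p = r *: b p + c p -> (forall j, j != p -> a j = b j /\ a j = c j) ->
  tops_vanish i b -> tops_vanish i c -> tops_vanish i a.
Proof.
move=> ap anp vb vc t tt0 k hk sk ak mix.
have kE : kap a = (fun w => r * kap b w + kap c w).
  apply/funext => w.
  apply: (@zeta_act_uniq K d.+1 xpredT _ (fun w => r * kap b w + kap c w) _ _ w isT) => // {}w _.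
  rewrite zeta_act_cumulant (moment_linear hphi w ap anp) -!zeta_act_cumulant.
  rewrite /zeta_act mulr_sumr -big_split; apply: eq_bigr => s _ /=.
  by rewrite /fib mulr_sumr -big_split.
rewrite /free_cumulant -/(kap a) kE.
by have := vb t tt0 k hk sk ak mix; have := vc t tt0 k hk sk ak mix;
  rewrite /free_cumulant -/(kap b) -/(kap c) => -> ->; rewrite mulr0 addr0.
Qed.

(** The cumulants live on the image of [iota], where [p] is a block by itself; a mixed tuple has
    another point, so the one-block element is not in that image. *)
Lemma tops_vanish_unit d i (a : 'I_d.+1 -> A) p : a p = 1 -> tops_vanish i a.
Proof.
move=> ap t tt0 k hk sk ak [j1 [j2 ij]].
rewrite /free_cumulant (zeta_act_unit hphi ap (zeta_act_cumulant phi a) (zeta_act_cumulant phi _)).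
apply: fib_notin => y e.
have [j jp] : exists j, j != p.
  have [e1|n1] := eqVneq j1 p; last by exists j1.
  by exists j2; apply/eqP => e2; apply: ij; rewrite e1 e2.
have sp : saturated (iota p y) [set p].
  rewrite iota_sat (_ : finset _ = finset.set0); last first.
    by apply/setP => l; rewrite !finset.inE liftq_neq.
  by apply/saturatedP => l; rewrite finset.inE.
have /saturatedP/(_ p (set11 p)) := sp; rewrite e sp_top_cl => /subsetP/(_ j (in_setT j)).
by rewrite in_set1 (negbTE jp).
Qed.

Lemma tops_vanish_split d (i : 'I_d.+1 -> I) (a : 'I_d.+1 -> A) p
    (i' : 'I_d.+2 -> I) (a' : 'I_d.+2 -> A) (q : 'I_d.+2) :
    a p = a' (lift q p) * a' q -> (forall j, j != p -> a j = a' (lift q j)) ->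
    (forall j, i' (lift q j) = i j) -> i' q = i p ->
    (forall m (f : 'I_m.+1 -> 'I_d.+2), injective f -> tops_vanish (i' \o f) (a' \o f)) ->
  tops_vanish i a.
Proof.
move=> ap anp i'l i'q van t tt0 k hk sk ak [j1 [j2 ij]].
rewrite /free_cumulant -/(kap a).
set g := cycles_perm _; set G := typ_genus t; set x := sp_top g G.
rewrite (zeta_act_ins (p := p) (f := kap a') (q := q)); last first.
  by move=> y; rewrite !zeta_act_cumulant // (moment_ins hphi _ ap anp).
rewrite big1 // => j _; rewrite /fib big1 // => y /eqP; set W := ins q p x => eW.
set T := [set: 'I_d.+2]; set N := #|porbits g|.
have extT : ext q p [set: 'I_d.+1] = T.
  by apply/setP; apply: (liftqP (q := q)) => [l|]; rewrite ?mem_ext_lift ?mem_ext_q !in_setT.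
have clW z : cl W z = T.
  move: z; apply: (liftqP (q := q)) => [l|]; first by rewrite ins_cl sp_top_cl extT.
  by rewrite ins_cl_q ins_cl sp_top_cl extT.
have gnW : gn W q = G by rewrite ins_gn_q sp_top_gn.
have ncW : ncyc (sp_perm W) T = N%:R.
  by have := ncyc_ins q p x p; rewrite sp_top_cl extT => ->; rewrite ncycT.
have Nk : (N <= typ_num t)%N.
  by rewrite -sk -(size_sort geq k); apply: card_porbits_cycles.
have mixT : i' (lift q j1) <> i' (lift q j2) by rewrite !i'l.
have cyc_pos (v : surfperm d.+2) z : (0 < #|porbits (sp_perm v) ::&: cl v z|)%N.
  apply/card_gt0P; exists (porbit (sp_perm v) z).
  by rewrite finset.inE porbit_cl imset_f.
have ncl (v : surfperm d.+2) z : ncyc (sp_perm v) (cl v z) = #|porbits (sp_perm v) ::&: cl v z|%:R.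
  by rewrite ncycE // saturated_stable ?saturated_cl.
have vanish (v : surfperm d.+2) z : (gn v z <= G)%N ->
    (gn v z + #|porbits (sp_perm v) ::&: cl v z|.*2 <= G + N.*2)%N ->
    (exists z1 z2, [/\ z1 \in cl v z, z2 \in cl v z & i' z1 <> i' z2]) -> kap a' v = 0.
  move=> le1 le2 mix; pose t' := Typ (gn v z) (cyc_pos v z).
  apply: (@block_vanish _ i' a' v z t') => //.
  by apply: typ_le_trans tt0 _ _ => //=; apply: leq_trans le2 _; rewrite leq_add2l leq_double.
(* For [j = q] the permutation [tq j] is the identity and [y] is [W], a single block with the genus
   and the number of cycles of [x]. *)
have [ejq|njq] := eqVneq j q.
  move: eW; rewrite ejq /tq tperm1 lmul1 => ->.
  apply: (vanish W q); rewrite ?gnW //; last by exists (lift q j1), (lift q j2); rewrite clW !in_setT.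
  rewrite leq_add2l leq_double -(ler_nat rat) -ncl clW ncW //.
have /sp_prodP[satW pW wW] := lmulP (tq q j) y.
rewrite eW emb_perm in satW pW wW.
have satWT : saturated W T := saturatedT W.
have wsW := wW T satWT.
have := wsize_cl W q; rewrite clW ncW gnW wsW tperm_wsize ?[q == j]eq_sym //; last first.
  by rewrite stable_tperm !in_setT.
rewrite in_setT /= => wsy.
have stT : stable (sp_perm y) T := stableT _.
have nqj : q != j by rewrite eq_sym.
have ncy := ncyc_tperm stT (in_setT q) (in_setT j) nqj.
rewrite -/(tq q j) -pW ncW in ncy.
have satq (E : {set 'I_d.+2}) : q \in E -> j \in E -> saturated y E -> E = T.
  move=> qE jE sE; apply/eqP; rewrite eqEsubset subsetT /= -(clW q).
  have : saturated W E by rewrite satW emb_sat stable_tperm qE jE sE.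
  by move/saturatedP; apply.
have [jq|jq] := boolP (j \in cl y q).
  have clT : cl y q = T by apply: satq; rewrite ?cl_id ?saturated_cl.
  move: wsy; rewrite -clT wsize_cl clT => wsy.
  have nT := ncl y q; rewrite clT in nT; rewrite nT in wsy ncy.
  have e1 : (1 + (#|porbits (sp_perm y) ::&: T| + gn y q) = N + G)%N.
    by apply/eqP; rewrite -(eqr_nat rat) !natrD; apply/eqP; lra.
  (* Either the transposition cuts a cycle of [y] and the genus is kept, or it joins two and the
     doubled genus of [y] is [G] minus 2; both types are below that of [x]. *)
  have e2 : (N = #|porbits (sp_perm y) ::&: T| + 1 \/ N + 1 = #|porbits (sp_perm y) ::&: T|)%N.
    move: ncy; case: ifP => _ ncy; [left|right]; apply/eqP; rewrite -(eqr_nat rat) natrD; apply/eqP; lra.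
  apply: (vanish y q); rewrite ?clT; [lia|lia|].
  by exists (lift q j1), (lift q j2); rewrite !in_setT.
have dis := cl_disjoint jq.
have clU : cl y q :|: cl y j = T.
  apply: satq; rewrite ?in_setU ?cl_id ?orbT //.
  by apply/saturatedP => l; rewrite in_setU => /orP[] /cl_trans ->; rewrite ?subsetUl ?subsetUr.
have cardT : #|T|%:R = #|cl y q|%:R + #|cl y j|%:R :> rat.
  by rewrite -clU -natrD -!sum1_card big_disjointU.
have wsU : wsize y T = wsize y (cl y q) + wsize y (cl y j) by rewrite -clU /wsize big_disjointU.
have ncU : ncyc (sp_perm y) T = ncyc (sp_perm y) (cl y q) + ncyc (sp_perm y) (cl y j).
  by rewrite -clU /ncyc big_disjointU.
have jporb : j \in porbit (sp_perm y) q = false.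
  by apply: contraNF jq => /(subsetP (porbit_cl _ _)).
rewrite jporb ncU !ncl in ncy; rewrite wsU cardT !wsize_cl !ncl in wsy.
have := cyc_pos y q; have := cyc_pos y j.
move: ncy wsy; set n1 := #|_|; set n2 := #|_| => ncy wsy n2_gt0 n1_gt0.
(* Each block has at least one cycle, hence at most [N], and neither genus exceeds [G]. *)
have e1 : (n1 + n2 = N + 1)%N by apply/eqP; rewrite -(eqr_nat rat) !natrD; apply/eqP; lra.
have e2 : (gn y q + gn y j = G)%N by apply/eqP; rewrite -(eqr_nat rat) !natrD; apply/eqP; lra.
have [mix|nmix1] := pselect (exists z1 z2, [/\ z1 \in cl y q, z2 \in cl y q & i' z1 <> i' z2]).
  by apply: (vanish y q) => //; rewrite -/n1; lia.
have [mix|nmix2] := pselect (exists z1 z2, [/\ z1 \in cl y j, z2 \in cl y j & i' z1 <> i' z2]).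
  by apply: (vanish y j) => //; rewrite -/n2; lia.
have const1 z : z \in cl y q -> i' z = i' q.
  by move=> zq; apply: contrapT => ne; apply: nmix1; exists z, q; rewrite zq cl_id.
(* [W] sends [lift q p] to [q] and is [y] followed by (q j), so [y] sends [lift q p] to [j]. The two
   blocks thus contain [q] and [lift q p], which carry the same index: if neither block were mixed,
   the tuple would not be. *)
have pj : lift q p \in cl y j.
  have := ins_perm_lift q p x p; rewrite eqxx -/W pW permM => e.
  have : sp_perm y (lift q p) = j by apply: (@perm_inj _ (tq q j)); rewrite e tpermR.
  by move=> <-; rewrite cl_sym perm_cl.
have const2 z : z \in cl y j -> i' z = i' q.
  move=> zj; rewrite i'q -i'l; apply: contrapT => ne; apply: nmix2.
  by exists z, (lift q p); rewrite zj pj.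
have const z : i' z = i' q.
  have : z \in T by rewrite in_setT.
  by rewrite -clU in_setU => /orP[/const1|/const2].
by case: mixT; rewrite !const.
Qed.

End Freeness.

(** * Generated subalgebras *)

Local Open Scope classical_set_scope.

Section Generated.
Variables (K : fieldType) (A : algType K) (phi : nat -> seq A -> K).
Hypothesis hphi : is_sps phi.
Variables (I : Type) (X : I -> set A) (t0 : typ_ext).
Hypothesis freeX : is_free phi X t0.

Let gen (i : I) : set A := gen_subalg (X i).

Lemma sub_gen i x : X i x -> gen i x.
Proof. by move=> Xx S [_]; apply. Qed.

Let bad d (i : 'I_d -> I) (a : 'I_d -> A) : {set 'I_d} :=
  [set p | ~~ `[< X (i p) (a p) >]]%SET.

Lemma bad_comp m d (f : 'I_m -> 'I_d) (D : {set 'I_m}) i a N :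
    injective f -> (#|[set p in bad i a | p \in f @: D]%SET| <= N)%N ->
  (#|bad (i \o f) (a \o f) :&: D| <= N)%N.
Proof.
move=> fi; apply: leq_trans; rewrite -(card_imset _ fi); apply: subset_leq_card.
apply/subsetP => _ /imsetP[p + ->]; rewrite !finset.inE /= => /andP[-> pD].
by rewrite imset_f.
Qed.

Let good N : Prop := forall d (i : 'I_d.+1 -> I) a,
  (forall p, gen (i p) (a p)) -> (#|bad i a| <= N)%N -> tops_vanish phi t0 i a.

(* [z] may fill a slot of index [i0] next to at most [N] slots outside the generating sets. *)
Let fills N i0 (z : A) : Prop := forall d (i : 'I_d.+1 -> I) a p,
  i p = i0 -> a p = z -> (forall r, r != p -> gen (i r) (a r)) ->
  (#|bad i a :\ p| <= N)%N -> tops_vanish phi t0 i a.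

Lemma fills_linear N i0 c x y : fills N i0 x -> fills N i0 y -> fills N i0 (c *: x + y).
Proof.
move=> gx gy d i a p ip ap ga ba.
pose b z r := if r == p then z else a r.
have bE z r : r != p -> b z r = a r by rewrite /b => /negbTE ->.
have fb z : fills N i0 z -> tops_vanish phi t0 i (b z).
  move=> gz; apply: (gz d i (b z) p) => //; first by rewrite /b eqxx.
    by move=> r rp; rewrite bE //; apply: ga.
  suff -> : bad i (b z) :\ p = bad i a :\ p by [].
  by apply/setP => r; rewrite !finset.inE; case: eqVneq => //= rp; rewrite bE.
apply: (tops_vanish_linear hphi (p := p) (r := c) (b := b x) (c := b y)).
- by rewrite ap /b eqxx.
- by move=> r rp; rewrite !bE.
- exact: fb.
- exact: fb.
Qed.

Lemma fills_unit N i0 : fills N i0 1.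
Proof. by move=> d i a p _ ap _ _; apply: tops_vanish_unit ap. Qed.

(** The factors get separate slots: [x] is a generator and costs nothing, and [z] sits at the new
    point [q]. A subtuple containing [q] is handled by the assumption on [z], any other by
    [good N]. *)
Lemma fills_mul N i0 x z : good N -> X i0 x -> fills N i0 z -> fills N i0 (x * z).
Proof.
move=> gN Xx gz d i a p ip ap ga ba; pose q : 'I_d.+2 := ord0.
pose a' (r : 'I_d.+2) := if unlift q r is Some j then (if j == p then x else a j) else z.
pose i' (r : 'I_d.+2) := if unlift q r is Some j then i j else i p.
have a'l j : a' (lift q j) = if j == p then x else a j by rewrite /a' liftK.
have i'l j : i' (lift q j) = i j by rewrite /i' liftK.
have a'q : a' q = z by rewrite /a' unlift_none.
have i'q : i' q = i p by rewrite /i' unlift_none.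
have ba' : (#|bad i' a' :\ q| <= N)%N.
  apply: leq_trans ba; rewrite -(card_imset _ (@lift_inj _ q)); apply: subset_leq_card.
  apply/subsetP => r; case: (unliftP q r) => [j ->|->]; rewrite !finset.inE ?eqxx //.
  move=> /andP[_]; rewrite i'l a'l; have [->|jp bj] := eqVneq j p.
    by rewrite ip (asboolT Xx).
  by rewrite imset_f // !finset.inE jp.
have ga' j : gen (i' (lift q j)) (a' (lift q j)).
  rewrite i'l a'l; have [->|jp] := eqVneq j p; last exact: ga.
  by rewrite ip; apply: sub_gen.
apply: (tops_vanish_split hphi (p := p) (q := q) (i' := i') (a' := a')) => //.
- by rewrite a'l a'q eqxx.
- by move=> j jp; rewrite a'l (negbTE jp).
move=> m f fi; have [[r fr]|nq] := pselect (exists r, f r = q).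
  apply: (gz m _ _ r); rewrite /= ?fr //.
  - by rewrite i'q.
  - move=> l lr; have := inj_eq fi l r; rewrite (negbTE lr) fr.
    by case: (unliftP q (f l)) => [j ->|->]; rewrite ?eqxx.
  - rewrite setDE; apply: (bad_comp fi); apply: leq_trans ba'; apply: subset_leq_card.
    apply/subsetP => l; rewrite !finset.inE => /andP[bl /imsetP[k kr el]].
    rewrite bl andbT el -fr (inj_eq fi).
    by move: kr; rewrite in_setC in_set1.
have nqf l : f l != q by apply/eqP => e; apply: nq; exists l.
apply: gN.
- by move=> l /=; have := nqf l; case: (unliftP q (f l)) => [j ->|->]; rewrite ?eqxx.
- rewrite -[bad _ _]setIT; apply: (bad_comp fi); apply: leq_trans ba'; apply: subset_leq_card.
  apply/subsetP => l; rewrite !finset.inE => /andP[bl /imsetP[k _ el]].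
  by rewrite bl andbT el nqf.
Qed.

(** Elements that fill a slot are not visibly closed under products, so the subalgebra exhibited is
    that of the [x] whose left multiplication preserves them; applied to the unit, it gives the
    claim. *)
Lemma gen_fills N i0 z : good N -> gen i0 z -> fills N i0 z.
Proof.
move=> gN gz.
pose M : set A := [set x | forall u, fills N i0 u -> fills N i0 (x * u)].
suff : M z by move=> /(_ 1 (@fills_unit N i0)); rewrite mulr1.
apply: gz; split; last by move=> x Xx u; apply: fills_mul.
split=> [|c x y /set_mem Mx /set_mem My|x y /set_mem Mx /set_mem My]; apply/mem_set.
- by move=> u; rewrite mul1r.
- move=> u gu; rewrite mulrDl -scalerAl; apply: fills_linear; [exact: Mx|exact: My].
- by move=> u gu; rewrite -mulrA; apply/Mx/My.
Qed.

(** Induction on the number of arguments outside the generating sets; one of them is singled out,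
    and the others number at most [N]. *)
Lemma all_good N : good N.
Proof.
elim: N => [|N IHN] d i a ga ba.
  have Xa p : X (i p) (a p).
    move: ba; rewrite leqn0 cards_eq0 => /eqP/setP/(_ p); rewrite !finset.inE.
    by move=> /negbFE/asboolP.
  by move=> t tt0 k hk sk ak mix; apply: (freeX tt0 (i := i)).
have [b0|[p bp]] := set_0Vmem (bad i a).
  by apply: IHN => //; rewrite b0 cards0.
apply: (gen_fills IHN (ga p) (p := p)) => //.
by move: ba; rewrite (cardsD1 p) bp.
Qed.

Lemma is_free_gen : is_free phi gen t0.
Proof.
move=> t tt0 d i a ga k hk sk ak mix.
exact: (all_good (N := #|bad i a|) ga (leqnn _) tt0).
Qed.

End Generated.

Theorem proposition5p24 (R : realType) (A : algType (complex R))
    (phi : nat -> seq A -> complex R) (hphi : is_sps phi)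
    (I : Type) (X : I -> set A) (t0 : typ_ext) :
  is_free phi X t0 <-> is_free phi (fun i => gen_subalg (X i)) t0.
Proof.
split=> [freeX|freeG]; first exact: is_free_gen.
move=> t tt0 d i a Xa; apply: freeG => // p; exact: sub_gen.
Qed.
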